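(* For each pair $J,U>0$ there exist $\beta_c^{\tau},\beta_c^{\tau\tau'}\in(0,\infty)$ such that: (a) for every $0<\beta<\beta_c^{\tau}$ there is $c>0$ with $\langle\tau_0\tau_x\rangle^{+,+}_{\beta J,\beta U}\le e^{-c\|x\|}$ for all $x\in\mathbb{Z}^2$, and for every $\beta>\beta_c^{\tau}$ there is $C>0$ with $\langle\tau_0\tau_x\rangle^{+,+}_{\beta J,\beta U}\ge C$ for all $x\in\mathbb{Z}^2$; (b) for every $0<\beta<\beta_c^{\tau\tau'}$ there is $c>0$ with $\langle\tau_0\tau'_0\tau_x\tau'_x\rangle^{+,+}_{\beta J,\beta U}\le e^{-c\|x\|}$ for all $x\in\mathbb{Z}^2$, and for every $\beta>\beta_c^{\tau\tau'}$ there is $C>0$ with $\langle\tau_0\tau'_0\tau_x\tau'_x\rangle^{+,+}_{\beta J,\beta U}\ge C$ for all $x\in\mathbb{Z}^2$.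
   Context: **Ashkin--Teller (AT) model on $\mathbb{Z}^2$.** For a finite subgraph $\Omega=(V,E)$ of $\mathbb{Z}^2$ and $J,U>0$, $\mathsf{AT}_{\Omega,J,U}$ is the probability measure on pairs $(\tau,\tau')\in\{\pm1\}^V\times\{\pm1\}^V$ given by $$\mathsf{AT}_{\Omega,J,U}(\tau,\tau')=\frac1Z\exp\Big[\sum_{uv\in E}J\tau_u\tau_v+J\tau'_u\tau'_v+U\tau_u\tau'_u\tau_v\tau'_v\Big],$$ with $Z$ the normalizing constant. $\partial\Omega$ is the set of vertices of $\Omega$ adjacent to at least one vertex of $\mathbb{Z}^2\setminus\Omega$. The plus measure is $\mathsf{AT}^{+,+}_{\Omega,J,U}:=\mathsf{AT}_{\Omega,J,U}(\,\cdot\mid \tau_u=\tau'_u=1\ \forall u\in\partial\Omega)$. The weak limit $\mathsf{AT}^{+,+}_{J,U}$ of $\mathsf{AT}^{+,+}_{\Omega_n,J,U}$ as $\Omega_n\nearrow\mathbb{Z}^2$ (e.g. $\Omega_n=[-n,n]^2\cap\mathbb{Z}^2$) exists and does not depend on $\{\Omega_n\}$; its expectation is denoted $\langle\cdot\rangle^{+,+}_{J,U}$. $\|\cdot\|$ is a fixed norm on $\mathbb{R}^2$. *)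

(* Defs.v *)
From HB Require Import structures.
From mathcomp Require Import all_boot all_order all_algebra finmap zify.
From mathcomp Require Import all_classical all_reals all_analysis.

Set Implicit Arguments.
Unset Strict Implicit.
Unset Printing Implicit Defensive.

Import Order.TTheory GRing.Theory Num.Theory.
Import numFieldNormedType.Exports.

Local Open Scope classical_set_scope.
Local Open Scope ring_scope.

Notation vertex := (int * int)%type.

Definition origin : vertex := (0, 0).

Definition neighbours (u : vertex) : seq vertex :=
  [:: (u.1 + 1, u.2); (u.1 - 1, u.2); (u.1, u.2 + 1); (u.1, u.2 - 1)].

Definition forward_neighbours (u : vertex) : seq vertex :=
  [:: (u.1 + 1, u.2); (u.1, u.2 + 1)].

(* A finite vertex set V stands for the subgraph of Z^2 it induces. Each
   unoriented edge is listed once, oriented to the right or upwards. *)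
Definition edges (V : {fset vertex}) : {fset vertex * vertex} :=
  [fset e in V `*` V | e.2 \in forward_neighbours e.1]%fset.

Definition boundary (V : {fset vertex}) : {fset vertex} :=
  [fset u in V | has (fun v => v \notin V) (neighbours u)]%fset.

Definition interval_seq (n : nat) : seq int :=
  [seq i%:Z - n%:Z | i <- iota 0 n.*2.+1].

Definition box (n : nat) : {fset vertex} :=
  [fset u in [seq (i, j) | i <- interval_seq n, j <- interval_seq n]]%fset.

Lemma mem_interval_seq (n : nat) (i : int) :
  (i \in interval_seq n) = (`|i| <= n%:Z).
Proof.
apply/mapP/idP => [[k]|ni].
  by rewrite mem_iota => kn ->; lia.
exists (absz (i + n%:Z)); last by lia.
by rewrite mem_iota; lia.
Qed.

Lemma in_box (n : nat) (u : vertex) :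
  (u \in box n) = (`|u.1| <= n%:Z) && (`|u.2| <= n%:Z).
Proof.
rewrite -!mem_interval_seq in_fset; apply/allpairsP/andP.
  by move=> [[i j] /= [iP jP ->]].
by move=> [u1 u2]; exists u; split=> //; case: (u).
Qed.

(* A pair of spins is a pair of booleans, true standing for +1. *)
Definition config : Type := vertex -> (bool * bool)%type.

Definition tau {R : realType} (s : config) (u : vertex) : R :=
  if (s u).1 then 1 else -1.
Definition tau' {R : realType} (s : config) (u : vertex) : R :=
  if (s u).2 then 1 else -1.

(* The values outside V enter neither the energy nor, for a given cylinder
   event, the finite-volume probabilities in large enough boxes. *)
Definition extend (V : {fset vertex}) (s : {ffun V -> bool * bool}) : config :=
  fun u => if insub u is Some v then s v else (true, true).

Definition AT_weight {R : realType} (V : {fset vertex}) (J U : R)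
    (s : config) : R :=
  expR (\sum_(e <- edges V)
    (J * tau s e.1 * tau s e.2 + J * tau' s e.1 * tau' s e.2
     + U * tau s e.1 * tau' s e.1 * tau s e.2 * tau' s e.2)).

Definition AT_partition {R : realType} (V : {fset vertex}) (J U : R) : R :=
  \sum_(s : {ffun V -> bool * bool}) AT_weight V J U (extend s).

Definition AT {R : realType} (V : {fset vertex}) (J U : R) (A : set config) : R :=
  \sum_(s : {ffun V -> bool * bool} | extend s \in A)
    (AT_weight V J U (extend s) / AT_partition V J U).

Definition plus_boundary (R : realType) (V : {fset vertex}) : set config :=
  [set s | forall u, u \in boundary V -> tau s u = 1 :> R /\ tau' s u = 1 :> R].

Definition AT_plus {R : realType} (V : {fset vertex}) (J U : R)
    (A : set config) : R :=
  AT V J U (A `&` plus_boundary R V) / AT V J U (plus_boundary R V).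

Definition cylinder : set (set config) :=
  [set A | exists V : {fset vertex}, forall s t : config,
    (forall u, u \in V -> s u = t u) -> A s -> A t].

(* The product sigma-algebra on ({+1,-1} x {+1,-1})^(Z^2). *)
Definition configM := g_sigma_algebraType cylinder.

(* On this product of finite spaces, weak convergence means convergence of the
   probability of every cylinder event. *)
Definition is_AT_plus_limit {R : realType} (J U : R)
    (P : probability configM R) : Prop :=
  forall A : set config, cylinder A ->
    (AT_plus (box n) J U A)%:E @[n --> \oo] --> P A.

(* Picked by choice: two limits agree on the sigma-algebra, which the cylinder
   events generate as a class stable under intersection. The default
   point is never used for J, U > 0, where the limit exists. *)
Definition AT_plus_inf {R : realType} (J U : R) : probability configM R :=
  xget point [set P | is_AT_plus_limit J U P].

Definition AT_plus_expect {R : realType} (J U : R) (f : config -> R) : R :=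
  fine ('E_(AT_plus_inf J U)[f])%E.

Definition is_norm {R : realType} (N : 'rV[R]_2 -> R) : Prop :=
  [/\ forall v, N v = 0 -> v = 0,
      forall (a : R) v, N (a *: v) = `|a| * N v
    & forall v w, N (v + w) <= N v + N w].

Definition to_plane (R : realType) (x : vertex) : 'rV[R]_2 :=
  \row_(i < 2) (if i == ord0 then x.1 else x.2)%:~R.

(* Main.v *)
Require Import Defs.
From HB Require Import structures.
From mathcomp Require Import all_boot all_order all_algebra finmap.
From mathcomp Require Import ring lra zify.

Set Implicit Arguments.
Unset Strict Implicit.
Unset Printing Implicit Defensive.

Import Order.TTheory GRing.Theory Num.Theory.

Local Open Scope ring_scope.

(** Encode a pair of spins as an element of K = (Z/2)^2. Up to a constant, the
    energy of an edge is a combination, with positive coefficients kappa_t, of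
    the indicators that the increment of the spin along the edge lies in a
    subgroup H_t of K. Expanding every factor of the Gibbs weight as
    1 + (exp(beta kappa_t) - 1) 1_{H_t} gives an Edwards-Sokal representation by
    a random set of bonds, each carrying a kind t; its weight contains the order
    of the group of the compatible spin configurations, and
    |G| |H| <= |G + H| |G :&: H| makes it satisfy the lattice condition of FKG.

    For phi = tau or tau tau', the plus magnetization of phi in a box is the
    probability that the origin is connected to the boundary by the bonds that
    force phi to be constant, as soon as some g in K flips phi and satisfies all
    the other bonds. Following Duminil-Copin, Raoufi and Tassion, the OSSS
    inequality for the exploration from a sphere of random radius gives
    theta_n' >= c n theta_n (1 - theta_n) / (sum_(k < n) theta_k), up to factors 2
    in the indices, hence exponential decay of the magnetization at every beta
    below some beta' where it tends to 0. A one-step estimate at high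
    temperature and a Peierls argument at low temperature make the threshold
    positive and finite. The boxes sit in large tori, which provides
    translation invariance.

    Only for phi = tau tau' and U <= J does no such g exist; then the magnetization
    of tau tau' is at most that of tau, while its two-point function is at least
    the product of those of tau and tau', so the two thresholds coincide.

    Characters of the spins have nonnegative plus means that decrease with the
    box. So the probabilities of the cylinder events converge, and compactness of
    the configuration space with Caratheodory's theorem gives the limit measure.
    The two-point function at x is at most the magnetization in the box of radius
    |x|, and at least the product of two magnetizations. *)

(** * Monotonic measures and the OSSS inequality *)

(** The bonds are dependent, so an OSSS argument that resamples independent bits does not apply.
    What replaces independence is that conditioning on more open bonds raises the conditional mean
    of every increasing function. Two configurations, one driving the decision tree and one carrying
    the event, are sampled query by query with the monotone coupling; decoupling one query costs at
    most the covariance of that bond with the event.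

    The coefficients of the energy are positive because of 4 1_{a=b=1} = 1 + a + b + a b, where a
    and b are the products of tau and of tau' along an edge: min(J, U) times this identity leaves a
    nonnegative multiple of either a + b or a b. The kinds of bonds thus change at U = J.

    The exploration needs connection probabilities from all vertices u of a ball, under a boundary
    condition that is not centred at u. The boundary is therefore put at radius 2n for an event of
    radius n, and the pinned set is enlarged to the complement of a ball about u, which can only
    raise the probability. *)

Section FourFunctions.
Variables (R : realFieldType) (B : finType).

(** Put u = [a0 * b1], v = [a1 * b0] and m = [c1 * d0]. Both u and v are at most m, and u v is at
    most m times [c0 * d1]; hence (m - u)(m - v) >= 0 gives u + v <= m + u v / m <= m +
    [c0 * d1]. *)
Lemma four_functions_bool (a0 a1 b0 b1 c0 c1 d0 d1 : R) :
  0 <= a0 -> 0 <= a1 -> 0 <= b0 -> 0 <= b1 ->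
  0 <= c0 -> 0 <= c1 -> 0 <= d0 -> 0 <= d1 ->
  a0 * b0 <= c0 * d0 -> a0 * b1 <= c1 * d0 ->
  a1 * b0 <= c1 * d0 -> a1 * b1 <= c1 * d1 ->
  (a0 + a1) * (b0 + b1) <= (c0 + c1) * (d0 + d1).
Proof.
move=> a0p a1p b0p b1p c0p c1p d0p d1p h00 h01 h10 h11.
set m := c1 * d0 in h01 h10.
have m_ge0 : 0 <= m by rewrite mulr_ge0.
set u := a0 * b1 in h01; set v := a1 * b0 in h10.
have u_ge0 : 0 <= u by rewrite mulr_ge0.
have v_ge0 : 0 <= v by rewrite mulr_ge0.
have cd_ge0 : 0 <= c0 * d1 by rewrite mulr_ge0.
have -> : (a0 + a1) * (b0 + b1) = a0 * b0 + a1 * b1 + u + v.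
  by rewrite /u /v; ring.
have -> : (c0 + c1) * (d0 + d1) = c0 * d0 + c1 * d1 + m + c0 * d1.
  by rewrite /m; ring.
have [m0|m_neq0] := eqVneq m 0; first lra.
have m_gt0 : 0 < m by rewrite lt_def m_neq0.
have uv : u * v <= m * (c0 * d1).
  have -> : u * v = (a0 * b0) * (a1 * b1) by rewrite /u /v; ring.
  have -> : m * (c0 * d1) = (c0 * d0) * (c1 * d1) by rewrite /m; ring.
  by apply: ler_pM => //; rewrite mulr_ge0.
have : u + v <= m + c0 * d1.
  rewrite -(ler_pM2l m_gt0).
  have : 0 <= (m - u) * (m - v) by rewrite mulr_ge0 // subr_ge0.
  nra.
lra.
Qed.

Lemma sum_subsetU1 (D : {set B}) (x : B) (F : {set B} -> R) : x \notin D ->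
  \sum_(X : {set B} | X \subset x |: D) F X =
  \sum_(X : {set B} | X \subset D) (F X + F (x |: X)).
Proof.
move=> xD; rewrite (bigID (fun X : {set B} => x \in X)) /= addrC big_split /=.
congr (_ + _).
  apply: eq_bigl => X; apply/andP/idP => [[XD xX]|XD].
    by rewrite -(setU1K xD) subsetD1 XD.
  split; first by rewrite (subset_trans XD) // subsetUr.
  by apply: contra xD; apply/subsetP.
rewrite (reindex_onto (fun X => x |: X) (fun X => X :\ x)) /=.
  apply: eq_bigl => X; rewrite setU11 andbT.
  apply/andP/idP => [[XD /eqP <-]|XD].
    by rewrite -(setU1K xD) setSD.
  rewrite setUS //; split=> //; apply/eqP/setU1K.
  by apply: contra xD; apply/subsetP.
by move=> X /andP[_ xX]; rewrite setD1K.
Qed.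

(** The Ahlswede-Daykin theorem. Summing over the presence of one element x replaces each function
    by F X + F (x |: X), and the Boolean case says that the new functions satisfy the hypothesis on
    [D :\ x]. *)
Lemma four_functions_subset (D : {set B}) (a b c d : {set B} -> R) :
  (forall X, 0 <= a X) -> (forall X, 0 <= b X) ->
  (forall X, 0 <= c X) -> (forall X, 0 <= d X) ->
  (forall X Y : {set B}, X \subset D -> Y \subset D ->
     a X * b Y <= c (X :|: Y) * d (X :&: Y)) ->
  (\sum_(X : {set B} | X \subset D) a X) * (\sum_(X : {set B} | X \subset D) b X)
  <= (\sum_(X : {set B} | X \subset D) c X) *
     (\sum_(X : {set B} | X \subset D) d X).
Proof.
elim: {D}_.+1 {-2}D (ltnSn #|D|) a b c d => // n IHn D Dn a b c d ap bp cp dp abcd.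
have [->|[x xD]] := set_0Vmem D.
  rewrite !(big_pred1 set0) => [||||]; try by move=> X; rewrite /= subset0.
  by have := abcd set0 set0 (sub0set _) (sub0set _); rewrite setU0 setI0.
have xD' : x \notin D :\ x by rewrite setD11.
rewrite -(setD1K xD) !sum_subsetU1 //.
apply: IHn => [||||| X Y XD YD]; try by move=> X; rewrite addr_ge0.
  by move: Dn; rewrite (cardsD1 x D) xD.
have sD (Z : {set B}) : Z \subset D :\ x -> Z \subset D.
  by move=> ZD; apply: subset_trans ZD (subsetDl _ _).
have sxD (Z : {set B}) : Z \subset D :\ x -> x |: Z \subset D.
  by move=> ZD; rewrite subUset sub1set xD sD.
have nx (Z : {set B}) : Z \subset D :\ x -> x \notin Z.
  by move=> ZD; apply: contra xD'; apply/subsetP.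
apply: four_functions_bool => //.
- by apply: abcd; apply: sD.
- have := abcd X (x |: Y) (sD _ XD) (sxD _ YD).
  by rewrite setUCA setIUr (_ : X :&: [set x] = set0) ?set0U //
    setIC; apply/setP => z; rewrite !inE; case: eqP => // ->; rewrite (negPf (nx _ XD)).
- have := abcd (x |: X) Y (sxD _ XD) (sD _ YD).
  by rewrite -setUA setIUl (_ : [set x] :&: Y = set0) ?set0U //;
    apply/setP => z; rewrite !inE; case: eqP => // ->; rewrite (negPf (nx _ YD)).
- have := abcd (x |: X) (x |: Y) (sxD _ XD) (sxD _ YD).
  by rewrite -setUIr -setUUr.
Qed.

Lemma four_functions (a b c d : {set B} -> R) :
  (forall X, 0 <= a X) -> (forall X, 0 <= b X) ->
  (forall X, 0 <= c X) -> (forall X, 0 <= d X) ->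
  (forall X Y : {set B}, a X * b Y <= c (X :|: Y) * d (X :&: Y)) ->
  (\sum_X a X) * (\sum_X b X) <= (\sum_X c X) * (\sum_X d X).
Proof.
move=> ap bp cp dp abcd.
have sumT (F : {set B} -> R) :
    \sum_(X : {set B} | X \subset [set: B]) F X = \sum_X F X.
  by apply: eq_bigl => X; rewrite subsetT.
have := @four_functions_subset setT a b c d ap bp cp dp (fun X Y _ _ => abcd X Y).
by rewrite !sumT.
Qed.

End FourFunctions.

(** * Weighted means, Holley's inequality and FKG *)

Definition wmean (R : realFieldType) (B : finType) (mu f : {set B} -> R) : R :=
  (\sum_X mu X * f X) / \sum_X mu X.

Definition wcov (R : realFieldType) (B : finType) (mu f g : {set B} -> R) : R :=
  wmean mu (fun X => f X * g X) - wmean mu f * wmean mu g.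

Definition increasing_set (R : realFieldType) (B : finType) (f : {set B} -> R) :=
  forall X Y : {set B}, X \subset Y -> f X <= f Y.

Section Holley.
Variables (R : realFieldType) (B : finType).
Implicit Types (mu f g : {set B} -> R) (X Y : {set B}).

Lemma eq_wmean mu f g : (forall X, mu X != 0 -> f X = g X) ->
  wmean mu f = wmean mu g.
Proof.
move=> fg; congr (_ / _); apply: eq_bigr => X _.
by have [->|/fg ->] := eqVneq (mu X) 0; rewrite ?mul0r.
Qed.

Lemma wmeanD mu f g : wmean mu (fun X => f X + g X) = wmean mu f + wmean mu g.
Proof.
rewrite /wmean -mulrDl -big_split /=; congr (_ / _).
by apply: eq_bigr => X _; rewrite mulrDr.
Qed.

Lemma wmeanZ mu (c : R) f : wmean mu (fun X => c * f X) = c * wmean mu f.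
Proof.
rewrite /wmean mulrA mulr_sumr; congr (_ / _).
by apply: eq_bigr => X _; rewrite mulrCA.
Qed.

Lemma wmean_cst mu (c : R) : \sum_X mu X != 0 -> wmean mu (fun=> c) = c.
Proof. by move=> mu0; rewrite /wmean -mulr_suml mulrAC mulfV ?mul1r. Qed.

Lemma wmeanB mu f g : wmean mu (fun X => f X - g X) = wmean mu f - wmean mu g.
Proof.
rewrite wmeanD; congr (_ + _); rewrite -mulN1r -wmeanZ.
by apply: eq_wmean => X _; rewrite mulN1r.
Qed.

Lemma ler_wmean mu f g : (forall X, 0 <= mu X) ->
  (forall X, mu X != 0 -> f X <= g X) -> wmean mu f <= wmean mu g.
Proof.
move=> mu0 fg; apply: ler_wpM2r; first by rewrite invr_ge0 sumr_ge0.
apply: ler_sum => X _.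
by have [->|/fg /ler_wpM2l->] := eqVneq (mu X) 0; rewrite ?mul0r.
Qed.

Lemma wmean_ge0 mu f : (forall X, 0 <= mu X) ->
  (forall X, mu X != 0 -> 0 <= f X) -> 0 <= wmean mu f.
Proof.
move=> mu0 f0; have := ler_wmean mu0 f0.
by rewrite {1}/wmean big1 ?mul0r // => X _; rewrite mulr0.
Qed.

(** The four functions are [mu1 * (g - g set0)], [mu2], [mu2 * (g - g set0)] and [mu1]; subtracting
    [g set0] makes [g] nonnegative and shifts both means equally. *)
Lemma holley mu1 mu2 g :
  (forall X, 0 <= mu1 X) -> (forall X, 0 <= mu2 X) ->
  0 < \sum_X mu1 X -> 0 < \sum_X mu2 X ->
  (forall X Y, mu1 X * mu2 Y <= mu2 (X :|: Y) * mu1 (X :&: Y)) ->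
  increasing_set g -> wmean mu1 g <= wmean mu2 g.
Proof.
move=> mu1_ge0 mu2_ge0 Z1 Z2 lat g_incr.
have g_ge X : 0 <= g X - g set0 by rewrite subr_ge0 g_incr ?sub0set.
have shift mu : 0 < \sum_X mu X ->
    wmean mu g = wmean mu (fun X => g X - g set0) + g set0.
  by move=> Z; rewrite wmeanB wmean_cst ?gt_eqF // subrK.
rewrite !shift // lerD2r /wmean ler_pdivrMr // mulrAC ler_pdivlMr //.
have := @four_functions R B (fun X => mu1 X * (g X - g set0)) mu2
  (fun X => mu2 X * (g X - g set0)) mu1.
apply=> // [X|X|X Y]; try by rewrite mulr_ge0.
have -> : mu1 X * (g X - g set0) * mu2 Y = (mu1 X * mu2 Y) * (g X - g set0) by ring.
rewrite [leRHS](_ : _ = (mu2 (X :|: Y) * mu1 (X :&: Y)) * (g (X :|: Y) - g set0));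
  last by ring.
apply: ler_pM => //; first by rewrite mulr_ge0.
by rewrite lerD2r g_incr // subsetUl.
Qed.

(** Subtracting constants from [f] and [g] does not change the covariance, so both may be taken
    nonnegative; the four functions are then [mu * f], [mu * g], [mu * f * g] and [mu]. *)
Lemma fkg mu f g : (forall X, 0 <= mu X) -> 0 < \sum_X mu X ->
  (forall X Y, mu X * mu Y <= mu (X :|: Y) * mu (X :&: Y)) ->
  increasing_set f -> increasing_set g -> 0 <= wcov mu f g.
Proof.
move=> mu_ge0 Z lat f_incr g_incr.
pose f' X := f X - f set0; pose g' X := g X - g set0.
have f'_ge0 X : 0 <= f' X by rewrite subr_ge0 f_incr ?sub0set.
have g'_ge0 X : 0 <= g' X by rewrite subr_ge0 g_incr ?sub0set.
have Z0 : \sum_X mu X != 0 by rewrite gt_eqF.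
have -> : wcov mu f g = wcov mu f' g'.
  rewrite /wcov /f' /g' !wmeanB !wmean_cst //.
  have -> : wmean mu (fun X => (f X - f set0) * (g X - g set0)) =
     wmean mu (fun X => f X * g X) - g set0 * wmean mu f
     - f set0 * wmean mu g + f set0 * g set0.
    rewrite -{1}(wmean_cst (f set0 * g set0) Z0) -!wmeanZ -!wmeanB -wmeanD.
    by apply: eq_wmean => X _; ring.
  by ring.
rewrite /wcov subr_ge0 /wmean mulf_div ler_pdivrMr ?mulr_gt0 // mulrA mulrAC.
rewrite [leRHS](_ : _ = (\sum_X mu X * (f' X * g' X)) * (\sum_X mu X)); last first.
  by field.
apply: four_functions => // [X|X|X|X Y]; rewrite ?mulr_ge0 //.
have -> : mu X * f' X * (mu Y * g' Y) = (mu X * mu Y) * (f' X * g' Y) by ring.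
rewrite [leRHS](_ : _ = (mu (X :|: Y) * mu (X :&: Y)) * (f' (X :|: Y) * g' (X :|: Y)));
  last by ring.
apply: ler_pM => //; rewrite ?mulr_ge0 //.
by apply: ler_pM => //; rewrite lerD2r ?f_incr ?g_incr // ?subsetUl ?subsetUr.
Qed.

End Holley.

(* [Node b T0 T1] queries [b] and continues with [T1] if [b] is open, with [T0]
   otherwise. *)
Inductive dtree (R B : Type) :=
  | Leaf of R
  | Node of B & dtree R B & dtree R B.
Arguments Leaf {R B}.

Section DecisionTrees.
Variables (R : realFieldType) (B : finType).
Implicit Types (T : dtree R B) (Q X Y x y : {set B}).

Fixpoint deval T X : R :=
  match T with
  | Leaf v => v
  | Node b T0 T1 => if b \in X then deval T1 X else deval T0 X
  end.

Fixpoint dqueries (c : B) T X : R :=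
  match T with
  | Leaf v => 0
  | Node b T0 T1 =>
    (c == b)%:R + (if b \in X then dqueries c T1 X else dqueries c T0 X)
  end.

(** [Q] collects the variables queried on the branch, none of which may be queried again. Leaves
    take values in [0, 1], so that [dcompl] preserves the class. *)
Fixpoint dtree_wf Q T : bool :=
  match T with
  | Leaf v => (0 <= v) && (v <= 1)
  | Node b T0 T1 => [&& b \notin Q, dtree_wf (b |: Q) T0 & dtree_wf (b |: Q) T1]
  end.

Fixpoint dcompl T : dtree R B :=
  match T with
  | Leaf v => Leaf (1 - v)
  | Node b T0 T1 => Node b (dcompl T0) (dcompl T1)
  end.

Lemma dcompl_wf Q T : dtree_wf Q (dcompl T) = dtree_wf Q T.
Proof.
elim: T Q => [v|b T0 IH0 T1 IH1] Q /=; last by rewrite IH0 IH1.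
by rewrite subr_ge0 lerBlDr lerDl andbC.
Qed.

End DecisionTrees.

(** * The OSSS inequality for monotonic measures *)

Section OSSS.
Variables (R : realFieldType) (B : finType) (mu : {set B} -> R).
Hypothesis mu_gt0 : forall X, 0 < mu X.
Hypothesis mu_lat :
  forall X Y, mu X * mu Y <= mu (X :|: Y) * mu (X :&: Y).
Implicit Types (T : dtree R B) (Q X Y x y z : {set B}) (f g : {set B} -> R) (b : B).

(** The weight restricted to the configurations whose open variables in [Q] are exactly [x]. For [b]
    outside [Q], [copen Q x b] is the conditional probability that [b] is open. *)
Definition cylw Q x X : R := mu X * (X :&: Q == x)%:R.
Definition cmass Q x : R := \sum_X cylw Q x X.
Definition cmean Q x f : R := wmean (cylw Q x) f.
Definition copen Q x b : R := cmass (b |: Q) (b |: x) / cmass Q x.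

Lemma cylw_ge0 Q x X : 0 <= cylw Q x X.
Proof. by rewrite mulr_ge0 // ltW. Qed.

Lemma cmass_gt0 Q x : x \subset Q -> 0 < cmass Q x.
Proof.
move=> /setIidPl xQ; rewrite /cmass (bigD1 x) //= ltr_pwDl //.
  by rewrite /cylw xQ eqxx mulr1.
by apply: sumr_ge0 => X _; apply: cylw_ge0.
Qed.

Lemma eq_cmean Q x f g : (forall X, X :&: Q = x -> f X = g X) ->
  cmean Q x f = cmean Q x g.
Proof.
move=> fg; apply: eq_wmean => X; rewrite /cylw.
by case: (X :&: Q =P x) => [/fg //|_]; rewrite mulr0 eqxx.
Qed.

(** As [x \subset y], unions land in the cylinder of [y] and intersections in that of [x]: this is
    Holley's condition between the two conditional laws. *)
Lemma cylw_lat Q x y X Y : x \subset y ->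
  cylw Q x X * cylw Q y Y <= cylw Q y (X :|: Y) * cylw Q x (X :&: Y).
Proof.
move=> /[dup] /setIidPl xIy /setUidPr xUy; rewrite /cylw.
case: eqP => [Xx|]; case: eqP => [Yy|]; rewrite ?(mulr0, mul0r);
  try by move=> *; rewrite !mulr_ge0 // ltW.
by rewrite setIUl -{3}(setIid Q) setIACA Xx Yy xIy xUy !eqxx !mulr1.
Qed.

Lemma cmean_incr Q x y g : x \subset y -> y \subset Q -> increasing_set g ->
  cmean Q x g <= cmean Q y g.
Proof.
move=> xy yQ; apply: holley => [X|X|||X Y]; rewrite ?cylw_ge0 ?cylw_lat //.
  by apply: cmass_gt0; apply: subset_trans yQ.
exact: cmass_gt0.
Qed.

Lemma cylw_split Q x b X : b \notin Q -> x \subset Q ->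
  cylw Q x X = cylw (b |: Q) (b |: x) X + cylw (b |: Q) x X.
Proof.
move=> bQ xQ; have bx : b \notin x by apply: contra bQ; apply/subsetP.
rewrite /cylw -mulrDr; congr (_ * _).
have XbQ c : c != b -> (c \in X :&: (b |: Q)) = (c \in X :&: Q).
  by rewrite !inE => /negPf->.
have -> : (X :&: (b |: Q) == b |: x) = (b \in X) && (X :&: Q == x).
  apply/eqP/andP => [E|[bX /eqP <-]]; last first.
    by rewrite setIUr; congr (_ :|: _); apply/setIidPr; rewrite sub1set.
  have := setU11 b x; rewrite -E inE => /andP[bX _]; split=> //.
  apply/eqP/setP => c; have [->|cb] := eqVneq c b.
    by rewrite inE (negPf bQ) andbF (negPf bx).
  by rewrite -XbQ // E !inE (negPf cb).
have -> : (X :&: (b |: Q) == x) = (b \notin X) && (X :&: Q == x).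
  apply/eqP/andP => [E|[bX /eqP <-]]; last first.
    apply/setP => c; have [->|cb] := eqVneq c b; last exact: XbQ.
    by rewrite !inE (negPf bX).
  split; first by move: bx; rewrite -E !inE eqxx andbT.
  apply/eqP/setP => c; have [->|cb] := eqVneq c b.
    by rewrite inE (negPf bQ) andbF (negPf bx).
  by rewrite -XbQ // E.
by case: (b \in X); rewrite ?addr0 ?add0r.
Qed.

Lemma setU1_sub Q x b : x \subset Q -> b |: x \subset b |: Q.
Proof. exact: setUS. Qed.

Lemma sub_setU1 Q x b : x \subset Q -> x \subset b |: Q.
Proof. by move=> xQ; apply: subset_trans (subsetUr _ _). Qed.

Lemma cmass_split Q x b : b \notin Q -> x \subset Q ->
  cmass Q x = cmass (b |: Q) (b |: x) + cmass (b |: Q) x.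
Proof.
by move=> bQ xQ; rewrite /cmass -big_split; apply: eq_bigr => X _; apply: cylw_split.
Qed.

Lemma copen_compl Q x b : b \notin Q -> x \subset Q ->
  1 - copen Q x b = cmass (b |: Q) x / cmass Q x.
Proof.
move=> bQ xQ; have Z := cmass_gt0 xQ.
apply: (mulIf (lt0r_neq0 Z)).
by rewrite mulrBl /copen !divfK ?gt_eqF // mul1r (cmass_split bQ xQ) addrC addKr.
Qed.

Lemma copen_ge0 Q x b : x \subset Q -> 0 <= copen Q x b.
Proof. by move=> xQ; rewrite divr_ge0 // ltW // cmass_gt0 // setU1_sub. Qed.

Lemma copen_le1 Q x b : b \notin Q -> x \subset Q -> copen Q x b <= 1.
Proof.
move=> bQ xQ; rewrite -subr_ge0 copen_compl //.
by rewrite divr_ge0 // ltW // cmass_gt0 // sub_setU1.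
Qed.

Lemma cmean_split Q x b f : b \notin Q -> x \subset Q ->
  cmean Q x f = copen Q x b * cmean (b |: Q) (b |: x) f
              + (1 - copen Q x b) * cmean (b |: Q) x f.
Proof.
move=> bQ xQ; rewrite copen_compl // /copen /cmean /wmean.
rewrite -/(cmass Q x) -/(cmass (b |: Q) (b |: x)) -/(cmass (b |: Q) x).
have Z := cmass_gt0 xQ; have Z1 := cmass_gt0 (setU1_sub b xQ).
have Z0 := cmass_gt0 (sub_setU1 b xQ).
rewrite [in LHS](eq_bigr (fun X => cylw (b |: Q) (b |: x) X * f X + cylw (b |: Q) x X * f X));
  last by move=> X _; rewrite (cylw_split _ bQ) // mulrDl.
by rewrite big_split /=; field; rewrite !gt_eqF.
Qed.

Lemma copenE Q x b : b \notin Q -> x \subset Q ->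
  copen Q x b = cmean Q x (fun X => (b \in X)%:R).
Proof.
move=> bQ xQ; have bx : b \notin x by apply: contra bQ; apply/subsetP.
have Z1 := cmass_gt0 (setU1_sub b xQ); have Z0 := cmass_gt0 (sub_setU1 b xQ).
rewrite (cmean_split _ bQ) //.
rewrite (_ : cmean _ (b |: x) _ = 1); last first.
  rewrite -[RHS](@wmean_cst _ _ (cylw (b |: Q) (b |: x))) ?gt_eqF //.
  by apply: eq_cmean => X E; have := setU11 b x; rewrite -E inE => /andP[->].
rewrite (_ : cmean _ x _ = 0) ?mulr0 ?addr0 ?mulr1 //.
rewrite -[RHS](@wmean_cst _ _ (cylw (b |: Q) x)) ?gt_eqF //.
apply: eq_cmean => X E; have : b \notin X :&: (b |: Q) by rewrite E.
by rewrite !inE eqxx andbT => /negPf->.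
Qed.

Lemma indic_incr b : increasing_set (fun X : {set B} => (b \in X)%:R : R).
Proof.
by move=> X Y XY; rewrite ler_nat; case: (boolP (b \in X)) => // /(subsetP XY)->.
Qed.

Lemma copen_incr Q x y b : b \notin Q -> x \subset y -> y \subset Q ->
  copen Q x b <= copen Q y b.
Proof.
move=> bQ xy yQ; rewrite !copenE ?(subset_trans xy) //.
exact: cmean_incr (indic_incr b).
Qed.

Lemma sum_mu_gt0 : 0 < \sum_X mu X.
Proof.
by rewrite (bigD1 set0) //= ltr_pwDl // sumr_ge0 // => X _; rewrite ltW.
Qed.

Definition cprob Q x : R := cmass Q x / \sum_X mu X.

Lemma cprob_ge0 Q x : x \subset Q -> 0 <= cprob Q x.
Proof. by move=> xQ; rewrite divr_ge0 // ltW // ?cmass_gt0 // sum_mu_gt0. Qed.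

Lemma cprob_open Q x b : x \subset Q ->
  cprob (b |: Q) (b |: x) = cprob Q x * copen Q x b.
Proof.
move=> xQ; rewrite /cprob /copen; field.
by rewrite !gt_eqF ?cmass_gt0 ?sum_mu_gt0.
Qed.

Lemma cprob_closed Q x b : b \notin Q -> x \subset Q ->
  cprob (b |: Q) x = cprob Q x * (1 - copen Q x b).
Proof.
move=> bQ xQ; rewrite copen_compl // /cprob; field.
by rewrite !gt_eqF ?cmass_gt0 ?sum_mu_gt0.
Qed.

Lemma wmean_cmean Q f :
  wmean mu f = \sum_(x : {set B} | x \subset Q) cprob Q x * cmean Q x f.
Proof.
rewrite {1}/wmean (partition_big (fun X => X :&: Q) (fun x => x \subset Q)) /=; last first.
  by move=> X _; apply: subsetIr.
rewrite mulr_suml; apply: eq_bigr => x xQ.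
rewrite /cprob /cmean /wmean mulrAC -/(cmass Q x).
have Z := cmass_gt0 xQ; have Z' := sum_mu_gt0.
rewrite [X in _ = X](_ : _ = (\sum_X cylw Q x X * f X) / \sum_X mu X); last first.
  by field; rewrite !gt_eqF.
congr (_ / _); rewrite big_mkcond; apply: eq_bigr => X _.
by rewrite /cylw; case: ifP; rewrite ?mulr1 ?mulr0 ?mul0r.
Qed.

(** Law of total covariance given the variables of [Q]. The covariance of the two conditional means
    is nonnegative by FKG, both being increasing. The left side is the mean of the conditional
    covariance, computed from the two values of the indicator of [b]. *)
Lemma cov_ge Q b g : b \notin Q -> increasing_set g ->
  \sum_(y : {set B} | y \subset Q) cprob Q y *
     (copen Q y b * (1 - copen Q y b) *
       (cmean (b |: Q) (b |: y) g - cmean (b |: Q) y g))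
  <= wcov mu (fun X => (b \in X)%:R) g.
Proof.
move=> bQ g_incr.
pose q X := copen Q (X :&: Q) b; pose G X := cmean Q (X :&: Q) g.
have q_incr : increasing_set q.
  by move=> X Y XY; apply: copen_incr => //; rewrite ?subsetIr ?setSI.
have G_incr : increasing_set G.
  by move=> X Y XY; apply: cmean_incr => //; rewrite ?subsetIr ?setSI.
have := fkg (fun X => ltW (mu_gt0 X)) sum_mu_gt0 mu_lat q_incr G_incr.
have cstE (h : {set B} -> R) : wmean mu (fun X => h (X :&: Q)) =
    \sum_(y : {set B} | y \subset Q) cprob Q y * h y.
  rewrite (wmean_cmean Q); apply: eq_bigr => y yQ; congr (_ * _).
  rewrite -[RHS](@wmean_cst _ _ (cylw Q y)) ?gt_eqF ?cmass_gt0 //.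
  by apply: eq_cmean => X ->.
rewrite /wcov.
rewrite (cstE (fun x => copen Q x b * cmean Q x g)) (cstE (fun x => copen Q x b)).
rewrite (cstE (fun x => cmean Q x g)) subr_ge0.
rewrite [wmean mu g](wmean_cmean Q).
rewrite [wmean mu (fun X => (b \in X)%:R)](wmean_cmean Q).
have -> : \sum_(x : {set B} | x \subset Q) cprob Q x * cmean Q x (fun X => (b \in X)%:R)
   = \sum_(y : {set B} | y \subset Q) cprob Q y * copen Q y b.
  by apply: eq_bigr => y yQ; rewrite copenE.
move=> h; rewrite lerBrDr; apply: le_trans (lerD (lexx _) h) _.
rewrite -big_split /= (wmean_cmean Q) le_eqVlt; apply/orP; left; apply/eqP.
apply: eq_bigr => y yQ; rewrite -mulrDr; congr (_ * _).
rewrite [cmean Q y g](cmean_split _ bQ) // [RHS](cmean_split _ bQ) //.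
have by_ : b \notin y by apply: contra bQ; apply/subsetP.
rewrite [cmean _ (b |: y) (fun X => (b \in X)%:R * g X)](_ : _ = cmean (b |: Q) (b |: y) g).
  rewrite [cmean _ y (fun X => (b \in X)%:R * g X)](_ : _ = 0); first by ring.
  rewrite -[RHS](@wmean_cst _ _ (cylw (b |: Q) y)) ?gt_eqF ?cmass_gt0 ?sub_setU1 //.
  apply: eq_cmean => X E; have : b \notin X :&: (b |: Q) by rewrite E.
  by rewrite !inE eqxx andbT => /negPf->; rewrite mul0r.
apply: eq_cmean => X E; have := setU11 b y; rewrite -E inE => /andP[-> _].
by rewrite mul1r.
Qed.

Section Coupling.
Variable g : {set B} -> R.
Hypothesis g_incr : increasing_set g.

(* The expectation of [deval T X * g Y] when X and Y have the conditional laws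
   given [x] and [y] on [Q], the variables queried by [T] along X being sampled
   for both by the monotone coupling, and Y being completed independently. *)
Fixpoint coupled T Q x y : R :=
  match T with
  | Leaf v => v * cmean Q y g
  | Node b T0 T1 =>
    let p := copen Q x b in let q := copen Q y b in let m := Num.min p q in
    let Q' := b |: Q in
    m * coupled T1 Q' (b |: x) (b |: y) + (p - m) * coupled T1 Q' (b |: x) y
    + (q - m) * coupled T0 Q' x (b |: y) + (1 - p - q + m) * coupled T0 Q' x y
  end.

Lemma coupled_diag T Q x : dtree_wf Q T -> x \subset Q ->
  coupled T Q x x = cmean Q x (fun X => deval T X * g X).
Proof.
elim: T Q x => [v|b T0 IH0 T1 IH1] Q x /=.
  by move=> _ _; rewrite /cmean wmeanZ.
case/and3P=> bQ wf0 wf1 xQ; rewrite minxx subrr !mul0r !addr0 addrNK.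
have bx : b \notin x by apply: contra bQ; apply/subsetP.
rewrite IH0 ?IH1 ?setU1_sub ?sub_setU1 // [RHS](cmean_split _ bQ) //.
congr (_ * _ + _ * _); apply: eq_cmean => X E.
  by have := setU11 b x; rewrite -E inE => /andP[->].
have : b \notin X :&: (b |: Q) by rewrite E.
by rewrite !inE eqxx andbT => /negPf->.
Qed.

(** The tree influences how Y is sampled but not its law, and the values of [T] and [dcompl T] add
    up to 1. *)
Lemma coupled_compl T Q x y : dtree_wf Q T -> x \subset Q -> y \subset Q ->
  coupled T Q x y + coupled (dcompl T) Q x y = cmean Q y g.
Proof.
elim: T Q x y => [v|b T0 IH0 T1 IH1] Q x y /=; first by move=> *; ring.
case/and3P=> bQ wf0 wf1 xQ yQ.
have s1 z := @setU1_sub Q z b; have s0 z := @sub_setU1 Q z b.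
rewrite [RHS](cmean_split _ bQ) //.
rewrite -[in RHS](IH1 _ _ _ wf1 (s1 _ xQ) (s1 _ yQ)).
rewrite -[in RHS](IH1 _ _ _ wf1 (s1 _ xQ) (s0 _ yQ)).
have h1 : coupled T1 (b |: Q) (b |: x) (b |: y) + coupled (dcompl T1) (b |: Q) (b |: x) (b |: y)
    = coupled T0 (b |: Q) x (b |: y) + coupled (dcompl T0) (b |: Q) x (b |: y).
  by rewrite (IH0 _ _ _ wf0 (s0 _ xQ) (s1 _ yQ)) (IH1 _ _ _ wf1 (s1 _ xQ) (s1 _ yQ)).
have h0 : coupled T1 (b |: Q) (b |: x) y + coupled (dcompl T1) (b |: Q) (b |: x) y
    = coupled T0 (b |: Q) x y + coupled (dcompl T0) (b |: Q) x y.
  by rewrite (IH0 _ _ _ wf0 (s0 _ xQ) (s0 _ yQ)) (IH1 _ _ _ wf1 (s1 _ xQ) (s0 _ yQ)).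
set a11 := coupled T1 _ _ (b |: y) in h1 *; set a10 := coupled T1 _ _ y in h0 *.
set a01 := coupled T0 _ _ (b |: y) in h1 *; set a00 := coupled T0 _ _ y in h0 *.
set b11 := coupled (dcompl T1) _ _ (b |: y) in h1 *.
set b01 := coupled (dcompl T0) _ _ (b |: y) in h1 *.
set b10 := coupled (dcompl T1) _ _ y in h0 *.
set b00 := coupled (dcompl T0) _ _ y in h0 *.
set p := copen Q x b; set q := copen Q y b; set m := Num.min p q.
clearbody a11 a10 a01 a00 b11 b01 b10 b00 m p q.
have -> : a11 = a01 + b01 - b11 by rewrite -h1 addrK.
have -> : a10 = a00 + b00 - b10 by rewrite -h0 addrK.
ring.
Qed.

(** Raising the probability q that Y opens [b] raises both [m], the mass where X opens [b] too, and
    [q - m]. In either branch of the tree, mass only moves from Y closed to Y open. *)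
Lemma coupled_incr T Q x y z : dtree_wf Q T ->
  x \subset Q -> y \subset z -> z \subset Q ->
  coupled T Q x y <= coupled T Q x z.
Proof.
elim: T Q x y z => [v|b T0 IH0 T1 IH1] Q x y z /=.
  by move=> /andP[v0 _] xQ yz zQ; rewrite ler_wpM2l // cmean_incr.
case/and3P=> bQ wf0 wf1 xQ yz zQ.
have yQ : y \subset Q by apply: subset_trans zQ.
have s1 w := @setU1_sub Q w b; have s0 w := @sub_setU1 Q w b.
have h11 : coupled T1 (b |: Q) (b |: x) (b |: y) <= coupled T1 (b |: Q) (b |: x) (b |: z).
  by apply: IH1; rewrite ?s1 ?setUS.
have h10 : coupled T1 (b |: Q) (b |: x) y <= coupled T1 (b |: Q) (b |: x) z.
  by apply: IH1; rewrite ?s1 ?s0.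
have h01 : coupled T0 (b |: Q) x (b |: y) <= coupled T0 (b |: Q) x (b |: z).
  by apply: IH0; rewrite ?s1 ?setUS ?s0.
have h00 : coupled T0 (b |: Q) x y <= coupled T0 (b |: Q) x z.
  by apply: IH0; rewrite ?s0.
have k1 : coupled T1 (b |: Q) (b |: x) z <= coupled T1 (b |: Q) (b |: x) (b |: z).
  by apply: IH1; rewrite ?s1 ?subsetUr.
have k0 : coupled T0 (b |: Q) x z <= coupled T0 (b |: Q) x (b |: z).
  by apply: IH0; rewrite ?subsetUr ?s1 ?s0.
move: h11 h10 h01 h00 k1 k0.
set a11 := coupled T1 _ _ (b |: y); set a10 := coupled T1 _ _ y.
set a01 := coupled T0 _ _ (b |: y); set a00 := coupled T0 _ _ y.
set b11 := coupled T1 _ _ (b |: z); set b10 := coupled T1 _ _ z.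
set b01 := coupled T0 _ _ (b |: z); set b00 := coupled T0 _ _ z.
move=> h11 h10 h01 h00 k1 k0.
have p0 := copen_ge0 b xQ; have p1 := copen_le1 bQ xQ.
have q0 := copen_ge0 b yQ; have q1 := copen_le1 bQ yQ.
have r1 := copen_le1 bQ zQ; have qr := copen_incr bQ yz zQ.
set p := copen Q x b in p0 p1 *; set q := copen Q y b in q0 q1 qr *.
set r := copen Q z b in r1 qr *.
set m := Num.min p q; set m' := Num.min p r.
have [m0 mp mq] : [/\ 0 <= m, m <= p & m <= q] by rewrite le_min p0 q0 !ge_min !lexx ?orbT.
have m1 : 0 <= 1 - p - q + m.
  by rewrite /m; case: (leP p q) => _; lra.
have mm' : m <= m' by rewrite /m /m' le_min !ge_min lexx qr orbT.
have nm : q - m <= r - m'.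
  by rewrite /m /m'; case: (leP p q); case: (leP p r); lra.
(* The histories of Y are raised with the masses kept, then the masses are moved. *)
apply: (@le_trans _ _ (m * b11 + (p - m) * b10 + (q - m) * b01 + (1 - p - q + m) * b00)).
  by rewrite !lerD // ler_wpM2l // subr_ge0.
rewrite -subr_ge0.
rewrite (_ : _ - _ = (m' - m) * (b11 - b10) + ((r - m') - (q - m)) * (b01 - b00)); last by ring.
by rewrite addr_ge0 // mulr_ge0 // subr_ge0.
Qed.

(** The complementary tree is monotone too, and the increments of the two trees add up to that of
    the mean of [g]. *)
Lemma coupled_lip T Q x y z : dtree_wf Q T ->
  x \subset Q -> y \subset z -> z \subset Q ->
  coupled T Q x z - coupled T Q x y <= cmean Q z g - cmean Q y g.
Proof.
move=> wf xQ yz zQ; have yQ : y \subset Q by apply: subset_trans zQ.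
rewrite -(coupled_compl wf xQ zQ) -(coupled_compl wf xQ yQ).
have := @coupled_incr (dcompl T) Q x y z; rewrite dcompl_wf => /(_ wf xQ yz zQ).
by lra.
Qed.

Lemma sum_cprob Q : \sum_(y : {set B} | y \subset Q) cprob Q y = 1.
Proof.
have Z : \sum_X mu X != 0 by rewrite gt_eqF // sum_mu_gt0.
rewrite -[RHS](wmean_cst 1 Z) (wmean_cmean Q); apply: eq_bigr => y yQ.
by rewrite /cmean wmean_cst ?mulr1 // gt_eqF // cmass_gt0.
Qed.

(** The history y of Y on [Q] is averaged with its own law, independently of [x]. The queries are
    decoupled one at a time: at a leaf X and Y are independent and the left side vanishes, while
    each query of [b] adds at most the covariance of [b] with [g]. *)
Lemma osss_step T Q x : dtree_wf Q T -> x \subset Q ->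
  \sum_(y : {set B} | y \subset Q) cprob Q y * coupled T Q x y
    - cmean Q x (deval T) * wmean mu g
  <= \sum_b cmean Q x (dqueries b T) * wcov mu (fun X => (b \in X)%:R) g.
Proof.
elim: T Q x => [v|b T0 IH0 T1 IH1] Q x.
  move=> _ xQ.
  have cst (c : R) : cmean Q x (fun=> c) = c.
    by rewrite /cmean wmean_cst // gt_eqF // cmass_gt0.
  rewrite [cmean Q x (deval _)](cst v) (wmean_cmean Q) [X in _ - X]mulr_sumr.
  rewrite (eq_bigr (fun y => v * (cprob Q y * cmean Q y g))); last first.
    by move=> y _; rewrite mulrCA.
  rewrite subrr big1 // => b _.
  by rewrite [cmean Q x _](cst 0) mul0r.
move=> wf xQ.
have /and3P[bQ wf0 wf1] :
  [&& b \notin Q, dtree_wf (b |: Q) T0 & dtree_wf (b |: Q) T1] := wf.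
have bx : b \notin x by apply: contra bQ; apply/subsetP.
have s1 w := @setU1_sub Q w b; have s0 w := @sub_setU1 Q w b.
have {}IH1 := IH1 _ _ wf1 (s1 _ xQ); have {}IH0 := IH0 _ _ wf0 (s0 _ xQ).
have in1 X (w : {set B}) : X :&: (b |: Q) = b |: w -> b \in X.
  by move=> E; have := setU11 b w; rewrite -E inE => /andP[].
have in0 X (w : {set B}) : w \subset Q -> X :&: (b |: Q) = w -> (b \in X) = false.
  move=> wQ E; have : b \notin X :&: (b |: Q).
    by rewrite E; apply: contra bQ; apply/subsetP.
  by rewrite !inE eqxx andbT => /negPf.
have -> : cmean Q x (deval (Node b T0 T1)) =
    copen Q x b * cmean (b |: Q) (b |: x) (deval T1)
    + (1 - copen Q x b) * cmean (b |: Q) x (deval T0).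
  rewrite (cmean_split _ bQ) //.
  congr (_ * _ + _ * _); apply: eq_cmean => X E; first by rewrite /= (in1 _ _ E).
  by rewrite /= (in0 _ _ xQ E).
have qE c : cmean Q x (dqueries c (Node b T0 T1)) =
    (c == b)%:R + (copen Q x b * cmean (b |: Q) (b |: x) (dqueries c T1)
    + (1 - copen Q x b) * cmean (b |: Q) x (dqueries c T0)).
  rewrite {1}/cmean /dqueries -/dqueries wmeanD wmean_cst ?gt_eqF ?cmass_gt0 //; congr (_ + _).
  rewrite -/(cmean Q x _) (cmean_split _ bQ) //.
  congr (_ * _ + _ * _); apply: eq_cmean => X E; first by rewrite /= (in1 _ _ E).
  by rewrite /= (in0 _ _ xQ E).
set cv := fun c => wcov mu (fun X => (c \in X)%:R) g in IH0 IH1 *.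
have -> : \sum_c cmean Q x (dqueries c (Node b T0 T1)) * cv c =
   cv b + (copen Q x b * (\sum_c cmean (b |: Q) (b |: x) (dqueries c T1) * cv c)
    + (1 - copen Q x b) * (\sum_c cmean (b |: Q) x (dqueries c T0) * cv c)).
  rewrite !mulr_sumr -big_split /=.
  rewrite [X in X + _](_ : cv b = \sum_c (c == b)%:R * cv c); last first.
    rewrite (bigD1 b) //= eqxx mul1r big1 ?addr0 // => c /negPf->.
    by rewrite mul0r.
  rewrite -big_split /=; apply: eq_bigr => c _; rewrite qE; ring.
set P := copen Q x b.
have P0 : 0 <= P by apply: copen_ge0.
have P1 : 0 <= 1 - P by rewrite subr_ge0 copen_le1.
apply: le_trans (lerD (lexx (cv b)) (lerD (ler_wpM2l P0 IH1) (ler_wpM2l P1 IH0))).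
apply: le_trans (lerD (cov_ge bQ g_incr) (lexx _)).
rewrite !sum_subsetU1 // -/P.
set S := \sum_(y : {set B} | y \subset Q) _.
set S' := \sum_(y : {set B} | y \subset Q) _.
set S1 := \sum_(y : {set B} | y \subset Q) _.
set S0 := \sum_(y : {set B} | y \subset Q) _.
suff: S <= S' + (P * S1 + (1 - P) * S0) by lra.
rewrite /S /S' /S1 /S0 !mulr_sumr -!big_split /=.
apply: ler_sum => y yQ /=.
rewrite -/P !cprob_open ?cprob_closed //.
set q := copen Q y b; set c := cprob Q y.
have c0 : 0 <= c by apply: cprob_ge0.
have q0 : 0 <= q by apply: copen_ge0.
have q1 : q <= 1 by apply: copen_le1.
have hlip := coupled_lip wf1 (s1 _ xQ) (subsetUr [set b] y) (s1 _ yQ).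
have hinc1 := coupled_incr wf1 (s1 _ xQ) (subsetUr [set b] y) (s1 _ yQ).
have hinc0 := coupled_incr wf0 (s0 _ xQ) (subsetUr [set b] y) (s1 _ yQ).
move: hlip hinc1 hinc0.
set a11 := coupled T1 _ _ (b |: y); set a10 := coupled T1 _ _ y.
set a01 := coupled T0 _ _ (b |: y); set a00 := coupled T0 _ _ y.
set G1 := cmean _ (b |: y) g; set G0 := cmean _ y g.
set m := Num.min P q => hlip hinc1 hinc0.
have m_ge : 0 <= m - P * q.
  by rewrite /m; case: (leP P q) => _; nra.
have m_le : m - P * q <= q * (1 - q).
  by rewrite /m; case: (leP P q) => h; nra.
(* The four joint masses deviate from the independent ones by plus or minus [m - P * q], hence the
   mixed difference. Its part with X closed is nonnegative by [coupled_incr], and its part with X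
   open is at most [G1 - G0] by [coupled_lip]. *)
rewrite [leLHS](_ : _ = c * ((m - P * q) * ((a11 - a10) - (a01 - a00)) +
  (P * (q * a11 + (1 - q) * a10) + (1 - P) * (q * a01 + (1 - q) * a00)))); last by ring.
rewrite [leRHS](_ : _ = c * (q * (1 - q) * (G1 - G0) +
  (P * (q * a11 + (1 - q) * a10) + (1 - P) * (q * a01 + (1 - q) * a00)))); last by ring.
rewrite ler_wpM2l // lerD2r.
apply: (@le_trans _ _ ((m - P * q) * (G1 - G0))).
  by rewrite ler_wpM2l //; lra.
by rewrite ler_wpM2r //; lra.
Qed.

Lemma osss T : dtree_wf set0 T ->
  wcov mu (deval T) g <=
  \sum_b wmean mu (dqueries b T) * wcov mu (fun X => (b \in X)%:R) g.
Proof.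
move=> wf; have := osss_step wf (sub0set set0).
rewrite (big_pred1 set0) => [|y]; last by rewrite /= subset0.
have mean0 f : cmean set0 set0 f = wmean mu f.
  rewrite (wmean_cmean set0) (big_pred1 set0) => [|y]; last by rewrite /= subset0.
  have := sum_cprob set0; rewrite (big_pred1 set0) => [->|y]; last by rewrite /= subset0.
  by rewrite mul1r.
have := sum_cprob set0; rewrite (big_pred1 set0) => [->|y]; last by rewrite /= subset0.
rewrite mul1r coupled_diag // !mean0 /wcov => /le_trans; apply.
by apply: ler_sum => b _; rewrite mean0.
Qed.

End Coupling.
End OSSS.

(** * Decision trees given by explorations *)

Section Exploration.
Variables (R : realFieldType) (B : finType) (mu : {set B} -> R).
Hypothesis mu_gt0 : forall X, 0 < mu X.
Hypothesis mu_lat :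
  forall X Y, mu X * mu Y <= mu (X :|: Y) * mu (X :&: Y).
(* [D b X] means that [b] is to be explored when [X] is the set of open
   variables, so an exploration that has queried [Q] looks at [D b (X :&: Q)]. *)
Variables (D : B -> {set B} -> bool) (f : {set B} -> bool).
Hypothesis D_incr : forall b (X Y : {set B}), X \subset Y -> D b X -> D b Y.
Hypothesis f_incr : forall X Y : {set B}, X \subset Y -> f X -> f Y.
(** Once every variable that is due has been queried, what has been revealed decides [f]. *)
Hypothesis D_stop : forall X Q : {set B},
  (forall b, D b (X :&: Q) -> b \in Q) -> f X = f (X :&: Q).

(** [Q] is the set of queried variables and [O] its open part; [n] is fuel, sufficient when it
    bounds the number of variables not yet queried. The order of the queries is irrelevant, hence
    [pick]. *)
Fixpoint explore n (Q O : {set B}) : dtree R B :=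
  if n is n'.+1 then
    if [pick b | (b \notin Q) && D b O] is Some b then
      Node b (explore n' (b |: Q) O) (explore n' (b |: Q) (b |: O))
    else Leaf (f O)%:R
  else Leaf (f O)%:R.

Lemma explore_wf n Q O : dtree_wf Q (explore n Q O).
Proof.
elim: n Q O => [|n IHn] Q O /=; first by case: f; rewrite /= ?lexx ?ler01.
case: pickP => [b /andP[bQ _]|_] /=; last by case: f; rewrite /= ?lexx ?ler01.
by rewrite bQ !IHn.
Qed.

Lemma explore_query (Q X : {set B}) b : b \notin Q ->
  X :&: (b |: Q) = if b \in X then b |: (X :&: Q) else X :&: Q.
Proof.
move=> bQ; rewrite setIUr; case: ifPn => bX.
  by congr (_ :|: _); apply/setIidPr; rewrite sub1set.
apply/setUidPr/subsetP => c; rewrite !inE => /andP[cX /eqP cb].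
by rewrite -cb cX in bX.
Qed.

Lemma deval_explore n Q X : (#|~: Q| <= n)%N ->
  deval (explore n Q (X :&: Q)) X = (f X)%:R.
Proof.
elim: n Q => [|n IHn] Q /=.
  rewrite leqn0 cards_eq0 => /eqP Q0.
  by rewrite -(setCK Q) Q0 setC0 setIT.
move=> Qn; case: pickP => [b /andP[bQ _]|none] /=.
  have {}Qn : (#|~: (b |: Q)| <= n)%N.
    have -> : ~: (b |: Q) = ~: Q :\ b by apply/setP => c; rewrite !inE negb_or.
    by move: Qn; rewrite (cardsD1 b (~: Q)) inE bQ.
  have := IHn _ Qn; rewrite explore_query //.
  by case: ifP.
rewrite -(@D_stop X Q) // => b Db; apply: contraFT (none b) => bQ.
by rewrite bQ Db.
Qed.

(** A queried variable was due for the part of [X] known at that time, so by monotonicity of [D] it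
    is due for the whole of [X]. *)
Lemma dqueries_explore n Q X c :
  dqueries c (explore n Q (X :&: Q)) X <= ((c \notin Q) && D c X)%:R :> R.
Proof.
elim: n Q => [|n IHn] Q /=; first exact: ler0n.
case: pickP => [b /andP[bQ Db]|_] /=; last exact: ler0n.
have {IHn} : (if b \in X then dqueries c (explore n (b |: Q) (b |: (X :&: Q))) X
   else dqueries c (explore n (b |: Q) (X :&: Q)) X)
    <= ((c \notin b |: Q) && D c X)%:R.
  by have := IHn (b |: Q); rewrite explore_query //; case: ifP.
rewrite -(lerD2l (c == b)%:R) => /le_trans; apply.
rewrite !inE; have [->|cb] := eqVneq c b; last by rewrite add0r.
by rewrite bQ (D_incr (subsetIl _ _) Db) addr0.
Qed.

(** As [f] takes the values 0 and 1, the left side is its covariance with itself; the probability of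
    querying [b] is at most that of [D b]. *)
Lemma osss_explore :
  wmean mu (fun X => (f X)%:R) * (1 - wmean mu (fun X => (f X)%:R))
  <= \sum_b wmean mu (fun X => (D b X)%:R) *
            wcov mu (fun X => (b \in X)%:R) (fun X => (f X)%:R).
Proof.
have mu_ge0 X := ltW (mu_gt0 X).
have f_mono : increasing_set (fun X : {set B} => (f X)%:R : R).
  move=> X Y XY; rewrite ler_nat; case: (boolP (f X)) => // fX.
  by rewrite (f_incr XY fX).
have T_wf := explore_wf #|B| set0 set0.
have evalE X : deval (explore #|B| set0 set0) X = (f X)%:R.
  by have := @deval_explore #|B| set0 X; rewrite setI0 setC0 cardsT; apply.
have := osss mu_gt0 mu_lat f_mono T_wf.
have -> : wcov mu (deval (explore #|B| set0 set0)) (fun X => (f X)%:R) =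
   wmean mu (fun X => (f X)%:R) * (1 - wmean mu (fun X => (f X)%:R)).
  rewrite /wcov mulrBr mulr1; congr (_ - _ * _); apply: eq_wmean => X _; rewrite evalE //.
  by case: f; rewrite ?mulr1 ?mulr0.
move=> /le_trans; apply; apply: ler_sum => b _; apply: ler_wpM2r.
  by apply: fkg => //; [apply: sum_mu_gt0|apply: indic_incr].
apply: ler_wmean => // X _.
by have := dqueries_explore #|B| set0 X b; rewrite setI0 in_set0.
Qed.

End Exploration.

(** * Group-valued spins and connections *)

Section SpinModel.
Variables (R : realFieldType) (V K : finZmodType) (T : finType).
Variables (dir : bool -> V) (kt : T -> K -> bool).
Hypothesis kt0 : forall t, kt t 0.
Hypothesis ktB : forall t x y, kt t x -> kt t y -> kt t (x - y).

Local Notation spins := {ffun V -> K}.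
Local Notation bond := (V * bool * T)%type.
Implicit Types (s : spins) (w X Y : {set bond}) (W : {set V}) (b : bond).
Implicit Types (r : T -> R) (chi : spins -> R).

Definition src b : V := b.1.1.
Definition tgt b : V := b.1.1 + dir b.1.2.

Definition satisfied b s : bool := kt b.2 (s (src b) - s (tgt b)).

Definition pinned W s : bool := [forall v in W, s v == 0].

Definition compat W w : {set spins} :=
  [set s | pinned W s && [forall b in w, satisfied b s]].

Lemma satisfied0 b : satisfied b 0.
Proof. by rewrite /satisfied !ffunE subrr. Qed.

Lemma satisfiedB b s s' : satisfied b s -> satisfied b s' -> satisfied b (s - s').
Proof.
rewrite /satisfied => h h'.
suff -> : (s - s') (src b) - (s - s') (tgt b) =
  (s (src b) - s (tgt b)) - (s' (src b) - s' (tgt b)) by apply: ktB.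
by rewrite !ffunE !opprD !opprK addrACA.
Qed.

Lemma compat0 W w : 0 \in compat W w.
Proof.
rewrite inE; apply/andP; split.
  by apply/forall_inP => v _; rewrite ffunE.
by apply/forall_inP => b _; apply: satisfied0.
Qed.

Lemma compatB W w s s' : s \in compat W w -> s' \in compat W w ->
  s - s' \in compat W w.
Proof.
rewrite !inE => /andP[/forall_inP p /forall_inP h] /andP[/forall_inP p' /forall_inP h'].
apply/andP; split; apply/forall_inP.
  by move=> v vW; rewrite !ffunE (eqP (p v vW)) (eqP (p' v vW)) subrr.
by move=> b bw; apply: satisfiedB; [apply: h|apply: h'].
Qed.

Lemma compatN W w s : s \in compat W w -> - s \in compat W w.
Proof. by move=> sG; rewrite -sub0r compatB ?compat0. Qed.

Lemma compatD W w s s' : s \in compat W w -> s' \in compat W w ->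
  s + s' \in compat W w.
Proof. by move=> sG s'G; rewrite -[s']opprK compatB ?compatN. Qed.

Lemma compatS W W' w w' : W \subset W' -> w \subset w' ->
  compat W' w' \subset compat W w.
Proof.
move=> /subsetP WW' /subsetP ww'; apply/subsetP => s; rewrite !inE.
case/andP=> /forall_inP p /forall_inP h; apply/andP; split; apply/forall_inP.
  by move=> v /WW'; apply: p.
by move=> b /ww'; apply: h.
Qed.

(** Two pairs in the product of [A] and [C] with the same sum have first components that differ by
    an element of [A :&: C], which bounds every fibre of the addition map. *)
Lemma card_subgroup_prod (A C E : {set spins}) :
  (forall s s', s \in A -> s' \in A -> s - s' \in A) ->
  (forall s s', s \in C -> s' \in C -> s - s' \in C) ->
  (forall s s', s \in A -> s' \in C -> s + s' \in E) ->
  (#|A| * #|C| <= #|E| * #|A :&: C|)%N.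
Proof.
move=> subA subC AC.
rewrite -cardsX -sum1_card.
rewrite (partition_big (fun p : spins * spins => p.1 + p.2) (mem E)) /=; last first.
  by case=> s s'; rewrite inE => /andP[]; apply: AC.
rewrite -sum_nat_const; apply: leq_sum => c _.
rewrite sum1dep_card.
set F := [set x | _].
have [->|[[a0 c0] a0F]] := set_0Vmem F; first by rewrite cards0.
move: a0F; rewrite !inE /= => /andP[/andP[a0A c0C] /eqP ac0].
have F_inj : {in F &, injective (fun x : spins * spins => x.1 - a0)}.
  move=> [a1 c1] [a2 c2]; rewrite !inE /= => /andP[_ /eqP h1] /andP[_ /eqP h2].
  by move=> /addIr e; move: h1; rewrite -h2 e => /addrI->.
rewrite -(card_in_imset F_inj).
apply/subset_leq_card/subsetP => _ /imsetP[[a c1] acF ->].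
move: acF; rewrite !inE /= => /andP[/andP[aA c1C] /eqP ac].
rewrite subA // (_ : a - a0 = c0 - c1) ?subC //.
apply/eqP; rewrite subr_eq addrAC eq_sym subr_eq.
by rewrite addrC ac0 -ac.
Qed.

(** The two groups on the left intersect in the group of the union, and sums of their elements
    satisfy the constraints common to both. Letting the pinned sets differ compares two boundary
    conditions at once. *)
Lemma compat_lattice W W' X Y : W \subset W' ->
  (#|compat W X| * #|compat W' Y| <=
   #|compat W' (X :|: Y)| * #|compat W (X :&: Y)|)%N.
Proof.
move=> WW'; rewrite [leqRHS]mulnC.
have -> : compat W' (X :|: Y) = compat W X :&: compat W' Y.
  apply/setP => s; apply/idP/setIP => [h|[]].
    by split; apply: (subsetP (compatS _ _) _ h); rewrite ?subsetUl ?subsetUr.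
  rewrite !inE => /andP[_ /forall_inP h] /andP[-> /forall_inP h'] /=.
  by apply/forall_inP => b; rewrite inE => /orP[/h|/h'].
apply: card_subgroup_prod; try exact: compatB.
move=> s s' h h'; apply: compatD.
  by apply: (subsetP (compatS _ _) _ h); rewrite ?subsetIl.
by apply: (subsetP (compatS _ _) _ h'); rewrite ?subsetIr.
Qed.

Definition bweight r W w : R := (\prod_(b in w) r b.2) * #|compat W w|%:R.

Lemma card_compat_gt0 W w : (0 < #|compat W w|)%N.
Proof. by apply/card_gt0P; exists 0; apply: compat0. Qed.

Lemma bweight_gt0 r W w : (forall t, 0 < r t) -> 0 < bweight r W w.
Proof.
by move=> r0; rewrite mulr_gt0 ?prodr_gt0 // ltr0n card_compat_gt0.
Qed.

Lemma sum_bweight_gt0 r W : (forall t, 0 < r t) -> 0 < \sum_w bweight r W w.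
Proof.
move=> r0; rewrite (bigD1 set0) //= ltr_pwDl ?bweight_gt0 // sumr_ge0 // => w _.
exact/ltW/bweight_gt0.
Qed.

(** With equal parameters this is the FKG lattice condition; with different ones it is Holley's
    condition, the source of monotonicity in the inverse temperature and in the pinned set. *)
Lemma bweight_lattice r r' W W' X Y :
  (forall t, 0 < r t) -> (forall t, r t <= r' t) -> W \subset W' ->
  bweight r W X * bweight r' W' Y <= bweight r' W' (X :|: Y) * bweight r W (X :&: Y).
Proof.
move=> r0 rr' WW'; have r'0 t := lt_le_trans (r0 t) (rr' t).
rewrite /bweight mulrACA [leRHS]mulrACA -!natrM.
apply: ler_pM; rewrite ?ler_nat ?compat_lattice ?ler0n //.
  by rewrite mulr_ge0 // prodr_ge0 // => b _; apply: ltW.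
rewrite [X in X * _ <= _](big_setID Y) [X in _ <= X * _](big_setID Y) /=.
have -> : (X :|: Y) :&: Y = Y by apply/setIidPr/subsetUr.
have -> : (X :|: Y) :\: Y = X :\: Y by rewrite setDUl setDv setU0.
rewrite mulrAC [leRHS]mulrAC [X in _ <= X * _]mulrC ler_wpM2l //.
  by rewrite mulr_ge0 // prodr_ge0 // => b _; apply: ltW.
by apply: ler_prod => b _; rewrite rr' ltW.
Qed.

Definition is_char chi : Prop :=
  (forall s s', chi (s + s') = chi s * chi s') /\ (forall s, chi s = 1 \/ chi s = -1).

(** A character sums to 0 over the group of compatible spins unless it is trivial there, so the
    probability of this event is the mean of [chi]. *)
Definition triv chi W w : bool := [forall s in compat W w, chi s == 1].

Lemma triv_incr chi W W' w w' : W \subset W' -> w \subset w' ->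
  triv chi W w -> triv chi W' w'.
Proof.
move=> WW' ww' /forall_inP h; apply/forall_inP => s sG.
by apply: h; apply: (subsetP (compatS WW' ww')).
Qed.

Lemma sum_char chi W w : is_char chi ->
  \sum_(s in compat W w) chi s = (triv chi W w)%:R * #|compat W w|%:R.
Proof.
case=> chiD chi1; have [h|h] := boolP (triv chi W w).
  rewrite mul1r -sumr_const; apply: eq_bigr => s sG.
  exact/eqP/(forall_inP h).
rewrite mul0r.
have [s0 s0G chis0] : exists2 s0, s0 \in compat W w & chi s0 != 1.
  by move: h; rewrite negb_forall_in => /exists_inP.
have {}chis0 : chi s0 = -1 by case: (chi1 s0) chis0 => -> //; rewrite eqxx.
set S := \sum_(s in _) _; suff : S = - S by lra.
rewrite {1}/S (reindex_inj (addrI s0)) /= -sumrN; apply: eq_big => [s|s _].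
  apply/idP/idP => [h1|h1]; last exact: compatD.
  by rewrite -[s](addKr s0) compatD ?compatN.
by rewrite chiD chis0 mulN1r.
Qed.

Definition sweight r s : R := \prod_b (1 + r b.2 * (satisfied b s)%:R).

Definition smean r W chi : R :=
  (\sum_(s | pinned W s) sweight r s * chi s) / \sum_(s | pinned W s) sweight r s.

Lemma sweightE r s :
  sweight r s = \sum_(w : {set bond}) (\prod_(b in w) r b.2) * [forall b in w, satisfied b s]%:R.
Proof.
rewrite /sweight; under eq_bigr do rewrite addrC.
rewrite bigA_distr; apply: eq_bigr => w _.
rewrite (bigID (mem w)) /= [X in _ * X]big1 ?mulr1; last by move=> b /negPf->.
rewrite (eq_bigr (fun b => r b.2 * (satisfied b s)%:R)); last by move=> b ->.
rewrite big_split /=; congr (_ * _); case: forall_inP => [h|h].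
  by apply: big1 => b /h->.
have [b bw nb] : exists2 b, b \in w & ~~ satisfied b s.
  by apply/exists_inP; rewrite -negb_forall_in; apply/negP => /forall_inP.
by apply/eqP; rewrite prodf_seq_eq0; apply/hasP; exists b; rewrite ?mem_index_enum //= bw (negPf nb) eqxx.
Qed.

(* The Edwards-Sokal coupling. *)
Lemma sum_sweight r W chi :
  \sum_(s | pinned W s) sweight r s * chi s =
  \sum_(w : {set bond}) (\prod_(b in w) r b.2) * \sum_(s in compat W w) chi s.
Proof.
under eq_bigr do rewrite sweightE mulr_suml.
rewrite exchange_big /=; apply: eq_bigr => w _.
rewrite mulr_sumr big_mkcond [RHS]big_mkcond; apply: eq_bigr => s _.
by rewrite inE; case: (pinned W s); case: forall_inP => _ //=; rewrite ?mulr1 // mulr0 mul0r.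
Qed.

Lemma sum_sweight1 r W : \sum_(s | pinned W s) sweight r s = \sum_w bweight r W w.
Proof.
under eq_bigr do rewrite -[sweight r _]mulr1.
by rewrite sum_sweight; apply: eq_bigr => w _; rewrite sumr_const.
Qed.

Lemma smean_char r W chi : is_char chi ->
  smean r W chi = wmean (bweight r W) (fun w => (triv chi W w)%:R).
Proof.
move=> chiP; rewrite /smean /wmean sum_sweight1 sum_sweight; congr (_ / _).
by apply: eq_bigr => w _; rewrite sum_char // /bweight -mulrA [_%:R * _]mulrC mulrA.
Qed.

Lemma smean_char_incr r r' W W' chi : is_char chi ->
  (forall t, 0 < r t) -> (forall t, r t <= r' t) -> W \subset W' ->
  smean r W chi <= smean r' W' chi.
Proof.
move=> chiP r0 rr' WW'; have r'0 t := lt_le_trans (r0 t) (rr' t).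
rewrite !smean_char //; apply: (@le_trans _ _ (wmean (bweight r' W') (fun w => (triv chi W w)%:R))).
  apply: holley => [w|w|||X Y|X Y XY]; rewrite ?sum_bweight_gt0 //.
  - exact/ltW/bweight_gt0.
  - exact/ltW/bweight_gt0.
  - exact: bweight_lattice.
  by rewrite ler_nat; case: (boolP (triv chi W X)) => // /(triv_incr (subxx W) XY)->.
apply: ler_wmean => [w|w _]; first exact/ltW/bweight_gt0.
by rewrite ler_nat; case: (boolP (triv chi W w)) => // /(triv_incr WW' (subxx w))->.
Qed.

Lemma smean_char_ge0 r W chi : is_char chi -> (forall t, 0 < r t) ->
  0 <= smean r W chi.
Proof.
move=> chiP r0; rewrite smean_char //; apply: wmean_ge0 => w *; last exact: ler0n.
exact/ltW/bweight_gt0.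
Qed.

Lemma is_charM chi chi' : is_char chi -> is_char chi' ->
  is_char (fun s => chi s * chi' s).
Proof.
case=> chiD chi1 [chi'D chi'1]; split=> [s s'|s]; first by rewrite chiD chi'D mulrACA.
by case: (chi1 s) => ->; case: (chi'1 s) => ->; rewrite ?mulr1 ?mulrN1 ?opprK; auto.
Qed.

(** Griffiths' second inequality. The trivialities of the two characters are increasing events,
    positively correlated by FKG, and together they imply that of the product. *)
Lemma smean_gks r W chi chi' : is_char chi -> is_char chi' -> (forall t, 0 < r t) ->
  smean r W chi * smean r W chi' <= smean r W (fun s => chi s * chi' s).
Proof.
move=> chiP chi'P r0; have chichi'P := is_charM chiP chi'P.
rewrite !smean_char //.
have b0 w := ltW (bweight_gt0 W w r0).
apply: (@le_trans _ _ (wmean (bweight r W)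
    (fun w => (triv chi W w)%:R * (triv chi' W w)%:R))).
  rewrite -subr_ge0; apply: fkg => // [|X Y|X Y XY|X Y XY].
  - exact: sum_bweight_gt0.
  - exact: bweight_lattice.
  - by rewrite ler_nat; case: (boolP (triv chi W X)) => // /(triv_incr (subxx W) XY)->.
  - by rewrite ler_nat; case: (boolP (triv chi' W X)) => // /(triv_incr (subxx W) XY)->.
apply: ler_wmean => // w _; rewrite -natrM mulnb ler_nat.
case: (boolP (triv chi W w)) => // /forall_inP h.
case: (boolP (triv chi' W w)) => // /forall_inP h'.
rewrite (_ : triv _ _ _ = true) //; apply/forall_inP => s sG.
by rewrite (eqP (h _ sG)) (eqP (h' _ sG)) mulr1.
Qed.

End SpinModel.

(** * Connections by relevant bonds *)

Section Connectivity.
Variables (R : realFieldType) (V K : finZmodType) (T : finType).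
Variables (dir : bool -> V) (kt : T -> K -> bool).
Hypothesis kt0 : forall t, kt t 0.
Hypothesis ktB : forall t x y, kt t x -> kt t y -> kt t (x - y).

Local Notation spins := {ffun V -> K}.
Local Notation bond := (V * bool * T)%type.
Local Notation src := (@src V T).
Local Notation tgt := (tgt dir).
Local Notation compat := (compat dir kt).
Local Notation triv := (triv dir kt).
Local Notation bweight := (bweight dir kt).
Local Notation smean := (smean dir kt).
Implicit Types (s : spins) (w X Y : {set bond}) (W P : {set V}) (b : bond).
Implicit Types (r : T -> R) (u v : V) (phi psi : K -> bool) (rl : pred T).

Definition incident b u v : bool := (src b == u) && (tgt b == v).

(** Only bonds of the kinds in [rl] connect; these will be the kinds that force [phi] to be
    constant. *)
Definition adj rl w u v : bool :=
  [exists b in w, rl b.2 && (incident b u v || incident b v u)].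

Definition reach rl w u P : bool := [exists v in P, connect (adj rl w) u v].

Lemma adj_sym rl w : symmetric (adj rl w).
Proof.
by move=> u v; apply/exists_inP/exists_inP => -[b bw h]; exists b; rewrite // orbC.
Qed.

Lemma connect_adjC rl w : connect_sym (adj rl w).
Proof. exact/sym_connect_sym/adj_sym. Qed.

Lemma adj_incr rl w w' u v : w \subset w' -> adj rl w u v -> adj rl w' u v.
Proof.
by move=> /subsetP ww' /exists_inP[b bw h]; apply/exists_inP; exists b => //; apply: ww'.
Qed.

Lemma connect_adj_incr rl w w' u v : w \subset w' ->
  connect (adj rl w) u v -> connect (adj rl w') u v.
Proof.
by move=> ww'; apply: connect_sub => x y xy; apply/connect1/(adj_incr ww').
Qed.

Lemma reach_incr rl w w' u P P' : w \subset w' -> P \subset P' ->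
  reach rl w u P -> reach rl w' u P'.
Proof.
move=> ww' /subsetP PP' /exists_inP[v vP uv]; apply/exists_inP; exists v.
  exact: PP'.
exact: connect_adj_incr uv.
Qed.

Definition xor_form phi : Prop := forall x y, phi (x + y) = phi x (+) phi y.

Definition chi_at phi u s : R := (-1) ^+ phi (s u).

Lemma form0 phi : xor_form phi -> phi 0 = false.
Proof. by move=> h; have := h 0 0; rewrite addr0; case: (phi 0). Qed.

Lemma formN phi x : xor_form phi -> phi (- x) = phi x.
Proof.
move=> h; have := h x (- x); rewrite subrr (form0 h).
by case: (phi x); case: (phi _).
Qed.

Lemma chi_at_char phi u : xor_form phi -> is_char (chi_at phi u).
Proof.
move=> h; split=> [s s'|s]; first by rewrite /chi_at ffunE h signr_addb.
by rewrite /chi_at; case: (phi _); [right|left].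
Qed.

Lemma form_connect rl phi W w s u v : xor_form phi ->
  (forall t x, rl t -> kt t x -> phi x = false) ->
  s \in compat W w -> connect (adj rl w) u v -> phi (s u) = phi (s v).
Proof.
move=> phiP rlP; rewrite inE => /andP[_ /forall_inP h] /connectP[p].
elim: p u => [|x p IHp] u /=; first by move=> _ ->.
case/andP=> ux xp vE; rewrite -(IHp _ xp vE) {IHp xp vE}.
case/exists_inP: ux => b /h; rewrite /satisfied => sat /andP[rb uvb].
have := rlP _ _ rb sat; rewrite phiP formN //.
by case/orP: uvb => /andP[/eqP-> /eqP->]; case: (phi _); case: (phi _).
Qed.

Lemma reach_triv rl phi W w u : xor_form phi ->
  (forall t x, rl t -> kt t x -> phi x = false) ->
  reach rl w u W -> triv (chi_at phi u) W w.
Proof.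
move=> phiP rlP /exists_inP[v vW uv]; apply/forall_inP => s sG.
rewrite /chi_at (form_connect phiP rlP sG uv).
move: sG; rewrite inE => /andP[/forall_inP/(_ _ vW)/eqP-> _].
by rewrite form0.
Qed.

(** If the cluster of [u] avoids [W], the spin equal to [g] on it and to 0 elsewhere is compatible:
    relevant bonds do not leave the cluster, and the others accept the increments 0, g and -g. Its
    character at [u] is -1. *)
Lemma triv_reach rl psi g W w u : psi g -> psi 0 = false ->
  (forall t, ~~ rl t -> kt t g) ->
  triv (chi_at psi u) W w -> reach rl w u W.
Proof.
move=> psig psi0 irl /forall_inP h; apply/contraT => nr.
pose C := [pred v | connect (adj rl w) u v].
pose s : spins := [ffun v => if C v then g else 0].
have sG : s \in compat W w.
  rewrite inE; apply/andP; split.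
    apply/forall_inP => v vW; rewrite ffunE; case: ifP => // uv.
    by case/negP: nr; apply/exists_inP; exists v.
  apply/forall_inP => b bw; rewrite /satisfied !ffunE.
  have [rb|/irl kg] := boolP (rl b.2); last first.
    by case: ifP => _; case: ifP => _; rewrite ?subrr ?subr0 ?sub0r // -sub0r ktB.
  have -> : C (src b) = C (tgt b).
    have bb : adj rl w (src b) (tgt b).
      by apply/exists_inP; exists b; rewrite // rb /incident !eqxx.
    rewrite /= ; apply/idP/idP => /connect_trans; apply; apply: connect1 => //.
    by rewrite adj_sym.
  by rewrite subrr.
have := h _ sG; rewrite /chi_at ffunE /C /= connect0 psig.
by rewrite expr1 eq_sym -subr_eq0 opprK -[1 + 1]/(2%:R) pnatr_eq0.
Qed.

Definition bprob r W (E : {set bond} -> bool) : R :=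
  wmean (bweight r W) (fun w => (E w)%:R).

Lemma bprob_sub r W (E E' : {set bond} -> bool) : (forall t, 0 < r t) ->
  (forall w, E w -> E' w) -> bprob r W E <= bprob r W E'.
Proof.
move=> r0 EE'; apply: ler_wmean => w *; first exact/ltW/bweight_gt0.
by rewrite ler_nat; case: (boolP (E w)) => // /EE'->.
Qed.

Lemma bprob_ge0 r W (E : {set bond} -> bool) : (forall t, 0 < r t) ->
  0 <= bprob r W E.
Proof.
by move=> r0; apply: wmean_ge0 => w *; rewrite ?ler0n //; apply/ltW/bweight_gt0.
Qed.

Lemma bprob_le1 r W (E : {set bond} -> bool) : (forall t, 0 < r t) ->
  bprob r W E <= 1.
Proof.
move=> r0; have Z : \sum_w bweight r W w != 0 by rewrite gt_eqF // sum_bweight_gt0.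
rewrite -[leRHS](wmean_cst 1 Z); apply: ler_wmean => w *.
  exact/ltW/bweight_gt0.
by rewrite lern1 leq_b1.
Qed.

Lemma bprob_orb r W (E E' : {set bond} -> bool) : (forall t, 0 < r t) ->
  bprob r W (fun w => E w || E' w) <= bprob r W E + bprob r W E'.
Proof.
move=> r0; rewrite -wmeanD; apply: ler_wmean => w *; first exact/ltW/bweight_gt0.
by rewrite -natrD ler_nat; case: (E w); case: (E' w).
Qed.

Lemma bprob_incr r r' W W' (E : {set bond} -> bool) :
  (forall t, 0 < r t) -> (forall t, r t <= r' t) -> W \subset W' ->
  (forall w w', w \subset w' -> E w -> E w') -> bprob r W E <= bprob r' W' E.
Proof.
move=> r0 rr' WW' E_incr; have r'0 t := lt_le_trans (r0 t) (rr' t).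
apply: holley => [w|w|||X Y|X Y XY]; rewrite ?sum_bweight_gt0 //.
- exact/ltW/bweight_gt0.
- exact/ltW/bweight_gt0.
- exact: bweight_lattice.
- by rewrite ler_nat; case: (boolP (E X)) => // /(E_incr _ _ XY)->.
Qed.

Section Radius.
Variable rad : V -> nat.
Hypothesis rad0 : rad 0 = 0%N.
Hypothesis radD : forall u v, (rad (u + v)%R <= rad u + rad v)%N.
Hypothesis radN : forall u, rad (- u)%R = rad u.
Hypothesis rad_dir : forall d, (rad (dir d) <= 1)%N.
Variables (rl : pred T) (phi : K -> bool) (g : K).
Hypothesis phiP : xor_form phi.
Hypothesis rl_phi : forall t x, rl t -> kt t x -> phi x = false.
Hypothesis phi_g : phi g.
Hypothesis irl_g : forall t, ~~ rl t -> kt t g.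

Definition outside u n : {set V} := [set v | (n <= rad (v - u)%R)%N].

Definition magn r n : R := smean r (outside 0 n) (chi_at phi 0).

Definition shift u s : spins := [ffun v => s (v + u)].

Lemma shiftK u : cancel (shift u) (shift (- u)).
Proof. by move=> s; apply/ffunP => v; rewrite !ffunE addrNK. Qed.

Lemma shiftKV u : cancel (shift (- u)) (shift u).
Proof. by move=> s; apply/ffunP => v; rewrite !ffunE addrK. Qed.

Lemma sweight_shift r u s : sweight dir kt r (shift u s) = sweight dir kt r s.
Proof.
rewrite /sweight [RHS](reindex_inj (h := fun b : bond => (b.1.1 + u, b.1.2, b.2))) /=.
  apply: eq_bigr => b _.
  by rewrite /satisfied /tgt /src !ffunE /= addrAC.
by move=> [[v d] t] [[v' d'] t'] [] /addIr-> -> ->.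
Qed.

Lemma pinned_shift u n s : pinned (outside 0 n) (shift u s) = pinned (outside u n) s.
Proof.
apply/forall_inP/forall_inP => h v.
  rewrite inE => vn; have := h (v - u); rewrite inE subr0 => /(_ vn).
  by rewrite ffunE subrK.
rewrite inE subr0 => vn; rewrite ffunE; apply: h.
by rewrite inE addrK.
Qed.

Lemma smean_shift r u n : smean r (outside u n) (chi_at phi u) = magn r n.
Proof.
have bij : {on [pred s | pinned (outside 0 n) s], bijective (shift u)}.
  by exists (shift (- u)) => s _; [apply: shiftK|apply: shiftKV].
rewrite /magn /smean [in RHS](reindex _ bij) [X in _ = _ / X](reindex _ bij) /=.
congr (_ / _); apply: eq_big => [s|s _]; rewrite ?pinned_shift ?sweight_shift //.
by rewrite /chi_at ffunE add0r.
Qed.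

Lemma smean_reach r W u : (forall t, 0 < r t) ->
  smean r W (chi_at phi u) = bprob r W (fun w => reach rl w u W).
Proof.
move=> r0; rewrite smean_char //; last exact: chi_at_char.
apply: eq_wmean => w _; congr ((_ : bool)%:R); apply/idP/idP.
  by apply: (triv_reach (g := g)); rewrite ?form0.
exact: reach_triv.
Qed.

Lemma magn_ge0 r n : (forall t, 0 < r t) -> 0 <= magn r n.
Proof. by move=> r0; apply: smean_char_ge0 => //; apply: chi_at_char. Qed.

Lemma outsideS u n k : (k <= n)%N -> outside u n \subset outside u k.
Proof. by move=> kn; apply/subsetP => v; rewrite !inE; apply: leq_trans. Qed.

Lemma magn_incr r r' n k : (forall t, 0 < r t) -> (forall t, r t <= r' t) ->
  (k <= n)%N -> magn r n <= magn r' k.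
Proof.
move=> r0 rr' kn; apply: smean_char_incr => //; first exact: chi_at_char.
exact: outsideS.
Qed.

(** Pinning more vertices and enlarging the target both raise the probability, so both sets may be
    replaced by the complement of the ball about [u]; translation then brings [u] to the origin. *)
Lemma bprob_reach_le r W P u n : (forall t, 0 < r t) ->
  W \subset outside u n -> P \subset outside u n ->
  bprob r W (fun w => reach rl w u P) <= magn r n.
Proof.
move=> r0 Wu Pu; rewrite -(smean_shift r u) smean_reach //.
apply: (@le_trans _ _ (bprob r (outside u n) (fun w => reach rl w u P))).
  by apply: bprob_incr => // w w' ww'; apply: reach_incr.
by apply: bprob_sub => // w; apply: reach_incr.
Qed.

Lemma rad_le u v : (rad u <= rad v + rad (u - v)%R)%N.
Proof. by rewrite -{1}(subrK v u) addnC radD. Qed.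

Lemma radB u v : rad (u - v)%R = rad (v - u)%R.
Proof. by rewrite -radN opprB. Qed.

Lemma rad_adj w u v : adj rl w u v -> (rad v <= (rad u).+1)%N.
Proof.
case/exists_inP=> b _ /andP[_ h]; apply: (leq_trans (rad_le v u)).
rewrite -addn1 leq_add2l.
case/orP: h => /andP[/eqP<- /eqP<-]; last rewrite radB;
  by rewrite /tgt addrC addKr.
Qed.

Definition inner n : {set bond} :=
  [set b | (rad (src b) < n)%N || (rad (tgt b) < n)%N].

Definition sphere n : {set V} := [set v | rad v == n].

(** A path stopped at its first vertex of radius at least [n] uses only bonds with an end of radius
    below [n]. *)
Lemma reach_inner w u n k : (n <= k)%N -> reach rl w u (outside 0 k) ->
  reach rl (w :&: inner n) u (outside 0 n).
Proof.
move=> nk /exists_inP[v]; rewrite inE subr0 => vk /connectP[p].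
elim: p u => [|x p IHp] u /=.
  move=> _ vu; apply/exists_inP; exists u => //.
  by rewrite inE subr0 -vu (leq_trans nk).
case/andP=> ux xp vE; have [un|un] := leqP n (rad u).
  by apply/exists_inP; exists u; rewrite // inE subr0.
have /exists_inP[z zn xz] := IHp _ xp vE; apply/exists_inP; exists z => //.
apply: connect_trans xz; apply: connect1.
case/exists_inP: ux => b bw /andP[rb h]; apply/exists_inP; exists b; last by rewrite rb.
rewrite inE bw inE; case/orP: h => /andP[/eqP e1 /eqP e2].
  by rewrite e1 un.
by rewrite e2 un orbT.
Qed.

(** The radius grows by at most 1 along a bond, so it cannot jump over k. *)
Lemma connect_sphere w u v k : (rad u <= k)%N -> (k <= rad v)%N ->
  connect (adj rl w) u v ->
  exists2 z, z \in sphere k & connect (adj rl w) u z /\ connect (adj rl w) z v.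
Proof.
move=> uk kv /connectP[p]; elim: p u uk => [|x p IHp] u uk /=.
  move=> _ vu; exists u; last by rewrite vu connect0.
  by rewrite inE eqn_leq uk -vu.
case/andP=> ux xp vE; have [uk'|nuk] := eqVneq (rad u) k.
  exists u; first by rewrite inE uk'.
  split=> //; apply: connect_trans (connect1 ux) _; apply/connectP.
  by exists p.
have xk : (rad x <= k)%N.
  by apply: leq_trans (rad_adj ux) _; rewrite ltn_neqAle nuk.
have [z zk [xz zv]] := IHp _ xk xp vE; exists z => //; split=> //.
exact: connect_trans (connect1 ux) xz.
Qed.

Definition crossing n w : bool := reach rl (w :&: inner n) 0 (outside 0 n).

Lemma crossing_incr n w w' : w \subset w' -> crossing n w -> crossing n w'.
Proof. by move=> ww'; apply: reach_incr => //; apply: setSI. Qed.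

(** The boundary at radius 2n lies at distance at least [n] from every vertex of radius at most [n],
    as [sum_explored] requires. *)
Definition theta r n : R := bprob r (outside 0 n.*2) (crossing n).

Lemma magn_le_theta r n : (forall t, 0 < r t) -> magn r n.*2 <= theta r n.
Proof.
move=> r0; rewrite /magn smean_reach //; apply: bprob_sub => // w.
by apply: reach_inner; rewrite -addnn leq_addr.
Qed.

Lemma theta_le_magn r n : (forall t, 0 < r t) -> theta r n <= magn r n.
Proof.
move=> r0; apply: (@le_trans _ _ (bprob r (outside 0 n.*2)
    (fun w => reach rl w 0 (outside 0 n)))).
  by apply: bprob_sub => // w; apply: reach_incr => //; apply: subsetIl.
by apply: bprob_reach_le => //; apply: outsideS; rewrite -addnn leq_addr.
Qed.

Definition explored n k b w : bool :=
  [&& b \in inner n, rl b.2 &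
      reach rl (w :&: inner n) (src b) (sphere k) ||
      reach rl (w :&: inner n) (tgt b) (sphere k)].

Lemma explored_incr n k b w w' : w \subset w' -> explored n k b w -> explored n k b w'.
Proof.
move=> ww' /and3P[bn rb h]; rewrite /explored bn rb /=.
by case/orP: h => h; apply/orP; [left|right]; apply: reach_incr h => //; apply: setSI.
Qed.

(** A path from the origin to radius [n] meets the sphere of radius k at some z. All bonds at the
    cluster of z within [w :&: Q] have been queried, so both halves of the path are seen in the
    queried bonds. *)
Lemma crossing_stop n k w Q : (k <= n)%N ->
  (forall b, explored n k b (w :&: Q) -> b \in Q) ->
  crossing n w = crossing n (w :&: Q).
Proof.
move=> kn stop; apply/idP/idP; last by apply: crossing_incr; apply: subsetIl.
case/exists_inP=> v vn v0; have kv : (k <= rad v)%N.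
  by move: vn; rewrite inE subr0; apply: leq_trans.
have k0 : (rad 0%R <= k)%N by rewrite rad0.
have [z zk [z0 zv]] := connect_sphere k0 kv v0.
have main x : connect (adj rl (w :&: inner n)) z x ->
    connect (adj rl (w :&: Q :&: inner n)) z x.
  case/connectP=> p; move: (connect0 (adj rl (w :&: Q :&: inner n)) z).
  elim: p {2 3 4}z => [|y p IHp] a za /=; first by move=> _ ->.
  case/andP=> ay yp; apply: IHp yp; apply: (connect_trans za); apply: connect1.
  have az : reach rl (w :&: Q :&: inner n) a (sphere k).
    by apply/exists_inP; exists z; rewrite // connect_adjC.
  case/exists_inP: ay => b; rewrite inE => /andP[bw bn] /andP[rb h].
  apply/exists_inP; exists b; last by rewrite rb.
  rewrite inE bn andbT inE bw /=.
  apply: stop; rewrite /explored bn rb /=.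
  by case/orP: h => /andP[/eqP-> /eqP->]; rewrite az ?orbT.
apply/exists_inP; exists v => //; apply: connect_trans (main _ zv).
by rewrite connect_adjC; apply: main; rewrite connect_adjC.
Qed.

(** The distance between i and k takes each value at most twice. *)
Lemma sum_magn_dist r n k : (forall t, 0 < r t) -> (k <= n)%N ->
  \sum_(i < n) magn r (if (k <= i)%N then i - k else k - i)%N
  <= 2 * \sum_(i < n) magn r i.
Proof.
move=> r0 kn; pose M j := \sum_(i < j) magn r i.
have m0 i : 0 <= magn r i by apply: magn_ge0.
have mS i : magn r i.+1 <= magn r i by apply: magn_incr.
have M_incr j j' : (j <= j')%N -> M j <= M j'.
  move=> jj'; rewrite /M (big_ord_widen j' (magn r) jj') big_mkcond /=.
  by apply: ler_sum => i _; case: ifP.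
(* Partial sums in closed form. Up to k, the term [magn r (k - i)] is bounded by
   [magn r (k - i.+1)], which avoids the value at distance k; from k on, the terms are exactly those
   of [M]. *)
suff main i : (i <= n)%N ->
    \sum_(i < i) magn r (if (k <= i)%N then i - k else k - i)%N
    <= (if (i <= k)%N then M k - M (k - i)%N else M k + M (i - k)%N).
  apply: le_trans (main n (leqnn n)) _; rewrite mulr2n mulrDl !mul1r.
  case: ifP => _.
    apply: (@le_trans _ _ (M k)); first by rewrite gerBl /M sumr_ge0.
    by apply: le_trans (M_incr _ _ kn) _; rewrite lerDl sumr_ge0.
  by apply: lerD; apply: M_incr => //; apply: leq_subr.
have MS j : M j.+1 = M j + magn r j by rewrite /M big_ord_recr.
have M0 : M 0%N = 0 by rewrite /M big_ord0.
elim: i => [|i IHi] ilt; first by rewrite big_ord0 leq0n subn0 subrr.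
have {IHi} := IHi (ltnW ilt); rewrite big_ord_recr /=.
case: (ltngtP i k) => [ik|ki|ik] h.
- have e : (k - i)%N = (k - i.+1).+1 by lia.
  by have := mS (k - i.+1)%N; move: h; rewrite e MS; lra.
- have -> : (i.+1 - k)%N = (i - k).+1 by lia.
  by rewrite MS; lra.
- by move: h; rewrite ik subnn subSnn (MS 0%N) M0; lra.
Qed.

(** A bond is due only if one of its ends u is connected to the sphere of radius k, which has
    probability at most the magnetization at the distance between k and the radius of u. Two ends
    and the factor 2 of [sum_magn_dist] make 4. *)
Lemma sum_explored r n b : (forall t, 0 < r t) ->
  \sum_(k < n) bprob r (outside 0 n.*2) (explored n k b)
  <= 4 * (rl b.2)%:R * \sum_(i < n) magn r i.
Proof.
move=> r0; have M0 : 0 <= \sum_(i < n) magn r i.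
  by apply: sumr_ge0 => i _; apply: magn_ge0.
have [rb|rb] := boolP (rl b.2); last first.
  rewrite mulr0 mul0r big1 // => k _; rewrite /bprob.
  rewrite (_ : wmean _ _ = wmean (bweight r (outside 0 n.*2)) (fun=> 0)).
    by rewrite wmean_cst // gt_eqF // sum_bweight_gt0.
  by apply: eq_wmean => w _; rewrite /explored (negPf rb) andbF.
have [bn|bn] := boolP (b \in inner n); last first.
  rewrite big1 ?mulr_ge0 // => k _; rewrite /bprob.
  rewrite (_ : wmean _ _ = wmean (bweight r (outside 0 n.*2)) (fun=> 0)).
    by rewrite wmean_cst // gt_eqF // sum_bweight_gt0.
  by apply: eq_wmean => w _; rewrite /explored (negPf bn).
have main u : (rad u <= n)%N ->
    \sum_(k < n) bprob r (outside 0 n.*2)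
       (fun w => reach rl (w :&: inner n) u (sphere k)) <= 2 * \sum_(i < n) magn r i.
  move=> un; apply: le_trans (sum_magn_dist r0 un); apply: ler_sum => k _.
  move: (nat_of_ord k) (ltn_ord k) => {}k kn.
  apply: (@le_trans _ _ (bprob r (outside 0 n.*2) (fun w => reach rl w u (sphere k)))).
    by apply: bprob_sub => // w; apply: reach_incr => //; apply: subsetIl.
  apply: bprob_reach_le => //; apply/subsetP => v; rewrite !inE ?subr0.
    rewrite -addnn => vn; have := rad_le v u; move: (rad v) (rad u) (rad (v - u)) vn un.
    by move=> x y z; case: ifP => h'; lia.
  move=> /eqP vk; have h1 := rad_le v u; have := rad_le u v; rewrite radB => h2.
  rewrite -vk; move: (rad v) (rad u) (rad (v - u)) h1 h2 => x y z h1 h2.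
  by case: ifP => h'; lia.
have src_n : (rad (src b) <= n)%N /\ (rad (tgt b) <= n)%N.
  have b1 : (rad (tgt b) <= (rad (src b)).+1)%N.
    by rewrite /tgt (leq_trans (radD _ _)) // -addn1 leq_add2l.
  have b2 : (rad (src b) <= (rad (tgt b)).+1)%N.
    rewrite /tgt -{1}(addrK (dir b.1.2) (src b)) (leq_trans (radD _ _)) //.
    by rewrite -addn1 leq_add2l radN.
  by move: bn; rewrite inE => /orP[]; lia.
have := lerD (main _ src_n.1) (main _ src_n.2).
rewrite mulr1 -mulrDl => /(le_trans _); rewrite -natrD; apply.
rewrite -big_split /=; apply: ler_sum => k _.
apply: le_trans (bprob_orb _ _ _ r0); apply: bprob_sub => // w.
by case/and3P.
Qed.

(* Averaging the OSSS inequality over the explorations started from the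
   spheres of radius k < n. *)
Lemma theta_osss r n : (forall t, 0 < r t) ->
  n%:R * (theta r n * (1 - theta r n)) <=
  4 * (\sum_(i < n) magn r i) *
   \sum_(b | rl b.2) wcov (bweight r (outside 0 n.*2))
      (fun w => (b \in w)%:R) (fun w => (crossing n w)%:R).
Proof.
move=> r0; set mu := bweight r _.
have mu0 w : 0 < mu w by apply: bweight_gt0.
have lat X Y : mu X * mu Y <= mu (X :|: Y) * mu (X :&: Y) by apply: bweight_lattice.
have cov0 b : 0 <= wcov mu (fun w => (b \in w)%:R) (fun w => (crossing n w)%:R).
  apply: fkg => // [w||X Y XY|X Y XY]; first exact/ltW.
  - exact: sum_bweight_gt0.
  - exact: indic_incr.
  - by rewrite ler_nat; case: (boolP (crossing n X)) => // /(crossing_incr XY)->.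
have step (k : 'I_n) : theta r n * (1 - theta r n) <=
    \sum_b bprob r (outside 0 n.*2) (explored n k b) *
      wcov mu (fun w => (b \in w)%:R) (fun w => (crossing n w)%:R).
  apply: osss_explore => // [b X Y|X Y|X Q].
  - exact: explored_incr.
  - exact: crossing_incr.
  - exact/crossing_stop/ltnW.
have -> : n%:R * (theta r n * (1 - theta r n)) =
    \sum_(k < n) theta r n * (1 - theta r n).
  by rewrite sumr_const card_ord mulr_natl.
apply: (le_trans (ler_sum _ (fun k _ => step k))).
rewrite exchange_big /= mulr_sumr [leRHS]big_mkcond /=.
apply: ler_sum => b _; rewrite -mulr_suml.
apply: le_trans (ler_wpM2r (cov0 b) (sum_explored n b r0)) _.
by case: ifP => _; rewrite ?mulr1 // mulr0 !mul0r.
Qed.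

End Radius.
End Connectivity.

(** * Finite energy and the high-temperature estimate *)

Section FiniteEnergy.
Variables (R : realFieldType) (V K : finZmodType) (T : finType).
Variables (dir : bool -> V) (kt : T -> K -> bool).
Hypothesis kt0 : forall t, kt t 0.
Hypothesis ktB : forall t x y, kt t x -> kt t y -> kt t (x - y).

Local Notation spins := {ffun V -> K}.
Local Notation bond := (V * bool * T)%type.
Local Notation src := (@src V T).
Local Notation tgt := (tgt dir).
Local Notation compat := (compat dir kt).
Local Notation bweight := (bweight dir kt).
Local Notation bprob := (bprob dir kt).
Local Notation reach := (reach dir).
Implicit Types (s : spins) (w D : {set bond}) (W P : {set V}) (b : bond).
Implicit Types (r : T -> R) (u v : V) (rl : pred T) (E : {set bond} -> bool).

Lemma wmean_sum (I : finType) (A : pred I) mu (F : I -> {set bond} -> R) :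
  wmean mu (fun w => \sum_(i | A i) F i w) = \sum_(i | A i) wmean mu (F i).
Proof.
rewrite /wmean -mulr_suml exchange_big; congr (_ / _).
by apply: eq_bigr => w _; rewrite mulr_sumr.
Qed.

(** Compatible spins with the same increment along [b] differ by a spin that also satisfies [b], and
    there are at most [#|K|] increments. *)
Lemma card_compat_add W w b : (#|compat W w| <= #|K| * #|compat W (b |: w)|)%N.
Proof.
pose d s : K := s (src b) - s (tgt b).
rewrite -sum1_card (partition_big d xpredT) //= -sum_nat_const.
apply: leq_sum => k _; rewrite sum1dep_card.
set F := [set s | _].
have [->|[s0 s0F]] := set_0Vmem F; first by rewrite cards0.
rewrite -(card_imset _ (addIr (- s0))).
apply/subset_leq_card/subsetP => _ /imsetP[s sF ->].
move: s0F sF; rewrite !inE => /andP[s0G /eqP d0] /andP[sG /eqP ds].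
have : s - s0 \in compat W w by apply: (compatB ktB); rewrite inE.
rewrite !inE; case/andP=> -> /forall_inP h /=; apply/forall_inP => b'.
rewrite !inE => /orP[/eqP->|/h//]; rewrite /satisfied !ffunE.
have -> : s (src b) - s0 (src b) - (s (tgt b) - s0 (tgt b)) = d s - d s0.
  by rewrite /d !opprD !opprK addrACA.
by rewrite ds d0 subrr.
Qed.

Lemma card_K_gt0 : 0 < #|K|%:R :> R.
Proof. by rewrite ltr0n; apply/card_gt0P; exists 0. Qed.

(** With the next lemma: given the other bonds, the odds that [b] is open lie between r / |K| and
    r. *)
Lemma bweight_add_ge r W w b : (forall t, 0 < r t) -> b \notin w ->
  r b.2 / #|K|%:R * bweight r W w <= bweight r W (b |: w).
Proof.
move=> r0 bw; rewrite /bweight big_setU1 //= -!mulrA ler_wpM2l ?(ltW (r0 _)) //.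
rewrite [X in X <= _]mulrCA ler_wpM2l ?prodr_ge0 // => [b' _|]; first exact: ltW.
by rewrite mulrC ler_pdivrMr ?card_K_gt0 // mulrC -natrM ler_nat card_compat_add.
Qed.

Lemma bweight_add_le r W w b : (forall t, 0 < r t) -> b \notin w ->
  bweight r W (b |: w) <= r b.2 * bweight r W w.
Proof.
move=> r0 bw; rewrite /bweight big_setU1 //= -!mulrA ler_wpM2l ?(ltW (r0 _)) //.
rewrite ler_wpM2l ?prodr_ge0 // => [b' _|]; first exact: ltW.
by rewrite ler_nat subset_leq_card // compatS // subsetUr.
Qed.

Lemma sum_set_split (F : {set bond} -> R) b :
  \sum_w F w = \sum_(w : {set bond} | b \notin w) (F w + F (b |: w)).
Proof.
rewrite (bigID (fun w : {set bond} => b \in w)) /= addrC big_split /=; congr (_ + _).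
rewrite (reindex_onto (fun w => b |: w) (fun w => w :\ b)) /=.
  apply: eq_bigl => w; rewrite setU11 /=.
  by apply/eqP/idP => [<-|/setU1K//]; rewrite setD11.
by move=> w; apply: setD1K.
Qed.

Lemma bprob_open_le r W E b : (forall t, 0 < r t) ->
  bprob r W (fun w => (b \in w) && E (w :\ b)) <= r b.2 * bprob r W (fun w => E (w :\ b)).
Proof.
move=> r0; rewrite -wmeanZ ler_wpM2r ?invr_ge0 ?(ltW (sum_bweight_gt0 _ _ _ r0)) //.
rewrite (sum_set_split _ b) [leRHS](sum_set_split _ b); apply: ler_sum => w bw.
rewrite (negPf bw) setU11 /= mulr0 add0r setU1K //.
have -> : w :\ b = w by apply/setDidPl; rewrite disjoint_sym disjoints1.
apply: (@le_trans _ _ (bweight r W w * (r b.2 * (E w)%:R))).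
  case: (E w); rewrite ?mulr0 // !mulr1 mulrC; exact: bweight_add_le.
by rewrite lerDl mulr_ge0 ?(ltW (bweight_gt0 _ _ _ _ r0)) // mulr_ge0 // ltW.
Qed.

(** Whatever the other bonds, a bond of [D] is closed with conditional probability at most (1 + r t
    / |K|)^-1; the bonds of [D] are removed one at a time. *)
Lemma bprob_closed_le r W t D : (forall t, 0 < r t) ->
  (forall b, b \in D -> b.2 = t) ->
  bprob r W (fun w => w :&: D == set0) <= (1 + r t / #|K|%:R)^-1 ^+ #|D|.
Proof.
move=> r0; set x := r t / _; have x0 : 0 < 1 + x.
  by rewrite addr_gt0 // divr_gt0 // card_K_gt0.
elim: {D}_.+1 {-2}D (ltnSn #|D|) => // n IHn D Dn Dt.
have [->|[b bD]] := set_0Vmem D; first by rewrite cards0 expr0 bprob_le1.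
have {}Dn : (#|D :\ b| < n)%N by move: Dn; rewrite (cardsD1 b) bD.
have {IHn} := IHn _ Dn (fun b' => Dt b' \o subsetP (subsetDl _ _) b').
rewrite (cardsD1 b D) bD exprS; set y := _ ^+ _ => h.
rewrite mulrC ler_pdivlMr //; apply: le_trans h.
rewrite mulrC -wmeanZ ler_wpM2r ?invr_ge0 ?(ltW (sum_bweight_gt0 _ _ _ r0)) //.
rewrite (sum_set_split _ b) [leRHS](sum_set_split _ b); apply: ler_sum => w bw.
have e w' : b \notin w' -> w' :&: D = w' :&: (D :\ b).
  move=> bw'; apply/setP => c; rewrite !inE; case: eqP => [->|//].
  by rewrite (negPf bw').
have -> : (b |: w) :&: D == set0 = false.
  by apply/negP => /eqP/setP/(_ b); rewrite !inE eqxx bD.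
have -> : (b |: w) :&: (D :\ b) = w :&: (D :\ b).
  by apply/setP => c; rewrite !inE; case: (c == b); rewrite ?andbF.
rewrite !mulr0 addr0 e //; case: eqP => _; rewrite ?mulr0 ?addr0 // !mulr1.
rewrite mulrC mulrDl mul1r lerD2l /x -(Dt b bD); exact: bweight_add_ge.
Qed.

(** A path without repetition never returns to [u], so it uses no further bond at [u] and its
    remainder survives the removal of [b]. *)
Lemma reach_first_step rl w u P : reach rl w u P -> u \notin P ->
  exists b v, [/\ b \in w, rl b.2, incident dir b u v || incident dir b v u
                & reach rl (w :\ b) v P].
Proof.
case/exists_inP=> z zP /connectP[p0 p0path zE] uP.
move: zE; case/shortenP: p0path => -[|x p] /=.
  by move=> _ _ _ zu; rewrite zu in zP; case/negP: uP.
case/andP=> ux xp /andP[up _] _ zE.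
case/exists_inP: ux => b bw /andP[rb inc]; exists b, x; split=> //.
apply/exists_inP; exists z => //; apply/connectP; exists p => //.
apply: (@sub_in_path _ (mem (x :: p)) _ _ _ _ _ _ xp); last exact/allP.
move=> y y' yp y'p /exists_inP[c cw /andP[rc inc']].
apply/exists_inP; exists c; last by rewrite rc.
rewrite !inE cw andbT; apply/negP => /eqP cb.
have uy : u != y by apply: contraNneq up => ->.
have uy' : u != y' by apply: contraNneq up => ->.
move: inc inc'; rewrite cb /incident.
by case/orP => /andP[/eqP e1 /eqP e2]; rewrite !e1 !e2;
  rewrite ?(negPf uy) ?(negPf uy') ?andbF.
Qed.

Section Radius.
Variable rad : V -> nat.
Hypothesis rad0 : rad 0 = 0%N.
Hypothesis radD : forall u v, (rad (u + v)%R <= rad u + rad v)%N.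
Hypothesis radN : forall u, rad (- u) = rad u.
Hypothesis rad_dir : forall d, (rad (dir d) <= 1)%N.
Variables (rl : pred T) (phi : K -> bool) (g : K).
Hypothesis phiP : xor_form phi.
Hypothesis rl_phi : forall t x, rl t -> kt t x -> phi x = false.
Hypothesis phi_g : phi g.
Hypothesis irl_g : forall t, ~~ rl t -> kt t g.

(** A connection leaves the origin by one of the bonds there, four of each kind. With that bond
    removed from the rest of the path, its being open costs a factor [r t], and its other end still
    has to cover a distance n. *)
Lemma magn_high_temperature r n : (forall t, 0 < r t) ->
  magn dir kt rad phi r n.+1 <=
  4 * (\sum_(t | rl t) r t) * magn dir kt rad phi r n.
Proof.
move=> r0; pose W := outside rad 0 n.+1; pose m := magn dir kt rad phi r n.
rewrite /magn (smean_reach _ kt0 ktB phiP rl_phi phi_g irl_g) //.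
have m0 : 0 <= m by apply: (magn_ge0 _ kt0 ktB).
pose F (bv : bond * V) : R :=
  bprob r W (fun w => (bv.1 \in w) && reach rl (w :\ bv.1) bv.2 W).
have F0 bv : 0 <= F bv by apply: bprob_ge0.
have Fle bv : (rad bv.2 <= 1)%N -> F bv <= r bv.1.2 * m.
  move=> bv1; apply: (le_trans (bprob_open_le _ (fun w => reach rl w bv.2 W) _ r0)).
  rewrite ler_wpM2l ?(ltW (r0 _)) //.
  apply: (@le_trans _ _ (bprob r W (fun w => reach rl w bv.2 W))).
    by apply: bprob_sub => // w; apply: reach_incr => //; apply: subD1set.
  have WO : W \subset outside rad bv.2 n.
    apply/subsetP => v; rewrite !inE subr0 => nv.
    by have := rad_le radD v bv.2; move: (rad v) (rad bv.2) (rad (v - bv.2)) nv bv1 => x y z; lia.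
  exact: (bprob_reach_le _ kt0 ktB phiP rl_phi phi_g irl_g).
(* [o] tells whether the origin is the source or the target of the bond; the second component is its
   other end. *)
pose bv (t : T) (d o : bool) : bond * V :=
  if o then ((0, d, t), dir d) else ((- dir d, d, t), - dir d).
apply: (@le_trans _ _ (\sum_(t | rl t) \sum_(d : bool) \sum_(o : bool) F (bv t d o))).
  rewrite [leRHS](_ : _ = wmean (bweight r W) (fun w =>
      \sum_(t | rl t) \sum_(d : bool) \sum_(o : bool)
        (((bv t d o).1 \in w) && reach rl (w :\ (bv t d o).1) (bv t d o).2 W)%:R)); last first.
    rewrite wmean_sum; apply: eq_bigr => t _.
    rewrite wmean_sum; apply: eq_bigr => d _.
    by rewrite wmean_sum; apply: eq_bigr => o _.
  apply: ler_wmean => w *; first exact/ltW/bweight_gt0.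
  have [rw|_] := boolP (reach _ _ _ _); last first.
    by do 3!(apply: sumr_ge0 => ? _); apply: ler0n.
  have [|b [v [bw rb inc rv]]] := reach_first_step rw; first by rewrite inE subr0 rad0.
  have [o e] : exists o, bv b.2 b.1.2 o = (b, v).
    case: b {bw rb rv} inc => [[x d] t] /=.
    rewrite /incident /src /tgt /= => /orP[] /andP[/eqP e1 /eqP e2].
      by exists true; rewrite /bv /= -e2 e1 add0r.
    have ex : - dir d = x by apply/eqP; rewrite eq_sym -addr_eq0 e2.
    by exists false; rewrite /bv /= ex e1.
  rewrite (bigD1 b.2) //= (bigD1 b.1.2) //= (bigD1 o) //= e /= bw rv /=.
  by rewrite -!addrA lerDl !addr_ge0 // ?sumr_ge0 // => *; rewrite ?sumr_ge0 // => *; rewrite ?sumr_ge0.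
rewrite mulr_sumr mulr_suml; apply: ler_sum => t _.
rewrite !big_bool -[smean _ _ _ _ _]/m.
have h d o : F (bv t d o) <= r t * m.
  have := Fle (bv t d o); rewrite /bv; case: o => /=; apply; rewrite ?radN; exact: rad_dir.
move: (h true true) (h true false) (h false true) (h false false).
move: (F (bv t true true)) (F (bv t true false)) (F (bv t false true)) (F (bv t false false)).
by move=> /= a b c d; lra.
Qed.

End Radius.
End FiniteEnergy.

(** * The torus and the Peierls argument *)

(* Makes products of finite additive groups finite additive groups. *)
HB.saturate prod.

Section Torus.
Variable m : nat.
Local Notation M := m.+2.
Local Notation Z := 'Z_M.
Implicit Types (x y : Z) (k n : nat).

Definition zdist x : nat := minn x (M - x).

Lemma Zp_val_nat k : (k%:R : Z) = (k %% M)%N :> nat.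
Proof. exact: val_Zp_nat. Qed.

Lemma zdist0 : zdist 0 = 0%N.
Proof. by rewrite /zdist min0n. Qed.

Lemma zdistN x : zdist (- x) = zdist x.
Proof.
rewrite /zdist /= /Zp_opp /=; have := ltn_ord x; rewrite /Zp_trunc /=.
move: (nat_of_ord x) => [|a] aM; last by rewrite modn_small; lia.
by rewrite (_ : (M - 0)%N = M) // modnn; lia.
Qed.

Lemma zdistD x y : (zdist (x + y)%R <= zdist x + zdist y)%N.
Proof.
rewrite /zdist /= /Zp_add /=; have := ltn_ord x; have := ltn_ord y.
rewrite /Zp_trunc /=; move: (nat_of_ord x) (nat_of_ord y) => a b bM aM.
have [abM|abM] := ltnP (a + b)%N M; first by rewrite modn_small //; lia.
have -> : ((a + b) %% M = a + b - M)%N.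
  by rewrite -{1}(subnK abM) modnDr modn_small; lia.
lia.
Qed.

Lemma zdist_nat k : (k.*2 <= M)%N -> zdist k%:R = k.
Proof. by move=> kM; rewrite /zdist Zp_val_nat modn_small; lia. Qed.

Lemma zdist_le x : ((zdist x).*2 <= M)%N.
Proof. by rewrite /zdist; have := ltn_ord x; rewrite /Zp_trunc /=; lia. Qed.

Lemma zdist_repr x : x = (zdist x)%:R \/ x = - (zdist x)%:R.
Proof.
have xM : (x < M)%N := ltn_ord x.
have [h|h] := leqP x (M - x)%N.
  left; apply: val_inj; rewrite /= Zp_val_nat /zdist (minn_idPl h) modn_small //.
right; have -> : zdist x = (M - x)%N by rewrite /zdist; lia.
rewrite natrB 1?ltnW // opprB; apply: val_inj.
by rewrite natr_Zp pchar_Zp // subr0.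
Qed.

Definition trad (v : Z * Z) : nat := maxn (zdist v.1) (zdist v.2).

Definition tdir (d : bool) : Z * Z := if d then (0, 1) else (1, 0).

Lemma trad0 : trad 0 = 0%N.
Proof. by rewrite /trad /= zdist0. Qed.

Lemma tradN v : trad (- v) = trad v.
Proof. by rewrite /trad /= !zdistN. Qed.

Lemma tradD u v : (trad (u + v)%R <= trad u + trad v)%N.
Proof.
rewrite /trad /=; have := zdistD u.1 v.1; have := zdistD u.2 v.2.
move: (zdist (u.1 + v.1)) (zdist (u.2 + v.2)) (zdist u.1) (zdist v.1) (zdist u.2) (zdist v.2).
by move=> a b c d e f; lia.
Qed.

Lemma trad_dir d : (trad (tdir d) <= 1)%N.
Proof. by rewrite /trad; case: d; rewrite /= zdist0 (@zdist_nat 1). Qed.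

End Torus.

(** * Dual walks around a cluster *)

Section DualWalk.
Variable m : nat.
Local Notation M := m.+2.
Local Notation V := ('Z_M * 'Z_M)%type.
Local Notation dir := (@tdir m).
Local Notation rad := (@trad m).
Implicit Types (u v p q : V) (k : bool * bool).

(* The point [p] stands for the plaquette of which it is the lower left corner;
   [dmove p k] is a neighbouring plaquette and [dedge p k] the edge, given by
   its source and direction, that separates them. *)
Definition dmove p k : V := if k.1 then p + dir k.2 else p - dir k.2.
Definition dedge p k : V * bool := (if k.1 then p + dir k.2 else p, ~~ k.2).

Lemma dedge_inj p q k k' : dedge p k = dedge q k' -> q = p \/ q = dmove p k.
Proof.
rewrite /dedge /dmove; case: k k' => [o d] [o' d'] /= [e /negb_inj ed].
rewrite ed in e *; case: o o' e => -[] e; try by left; rewrite ?(addIr e) // e.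
- by left; apply: addIr (esym e).
- by right.
- by right; rewrite e addrK.
Qed.

Fixpoint wedges p (ks : seq (bool * bool)) : seq (V * bool) :=
  if ks is k :: ks' then dedge p k :: wedges (dmove p k) ks' else [::].

Lemma size_wedges p ks : size (wedges p ks) = size ks.
Proof. by elim: ks p => //= k ks IH p; rewrite IH. Qed.

(** An edge determines the two plaquettes that it separates, so crossing it again means starting
    from, or arriving at, the plaquette from which it was first crossed. *)
Lemma wedges_uniq p ks : uniq (p :: scanl dmove p ks) -> uniq (wedges p ks).
Proof.
elim: ks p => //= k ks IHks p /andP[pks /IHks->]; rewrite andbT.
have main q l : dedge p k \in wedges q l -> p \in q :: scanl dmove q l.
  elim: l q => //= k' l IHl q; rewrite !inE => /orP[/eqP e|/IHl].
    have [->|->] := dedge_inj (esym e); first by rewrite eqxx.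
    by rewrite eqxx orbT.
  by rewrite inE => ->; rewrite orbT.
by apply: contra pks; apply: main.
Qed.

Variable C : pred V.

(** Indicator of the edge boundary of [C]. As a coboundary it is even around every plaquette, and
    dual walks cross only such edges. *)
Definition eta (e : V * bool) : bool := C e.1 (+) C (e.1 + dir e.2).

Definition dadj p q : bool := [exists k, (dmove p k == q) && eta (dedge p k)].

Lemma dadj_sym : symmetric dadj.
Proof.
suff h p q : dadj p q -> dadj q p by move=> p q; apply/idP/idP; apply: h.
case/existsP=> -[o d] /andP[/eqP<- e]; apply/existsP; exists (~~ o, d).
move: e; rewrite /dmove /dedge; case: o => /= e; first by rewrite addrK eqxx.
by rewrite subrK eqxx.
Qed.

Lemma dadj_walk p l : path dadj p l ->
  exists ks, scanl dmove p ks = l /\ all eta (wedges p ks).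
Proof.
elim: l p => [|q l IHl] p /=; first by exists [::].
case/andP=> /existsP[k /andP[/eqP pq e]] /IHl[ks [kl a]]; exists (k :: ks).
by rewrite /= pq kl e a.
Qed.

Lemma eta_plaquette p :
  eta (p, false) (+) eta (p + dir true, false) =
  eta (p, true) (+) eta (p + dir false, true).
Proof.
have E v d : eta (v, d) = C v (+) C (v + dir d) by [].
rewrite !E (addrAC p (dir true)).
by rewrite addbACA.
Qed.

Variable n : nat.
Hypothesis nM : (4 * n + 4 <= M)%N.
Hypothesis C0 : C 0.
Hypothesis Cn : forall v, C v -> (rad v < n)%N.

(** The starting plaquettes are those just above the segment from the origin to (n, 0). *)
Definition dreach p : bool := [exists i : 'I_n, connect dadj (i%:R, 0) p].

Lemma dreach_step p q : dadj p q -> dreach p = dreach q.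
Proof.
move=> pq; apply/existsP/existsP => -[i h]; exists i; apply: (connect_trans h).
  exact: connect1.
by apply: connect1; rewrite dadj_sym.
Qed.

Lemma dreach_move p k : dreach p && eta (dedge p k) = dreach (dmove p k) && eta (dedge p k).
Proof.
case e : (eta _); rewrite ?andbF ?andbT //; apply: dreach_step.
by apply/existsP; exists k; rewrite eqxx.
Qed.

(** Parity of the number of boundary edges of [C] that lie just below a reached plaquette of row
    [y]. *)
Definition row_parity (y : 'Z_M) : bool :=
  \big[addb/false]_(x : 'Z_M) (dreach (x, y) && eta ((x, y), false)).

(** Sum [eta_plaquette] over the reached plaquettes of the row. The two sides of a boundary edge are
    both reached or both not, so the vertical edges cancel cyclically and the upper edges become the
    lower ones of the next row. *)
Lemma row_parityS y : row_parity y = row_parity (y + 1).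
Proof.
apply/eqP; rewrite -negb_add /row_parity.
have -> : \big[addb/false]_x (dreach (x, y + 1) && eta ((x, y + 1), false)) =
    \big[addb/false]_x (dreach (x, y) && eta ((x, y + 1), false)).
  apply: eq_bigr => x _; have := dreach_move (x, y) (true, true).
  rewrite /dmove /dedge /= (_ : (x, y) + (0, 1) = (x, y + 1)) => [->//|].
  by congr pair; rewrite /= addr0.
rewrite -big_split /=.
rewrite (eq_bigr (fun x => (dreach (x, y) && eta ((x, y), true)) (+)
    (dreach (x + 1, y) && eta ((x + 1, y), true)))); last first.
  move=> x _; have := eta_plaquette (x, y).
  have := dreach_move (x, y) (true, false); rewrite /dmove /dedge /=.
  have -> : (x, y) + (0, 1) = (x, y + 1) by congr pair; rewrite /= addr0.
  have -> : (x, y) + (1, 0) = (x + 1, y) by congr pair; rewrite /= addr0.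
  by move=> <-; rewrite -!andb_addr => ->.
rewrite big_split /= [X in _ (+) X](_ : _ = \big[addb/false]_(x : 'Z_M)
   (dreach (x, y) && eta ((x, y), true))) ?addbb //.
by rewrite [RHS](reindex_inj (addIr 1)).
Qed.

Lemma row_parity0 : row_parity 0 = false.
Proof.
have -> : row_parity 0 = row_parity n%:R.
  elim: (n) => [|k IHk]; first by rewrite mulr0n.
  by rewrite IHk row_parityS natr1.
have far x : C (x, n%:R) = false.
  apply/negP => /Cn; rewrite /trad /= (@zdist_nat m n); lia.
apply: big1 => x _; rewrite /eta /= far.
have -> : (x, n%:R) + (1, 0) = (x + 1, n%:R) :> V by congr pair; rewrite /= addr0.
by rewrite far andbF.
Qed.

Lemma row_telescope :
  \big[addb/false]_(i < n) eta ((i%:R, 0), false) = true.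
Proof.
have tel l : \big[addb/false]_(i < l) eta ((i%:R, 0), false) = C (0, 0) (+) C (l%:R, 0).
  elim: l => [|l IHl]; first by rewrite big_ord0 mulr0n addbb.
  rewrite big_ord_recr /= IHl /eta /=.
  have -> : (l%:R, 0) + (1, 0) = (l.+1%:R, 0) :> V by congr pair; rewrite /= ?addr0 // natr1.
  by rewrite addbA -[X in X (+) _]addbA addbb addbF.
rewrite tel [C (0, 0)]C0; case e : (C _) => //.
by have := Cn e; rewrite /trad /= (@zdist_nat m n); lia.
Qed.

Lemma natr_Z_inj i j : (i < n)%N -> (j < n)%N -> (i%:R : 'Z_M) = j%:R -> i = j.
Proof.
move=> iN jN /(congr1 (@nat_of_ord _)); rewrite !Zp_val_nat !modn_small; lia.
Qed.

(** A parity count in place of the Jordan curve theorem. Row 0 has even parity, since row [n] does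
    not meet [C], whereas the starting plaquettes contribute an odd number. Some other reached
    plaquette of row 0 therefore lies above a boundary edge; that edge has an end in [C], so it is
    close to the origin, on its left. *)
Lemma dual_crossing :
  exists i j, [/\ (i < n)%N, (j < n)%N & connect dadj (i%:R, 0) (- j.+1%:R, 0)].
Proof.
pose I : {set 'Z_M} := [set (i : nat)%:R | i : 'I_n].
have [x /and3P[xI xr xe]|none] :=
    pickP (fun x => [&& x \notin I, dreach (x, 0) & eta ((x, 0), false)]).
  have [i xi] := existsP xr.
  have xn : (zdist x < n)%N \/ (zdist (x + 1)%R < n)%N.
    have z0 : zdist (0 : 'Z_M) = 0%N by apply: zdist0.
    move: xe; rewrite /eta /=; have := @Cn (x, 0); have := @Cn ((x, 0) + (1, 0)).
    rewrite /trad /= addr0 z0 !maxn0; case: (C _); case: (C _) => // h1 h2 _; auto.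
  have [xk|xk] := zdist_repr x; have kM := zdist_le x.
    case/negP: xI; apply/imsetP.
    suff kn : (zdist x < n)%N by exists (Ordinal kn); rewrite // -xk.
    case: xn => //; rewrite {1}xk natr1.
    have [h|h] := leqP (zdist x).+1.*2 M; first by rewrite zdist_nat //; lia.
    rewrite /zdist Zp_val_nat; set k := minn x _ in kM h *.
    have -> : (k.+1 %% M = k.+1)%N by rewrite modn_small; lia.
    lia.
  case k0 : (zdist x) => [|k].
    case/negP: xI; apply/imsetP.
    have n0 : (0 < n)%N by have := Cn C0; lia.
    by exists (Ordinal n0); rewrite // xk k0 mulr0n oppr0.
  exists i, k; split=> //; last by rewrite -k0 -xk.
  case: xn => [|]; first by rewrite k0; lia.
  rewrite xk k0 -[k.+1]addn1 natrD opprD addrNK zdistN zdist_nat; lia.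
have := row_parity0; rewrite /row_parity (bigID (mem I)) /= [X in _ (+) X]big1 ?addbF; last first.
  by move=> x xI; have := none x; rewrite xI.
rewrite big_imset /= => [|i j _ _ ij]; last first.
  by apply: val_inj; apply: natr_Z_inj ij.
rewrite (eq_bigr (fun i : 'I_n => eta ((i%:R, 0), false))) => [|i _].
  by rewrite (eq_bigl xpredT) ?row_telescope // => i; rewrite inE.
rewrite (_ : dreach _) //; apply/existsP; exists i; exact: connect0.
Qed.

End DualWalk.

(** * The Peierls bound *)

Section Peierls.
Variables (R : realFieldType) (m : nat) (K : finZmodType) (T : finType).
Local Notation M := m.+2.
Local Notation V := ('Z_M * 'Z_M)%type.
Local Notation dir := (@tdir m).
Local Notation rad := (@trad m).
Local Notation bond := (V * bool * T)%type.
Variable (kt : T -> K -> bool).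
Hypothesis kt0 : forall t, kt t 0.
Hypothesis ktB : forall t x y, kt t x -> kt t y -> kt t (x - y).
Variables (rl : pred T) (phi : K -> bool) (g : K).
Hypothesis phiP : xor_form phi.
Hypothesis rl_phi : forall t x, rl t -> kt t x -> phi x = false.
Hypothesis phi_g : phi g.
Hypothesis irl_g : forall t, ~~ rl t -> kt t g.
Variable t0 : T.
Hypothesis rt0 : rl t0.

Lemma sum_geometric_quarter n : \sum_(i < n) (4^-1 : R) ^+ i.+1 <= 3^-1.
Proof.
have -> : \sum_(i < n) (4^-1 : R) ^+ i.+1 = 3^-1 * (1 - 4^-1 ^+ n).
  elim: n => [|n IHn]; first by rewrite big_ord0 expr0 subrr mulr0.
  by rewrite big_ord_recr /= IHn exprS; field.
by rewrite ger_pMr ?invr_gt0 // gerBl exprn_ge0 // invr_ge0.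
Qed.

Definition wbonds (es : seq (V * bool)) : {set bond} := [set (e, t0) | e in es].

Definition ray (i : nat) : V := (i%:R, 0).

(** The dual walk around the cluster of the origin joins column i to column -(j+1), so it has at
    least i + 1 steps, of which the first i + 1 are kept. The edges that it crosses leave the
    cluster, hence carry no open bond of the relevant kind [t0]. *)
Lemma unreach_walk n (w : {set bond}) : (4 * n + 4 <= M)%N ->
  ~~ reach dir rl w 0 (outside rad 0 n) ->
  exists (i : 'I_n) (ks : i.+1.-tuple (bool * bool)),
    uniq (wedges (ray i) ks) &&
    (w :&: wbonds (wedges (ray i) ks) == set0).
Proof.
move=> nM nr; pose C : pred V := connect (adj dir rl w) 0.
have Cn v : C v -> (rad v < n)%N.
  rewrite ltnNge => Cv; apply: contra nr => nv; apply/exists_inP; exists v => //.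
  by rewrite inE subr0.
have [i [j [iN jN]]] := dual_crossing nM (connect0 _ 0) Cn.
case/connectP=> p0 p0path p0E; move: p0E; case/shortenP: p0path => p p_path p_uniq _ pE.
have [ks [ksE kseta]] := dadj_walk p_path.
have dmove1 q k : (rad (dmove q k - q)%R <= 1)%N.
  rewrite /dmove; case: k => -[] d; rewrite addrC addKr; first exact: trad_dir.
  by rewrite tradN trad_dir.
have far (q0 q : V) (l : seq (bool * bool)) :
    (rad (last q (scanl (@dmove m) q l) - q0)%R <= rad (q - q0)%R + size l)%N.
  elim: l q => [|k l IHl] q /=; first by rewrite addn0.
  apply: leq_trans (IHl _) _; rewrite addnS -addSn leq_add2r.
  rewrite -[dmove q k](subrK q) -addrA addrC -[(rad _).+1]addn1.
  by apply: leq_trans (tradD _ _) _; rewrite leq_add2l dmove1.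
have ski : (i.+1 <= size ks)%N.
  have := far (ray i) (ray i) ks; rewrite subrr trad0 ksE -pE add0n.
  apply: leq_trans; rewrite /trad /= subr0 zdist0 maxn0 -opprD zdistN -natrD.
  by rewrite zdist_nat; lia.
exists (Ordinal iN).
have sz : size (take i.+1 ks) == i.+1 by rewrite size_takel.
exists (Tuple sz) => /=; apply/andP; split.
  apply: wedges_uniq; move: p_uniq; rewrite -ksE -{1}(cat_take_drop i.+1 ks).
  by rewrite scanl_cat -cat_cons cat_uniq => /andP[].
have sub (q : V) l k : {subset wedges q (take k l) <= wedges q l}.
  move=> f; elim: k l q => [|k IHk] [|a l] q //=.
  by rewrite !inE => /orP[->//|/IHk->]; rewrite orbT.
rewrite -subset0; apply/subsetP => -[[v d] t]; rewrite inE => /andP[vw].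
case/imsetP=> e ew [ve tt]; rewrite ve tt in vw.
have : eta C e.
  exact: (allP kseta _ (sub _ _ _ _ ew)).
rewrite /eta (_ : C e.1 = C (e.1 + dir e.2)) ?addbb //.
have ed : adj dir rl w e.1 (e.1 + dir e.2).
  by apply/exists_inP; exists (e, t0); rewrite //= rt0 /incident /src /tgt /= !eqxx.
apply/idP/idP => /connect_trans; apply; apply: connect1 => //.
by rewrite adj_sym.
Qed.

(** There are 4^(i+1) walks from column i, and each crosses only closed bonds with probability at
    most 16^-(i+1); the sum over i of 4^-(i+1) is at most 1/3. *)
Lemma magn_low_temperature (r : T -> R) n : (forall t, 0 < r t) ->
  (4 * n + 4 <= M)%N -> 16 <= 1 + r t0 / #|K|%:R ->
  2 / 3 <= magn dir kt rad phi r n.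
Proof.
move=> r0 nM r16; rewrite /magn (smean_reach _ kt0 ktB phiP rl_phi phi_g irl_g) //.
pose W := outside rad 0 n.
suff : bprob dir kt r W (fun w => ~~ reach dir rl w 0 W) <= 3^-1.
  have -> : bprob dir kt r W (fun w => ~~ reach dir rl w 0 W) =
     1 - bprob dir kt r W (fun w => reach dir rl w 0 W).
    have Z : \sum_w bweight dir kt r W w != 0 by rewrite gt_eqF // sum_bweight_gt0.
    rewrite -{1}(wmean_cst 1 Z) -wmeanB; apply: eq_wmean => w _.
    by case: reach; rewrite ?subrr ?subr0.
  by rewrite -/W; lra.
apply: le_trans (sum_geometric_quarter n).
pose F (i : 'I_n) (ks : i.+1.-tuple (bool * bool)) (w : {set bond}) : bool :=
  uniq (wedges (ray i) ks) &&
    (w :&: wbonds (wedges (ray i) ks) == set0).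
apply: (@le_trans _ _ (\sum_(i < n) \sum_(ks : i.+1.-tuple (bool * bool))
   bprob dir kt r W (F i ks))).
  rewrite [leRHS](_ : _ = wmean (bweight dir kt r W) (fun w =>
    \sum_(i < n) \sum_(ks : i.+1.-tuple (bool * bool)) (F i ks w)%:R)); last first.
    rewrite wmean_sum; apply: eq_bigr => i _.
    by rewrite wmean_sum; apply: eq_bigr => ks _.
  apply: ler_wmean => w *; first exact/ltW/bweight_gt0.
  case: (boolP (~~ _)) => [nr|_]; last by do 2!(apply: sumr_ge0 => ? _); apply: ler0n.
  have [i [ks h]] := unreach_walk nM nr.
  rewrite (bigD1 i) //= (bigD1 ks) //= /F h -addrA lerDl addr_ge0 //;
    by do ?(apply: sumr_ge0 => ? _); apply: ler0n.
apply: ler_sum => i _.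
have Fle ks : bprob dir kt r W (F i ks) <= 16^-1 ^+ i.+1.
  case: (boolP (uniq (wedges (ray i) ks))) => [u|u]; last first.
    rewrite /bprob (_ : wmean _ _ = 0) ?exprn_ge0 ?invr_ge0 //.
    rewrite /wmean big1 ?mul0r // => w _; by rewrite /F (negPf u) mulr0.
  apply: (@le_trans _ _ (bprob dir kt r W (fun w => w :&: wbonds (wedges (ray i) ks) == set0))).
    by apply: bprob_sub => // w; rewrite /F u.
  set D := wbonds _.
  have Dt b : b \in D -> b.2 = t0 by case/imsetP=> e _ ->.
  apply: le_trans (bprob_closed_le _ kt0 ktB W r0 Dt) _.
  rewrite card_imset => [|e e' []//].
  rewrite (card_uniqP u) size_wedges size_tuple lerXn2r // ?nnegrE ?invr_ge0 //.
    by rewrite addr_ge0 // divr_ge0 // ltW.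
  by rewrite lef_pV2 ?posrE //; apply: lt_le_trans r16.
apply: le_trans (ler_sum _ (fun ks _ => Fle ks)) _.
rewrite sumr_const card_tuple card_prod card_bool -[X in X <= _]mulr_natr natrX.
rewrite -exprMn; apply: lerXn2r; rewrite ?nnegrE; lra.
Qed.

End Peierls.

From mathcomp Require Import all_classical all_reals all_analysis.
Import numFieldNormedType.Exports.

(** * Sharpness from a differential inequality *)

Section Derivatives.
Variable R : realType.
Implicit Types (f df : R -> R) (a b L x : R).

Lemma is_derive_big_sum (I : Type) (s : seq I) (P : pred I) (f : I -> R -> R) (df : I -> R) (x : R) :
  (forall i, P i -> is_derive x 1 (f i) (df i)) ->
  is_derive x 1 (fun y => \sum_(i <- s | P i) f i y) (\sum_(i <- s | P i) df i).
Proof.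
move=> fP; elim: s => [|i s IHs].
  rewrite big_nil (_ : (fun y => _) = cst 0); first exact: is_derive_cst.
  by apply/funext => y; rewrite big_nil.
rewrite big_cons (_ : (fun y => _) =
   (if P i then f i + (fun y => \sum_(i <- s | P i) f i y) else (fun y => \sum_(i <- s | P i) f i y))).
  by case: ifP => // Pi; exact: (is_deriveD (fP _ Pi) IHs).
by apply/funext => y; rewrite big_cons; case: ifP.
Qed.

Lemma is_derive_big_prod (I : Type) (s : seq I) (P : pred I) (f : I -> R -> R) (c : I -> R) (x : R) :
  (forall i, P i -> is_derive x 1 (f i) (c i * f i x)) ->
  is_derive x 1 (fun y => \prod_(i <- s | P i) f i y)
    ((\sum_(i <- s | P i) c i) * \prod_(i <- s | P i) f i x).
Proof.
move=> fP; elim: s => [|i s IHs].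
  rewrite !big_nil mul0r (_ : (fun y => _) = cst 1); first exact: is_derive_cst.
  by apply/funext => y; rewrite big_nil.
rewrite !big_cons (_ : (fun y => _) =
   (if P i then f i * (fun y => \prod_(i <- s | P i) f i y) else (fun y => \prod_(i <- s | P i) f i y))).
  case: ifP => // Pi; apply: (is_derive_eq (is_deriveM (fP _ Pi) IHs)).
  by rewrite /GRing.scale /=; ring.
by apply/funext => y; rewrite big_cons; case: ifP.
Qed.

Lemma is_derive_continuous_within f df a b :
  (forall x, a <= x -> x <= b -> is_derive x 1 f (df x)) ->
  {within `[a, b], continuous f}%classic.
Proof.
move=> fP; apply: derivable_within_continuous => x; rewrite in_itv /= => /andP[ax xb].
by have [] := fP x ax xb.
Qed.

Lemma derive_ge_increment f df a b L : a <= b ->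
  (forall x, a <= x -> x <= b -> is_derive x 1 f (df x)) ->
  (forall x, a <= x -> x <= b -> L <= df x) -> L * (b - a) <= f b - f a.
Proof.
move=> ab fP dfL.
have fP' x : x \in `]a, b[ -> is_derive x 1 f (df x).
  by rewrite in_itv /= => /andP[/ltW ax /ltW xb]; apply: fP.
have [c] := MVT_segment ab fP' (is_derive_continuous_within fP).
rewrite in_itv /= => /andP[ac cb] ->; rewrite ler_wpM2r ?subr_ge0 //.
exact: dfL.
Qed.

(** The hypothesis makes f x exp(- L x) nondecreasing. *)
Lemma gronwall_decay f df a b L : a <= b ->
  (forall x, a <= x -> x <= b -> is_derive x 1 f (df x)) ->
  (forall x, a <= x -> x <= b -> L * f x <= df x) ->
  f a <= f b * expR (- (L * (b - a))).
Proof.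
move=> ab fP dfL.
pose g x := f x * expR (- (L * x)).
pose dg x := (df x - L * f x) * expR (- (L * x)).
have gP x : a <= x -> x <= b -> is_derive x 1 g (dg x).
  move=> ax xb; have fx := fP _ ax xb.
  have ex : is_derive x 1 (fun y => expR (- (L * y))) (- L * expR (- (L * x))).
    have lx : is_derive x 1 (fun y : R => - (L * y)) (- L).
      have := is_deriveZ (- L) (is_derive_id x 1).
      rewrite (_ : (- L \*: id)%R = (fun y : R => - (L * y))).
        by rewrite /GRing.scale /= mulr1.
      by apply/funext => y; rewrite -mulNr.
    apply: (is_derive_eq (is_derive1_comp (is_derive_expR _) lx)).
    by rewrite mulrC.
  apply: (is_derive_eq (is_deriveM fx ex)).
  by rewrite /dg /GRing.scale /=; ring.
have := @derive_ge_increment g dg a b 0 ab gP.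
rewrite mul0r subr_ge0 => h.
have : g a <= g b.
  apply: h => x ax xb; rewrite mulr_ge0 ?expR_ge0 // subr_ge0; exact: dfL.
rewrite /g -ler_pdivlMr ?expR_gt0 // => /le_trans; apply.
rewrite -mulrA -expRN -expRD le_eqVlt; apply/orP; left; apply/eqP.
by congr (_ * expR _); ring.
Qed.

End Derivatives.

(** * Differentiation in the inverse temperature *)

Section InverseTemperature.
Variables (R : realType) (V K : finZmodType) (T : finType).
Variables (dir : bool -> V) (kt : T -> K -> bool).
Hypothesis kt0 : forall t, kt t 0.
Hypothesis ktB : forall t x y, kt t x -> kt t y -> kt t (x - y).
Variable kappa : T -> R.
Hypothesis kappa_gt0 : forall t, 0 < kappa t.
Local Notation bond := (V * bool * T)%type.
Implicit Types (beta : R) (t : T).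

Definition rho (beta : R) (t : T) : R := expR (beta * kappa t) - 1.

Lemma rho_gt0 beta t : 0 < beta -> 0 < rho beta t.
Proof. by move=> b0; rewrite subr_gt0 expR_gt1 mulr_gt0. Qed.

Lemma rho_incr beta beta' t : beta <= beta' -> rho beta t <= rho beta' t.
Proof. by move=> bb; rewrite lerD2r ler_expR ler_pM2r. Qed.

(** Logarithmic derivative of [rho] in beta; it is bounded below by [kappa], uniformly in beta. *)
Definition drho (beta : R) (t : T) : R :=
  kappa t * expR (beta * kappa t) / rho beta t.

Lemma drho_ge beta t : 0 < beta -> kappa t <= drho beta t.
Proof.
move=> b0; rewrite /drho ler_pdivlMr ?rho_gt0 // ler_wpM2l ?ltW //.
by rewrite ltrBlDr ltrDl ltr01.
Qed.

Lemma is_derive_rho beta t : 0 < beta ->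
  is_derive beta 1 (fun b => rho b t) (drho beta t * rho beta t).
Proof.
move=> b0; rewrite /drho divfK ?gt_eqF ?rho_gt0 //.
have lx : is_derive beta 1 (fun y : R => y * kappa t) (kappa t).
  have := is_deriveZ (kappa t) (is_derive_id beta 1).
  rewrite (_ : (kappa t \*: id)%R = (fun y : R => y * kappa t)).
    by rewrite /GRing.scale /= mulr1.
  by apply/funext => y; rewrite mulrC.
have ex := is_derive1_comp (is_derive_expR _) lx.
rewrite (_ : (fun b => rho b t) = (expR \o (fun y => y * kappa t)) - cst 1); last first.
  exact/funext.
apply: (is_derive_eq (is_deriveB ex (is_derive_cst (1 : R) beta 1))).
by rewrite subr0 mulrC.
Qed.

(** Russo's formula for these weights: each open bond contributes [drho] to the logarithmic
    derivative of [bweight], and the derivative of the normalization turns means of products into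
    covariances. *)
Lemma is_derive_wmean (W : {set V}) (F : {set bond} -> R) beta : 0 < beta ->
  is_derive beta 1 (fun b => wmean (bweight dir kt (rho b) W) F)
    (\sum_b drho beta b.2 * wcov (bweight dir kt (rho beta) W) (fun w => (b \in w)%:R) F).
Proof.
move=> b0; set mu := bweight dir kt (rho beta) W.
have dmu w : is_derive beta 1 (fun b => bweight dir kt (rho b) W w)
    ((\sum_(b in w) drho beta b.2) * mu w).
  have := is_derive_big_prod (index_enum _) (P := mem w) (fun b _ => is_derive_rho b.2 b0).
  move=> h; have := is_deriveM h (is_derive_cst (#|compat dir kt W w|%:R : R) beta 1).
  rewrite scaler0 add0r => h'; apply: (is_derive_eq h').
  by rewrite /mu /bweight /GRing.scale /=; ring.
have dZ : is_derive beta 1 (fun b => \sum_w bweight dir kt (rho b) W w)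
    (\sum_(w : {set bond}) (\sum_(b in w) drho beta b.2) * mu w).
  by apply: is_derive_big_sum => w _.
have dN : is_derive beta 1 (fun b => \sum_w bweight dir kt (rho b) W w * F w)
    (\sum_(w : {set bond}) (\sum_(b in w) drho beta b.2) * mu w * F w).
  apply: is_derive_big_sum => w _.
  have h := is_deriveM (dmu w) (is_derive_cst (F w) beta 1).
  apply: (is_derive_eq h); rewrite scaler0 add0r /GRing.scale /=; ring.
have Z0 : 0 < \sum_w mu w by apply: sum_bweight_gt0 => // t; apply: rho_gt0.
have h := is_deriveM dN (is_deriveV (lt0r_neq0 Z0) dZ).
apply: (is_derive_eq h); rewrite /GRing.scale /=.
have E (G : {set bond} -> R) : \sum_(w : {set bond}) (\sum_(b in w) drho beta b.2) * mu w * G w =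
   (\sum_b drho beta b.2 * wmean mu (fun w => (b \in w)%:R * G w)) * \sum_w mu w.
  under [in RHS]eq_bigr do rewrite /wmean mulrA.
  rewrite -mulr_suml divfK ?gt_eqF //.
  under [in RHS]eq_bigr do rewrite mulr_sumr.
  rewrite exchange_big; apply: eq_bigr => w _.
  rewrite big_mkcond !mulr_suml; apply: eq_bigr => b _.
  by case: (b \in w); rewrite ?mulr1n ?mulr0n ?mul1r ?(mul0r, mulr0) // -mulrA.
rewrite -/mu E; under [X in _ * (_ * X) + _]eq_bigr do rewrite -[_ * mu _]mulr1.
rewrite (E (fun=> 1)).
under [in RHS]eq_bigr do rewrite /wcov mulrBr.
rewrite sumrB.
have -> : \sum_b drho beta b.2 * (wmean mu (fun w => (b \in w)%:R) * wmean mu F) =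
  (\sum_b drho beta b.2 * wmean mu (fun w => (b \in w)%:R * 1)) * wmean mu F.
  rewrite mulr_suml; apply: eq_bigr => b _; rewrite mulrA; congr (_ * _ * _).
  by apply: eq_wmean => w _; rewrite mulr1.
rewrite [wmean mu F]/wmean; move: Z0; move: (\sum_w mu w) => Z Z0.
by field; rewrite gt_eqF.
Qed.

End InverseTemperature.

(** * From the differential inequality to exponential decay *)

Section SharpnessFromDifferentialInequality.
Variables (R : realType) (m : nat -> R -> R) (K : R).
Implicit Types (b beta : R) (n N : nat).
Hypothesis K_gt0 : 0 < K.
Hypothesis m_ge0 : forall n b, 0 < b -> 0 <= m n b.
Hypothesis m0 : forall b, 0 < b -> m 0 b = 1.
Hypothesis m_decr : forall n b, 0 < b -> m n.+1 b <= m n b.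
Hypothesis m_incr : forall n b b', 0 < b -> b <= b' -> m n b <= m n b'.

Definition magn_sum n b : R := \sum_(i < n) m i b.

Hypothesis m_diff : forall n, exists theta dtheta : R -> R, forall b, 0 < b ->
  [/\ is_derive b 1 theta (dtheta b), m n.*2 b <= theta b, theta b <= m n b
    & K * n%:R * (theta b * (1 - theta b)) <= magn_sum n b * dtheta b].

Lemma m_decrn n k b : 0 < b -> (n <= k)%N -> m k b <= m n b.
Proof.
move=> b0 /subnK <-; elim: (k - n)%N => // j IHj.
by apply: le_trans IHj; rewrite addSn m_decr.
Qed.

Lemma m_le1 n b : 0 < b -> m n b <= 1.
Proof. by move=> b0; rewrite -(m0 b0) m_decrn. Qed.

Lemma magn_sumS n b : magn_sum n.+1 b = magn_sum n b + m n b.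
Proof. by rewrite /magn_sum big_ord_recr. Qed.

Lemma magn_sum_ge1 n b : 0 < b -> (0 < n)%N -> 1 <= magn_sum n b.
Proof.
case: n => // n b0 _; rewrite /magn_sum big_ord_recl m0 // lerDl sumr_ge0 // => i _.
exact: m_ge0.
Qed.

Lemma magn_sum_le n b : 0 < b -> magn_sum n b <= n%:R.
Proof.
move=> b0; rewrite -[n in leRHS]card_ord -sumr_const ler_sum // => i _; exact: m_le1.
Qed.

Lemma magn_sum_incr n k b : 0 < b -> (n <= k)%N -> magn_sum n b <= magn_sum k b.
Proof.
move=> b0 /subnK <-; elim: (k - n)%N => // j IHj.
by apply: le_trans IHj _; rewrite addSn magn_sumS lerDl m_ge0.
Qed.

Lemma magn_sum_incrb n b b' : 0 < b -> b <= b' -> magn_sum n b <= magn_sum n b'.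
Proof. by move=> b0 bb'; apply: ler_sum => i _; apply: m_incr. Qed.

Lemma telescope_le (f g : nat -> R) n N : (n <= N)%N ->
  (forall k, (n <= k < N)%N -> g k.+1 - g k <= f k) ->
  g N - g n <= \sum_(n <= k < N) f k.
Proof. by move=> nN h; rewrite -telescope_sumr // ler_sum_nat. Qed.

Lemma ln_increment (x y : R) : 0 < x -> 0 <= y -> ln (x + y) - ln x <= y / x.
Proof.
move=> x0 y0; rewrite -ln_div ?posrE ?ltr_wpDr // mulrDl divff ?gt_eqF //.
by rewrite le_ln1Dx // (lt_le_trans (ltrN10 _)) // divr_ge0 // ltW.
Qed.

(** A discrete form of (ln M)' = m / M at even indices: the two new terms add up to at most
    [2 * m k.*2 b], and [magn_sum k b <= magn_sum k.*2 b]. *)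
Lemma ln_magn_sum n N b : 0 < b -> (0 < n)%N -> (n <= N)%N ->
  ln (magn_sum N.*2 b) - ln (magn_sum n.*2 b) <= 2 * \sum_(n <= k < N) m k.*2 b / magn_sum k b.
Proof.
move=> b0 n0 nN; rewrite mulr_sumr.
apply: (telescope_le (g := fun k => ln (magn_sum k.*2 b))) => // k /andP[nk kN].
have k0 : (0 < k)%N by apply: leq_trans nk.
have M1 : 0 < magn_sum k b by apply: lt_le_trans (magn_sum_ge1 b0 k0).
have M2 : magn_sum k b <= magn_sum k.*2 b by rewrite magn_sum_incr // -addnn leq_addr.
have M3 : 0 < magn_sum k.*2 b by apply: lt_le_trans M2.
rewrite doubleS !magn_sumS -addrA.
apply: le_trans (ln_increment M3 _) _; first by rewrite addr_ge0 // m_ge0.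
rewrite mulrA ler_pdivrMr //.
apply: (@le_trans _ _ (2 * m k.*2 b)); first by rewrite mulr2n mulrDl mul1r lerD2l m_decr.
rewrite [leRHS](_ : _ = 2 * m k.*2 b * ((magn_sum k b)^-1 * magn_sum k.*2 b)); last by ring.
rewrite ler_peMr //; first by rewrite mulr_ge0 // m_ge0.
by rewrite mulrC ler_pdivlMr // mul1r.
Qed.

Lemma telescope_ge (f g : nat -> R) n N : (n <= N)%N ->
  (forall k, (n <= k < N)%N -> f k <= g k.+1 - g k) ->
  \sum_(n <= k < N) f k <= g N - g n.
Proof. by move=> nN h; rewrite -telescope_sumr // ler_sum_nat. Qed.

Lemma sum_inv_le n N : (1 < n)%N -> (n <= N)%N ->
  \sum_(n <= k < N) (k%:R : R)^-1 <= ln N%:R.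
Proof.
move=> n1 nN; apply: (@le_trans _ _ (ln N.-1%:R - ln n.-1%:R)).
  apply: (telescope_ge (g := fun k => ln (k.-1%:R : R))) => // k /andP[nk _] /=.
  have k1 : (1 < k)%N by apply: leq_trans nk.
  have k0 : 0 < k%:R :> R by rewrite ltr0n ltnW.
  have k0' : 0 < k.-1%:R :> R by rewrite ltr0n; case: (k) k1 => [|[]].
  have e : k.-1%:R = k%:R - 1 :> R.
    by rewrite -[in k%:R](prednK (ltnW k1)) -natr1 addrK.
  have := @le_ln1Dx R (- k%:R^-1); rewrite (_ : 1 + - k%:R^-1 = k.-1%:R / k%:R); last first.
    by rewrite e; field; rewrite gt_eqF.
  rewrite ln_div ?posrE // => h.
  have : ln k.-1%:R - ln k%:R <= - (k%:R : R)^-1.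
    by apply: h; rewrite ltrN2 invf_lt1 // ltr1n.
  lra.
have N1 : (1 < N)%N by apply: leq_trans nN.
have h1 : 0 <= ln (n.-1%:R : R) by rewrite ln_ge0 // ler1n; case: (n) n1 => [|[]].
have h2 : ln (N.-1%:R : R) <= ln N%:R.
  rewrite ler_ln ?posrE ?ltr0n ?ler_nat ?leq_pred //; last by apply: leq_trans N1.
  by case: (N) N1 => [|[]].
lra.
Qed.

Lemma is_derive_wsum (s : seq nat) (c : nat -> R) (f df : nat -> R -> R) b :
  (forall k, is_derive b 1 (f k) (df k b)) ->
  is_derive b 1 (fun y => \sum_(k <- s) c k * f k y) (\sum_(k <- s) c k * df k b).
Proof.
by move=> h; apply: is_derive_big_sum.
Qed.

(* If m n b' -> 0, the sum of the theta k / k grows by at most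
   o(ln n) on [b, b'], whereas its derivative is at least of order ln (magn_sum n b). *)
Lemma magn_sum_sublinear b b' : 0 < b -> b < b' -> (m n b' @[n --> \oo] --> 0)%classic ->
  exists2 A : R, 0 < A & forall N, magn_sum N b ^+ 2 <= A * N%:R.
Proof.
move=> b0 bb' m_cvg; have b'0 : 0 < b' by apply: lt_trans bb'.
pose d := b' - b; have d0 : 0 < d by rewrite subr_gt0.
(* The bound 1/2 gives 1 - theta >= 1/2. The bound d K / 8 is half of the coefficient d K / 4
   obtained below, which keeps the logarithm of the sum below half of ln N up to a constant; hence
   the square in the conclusion. *)
pose eps := Num.min 2^-1 (d * K / 8).
have eps0 : 0 < eps by rewrite lt_min invr_gt0 ltr0n divr_gt0 // mulr_gt0.
have [n0 n0P] : exists n0, forall n, (n0 <= n)%N -> m n b' <= eps.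
  move/cvgrPdist_le : m_cvg => /(_ _ eps0)[n0 _ h]; exists n0 => n n0n.
  by have := h n n0n; rewrite sub0r normrN ger0_norm // m_ge0.
pose n1 := n0.+2.
have mhalf n (y : R) : (n1 <= n)%N -> 0 < y -> y <= b' -> m n y <= 2^-1.
  move=> n1n y0 yb; apply: le_trans (m_incr _ y0 yb) _.
  have := n0P n; rewrite /eps le_min => /(_ _)/andP[] //.
  exact: leq_trans (leqW (leqnSn n0)) n1n.
have [th [dth thP]] : exists th dth : nat -> R -> R, forall n (y : R), 0 < y ->
  [/\ is_derive y 1 (th n) (dth n y), m n.*2 y <= th n y, th n y <= m n y
    & K * n%:R * (th n y * (1 - th n y)) <= magn_sum n y * dth n y].
  have /choice[th /choice[dth h]] := m_diff.
  by exists th, dth.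
exists ((n1.*2)%:R ^+ 2); first by rewrite exprn_gt0 // ltr0n.
move=> N.
have [Nn1|n1N] := ltnP N n1.
  apply: (@le_trans _ _ (N%:R ^+ 2)).
    by rewrite lerXn2r ?nnegrE ?magn_sum_le // sumr_ge0 // => i _; apply: m_ge0.
  rewrite expr2 ler_wpM2r // -natrX ler_nat; lia.
pose S (y : R) := \sum_(n1 <= k < N) (k%:R)^-1 * th k y.
pose dS (y : R) := \sum_(n1 <= k < N) (k%:R)^-1 * dth k y.
have SP (y : R) : 0 < y -> is_derive y 1 S (dS y).
  by move=> y0; apply: is_derive_wsum => k; have [] := thP k y y0.
(* One factor 1/2 comes from 1 - theta, the other from [ln_magn_sum]. The logarithm is taken at b,
   where it is smallest on the interval. *)
pose L := K / 4 * (ln (magn_sum N.*2 b) - ln (n1.*2)%:R).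
have posn k : (n1 <= k)%N -> 0 < (k%:R : R) by move=> h; rewrite ltr0n; apply: leq_trans h.
have dSL (y : R) : b <= y -> y <= b' -> L <= dS y.
  move=> by_ yb'; have y0 : 0 < y by apply: lt_le_trans by_.
  apply: (@le_trans _ _ (K / 2 * \sum_(n1 <= k < N) m k.*2 y / magn_sum k y)).
    have h := ln_magn_sum y0 (isT : (0 < n1)%N) n1N.
    have pos k : (0 < k)%N -> 0 < magn_sum k.*2 y.
      by move=> k0; apply: lt_le_trans ltr01 (magn_sum_ge1 _ _); rewrite ?double_gt0.
    have posb k : (0 < k)%N -> 0 < magn_sum k.*2 b.
      by move=> k0; apply: lt_le_trans ltr01 (magn_sum_ge1 _ _); rewrite ?double_gt0.
    have N0 : (0 < N)%N by apply: leq_trans n1N.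
    have h1 : ln (magn_sum N.*2 b) <= ln (magn_sum N.*2 y).
      by rewrite ler_ln ?posrE ?pos ?posb // magn_sum_incrb.
    have h2 : ln (magn_sum n1.*2 y) <= ln (n1.*2)%:R.
      by rewrite ler_ln ?posrE ?pos // ?magn_sum_le // ltr0n.
    rewrite /L; have : ln (magn_sum N.*2 b) - ln (n1.*2)%:R
       <= 2 * \sum_(n1 <= k < N) m k.*2 y / magn_sum k y by lra.
    by rewrite -(ler_pM2l (_ : 0 < K / 4)) ?divr_gt0 //; nra.
  rewrite mulr_sumr; apply: ler_sum_nat => k /andP[n1k kN].
  have [_ h1 h2 h3] := thP k y y0; have k0 := posn k n1k.
  have M0 : 0 < magn_sum k y by apply: lt_le_trans ltr01 (magn_sum_ge1 _ (leq_trans _ n1k)).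
  have h4 := mhalf k y n1k y0 yb'.
  have h5 : 0 <= m k.*2 y by apply: m_ge0.
  have h6 : K * k%:R * (m k.*2 y * 2^-1) <= magn_sum k y * dth k y.
    apply: le_trans h3; rewrite ler_pM2l ?mulr_gt0 //.
    by apply: ler_pM => //; lra.
  rewrite [leLHS](_ : _ = K * k%:R * (m k.*2 y * 2^-1) * (k%:R^-1 * (magn_sum k y)^-1)); last first.
    by field; rewrite !gt_eqF.
  rewrite [leRHS](_ : _ = magn_sum k y * dth k y * (k%:R^-1 * (magn_sum k y)^-1)); last first.
    by field; rewrite !gt_eqF.
  by rewrite ler_wpM2r // mulr_ge0 // invr_ge0 ltW.
have := @derive_ge_increment R S dS b b' L (ltW bb')
   (fun y h _ => SP y (lt_le_trans b0 h)) dSL.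
have Sb0 : 0 <= S b.
  rewrite /S big_seq sumr_ge0 // => k; rewrite mem_index_iota => /andP[n1k _].
  rewrite mulr_ge0 ?invr_ge0 //; have [_ h _ _] := thP k b b0.
  by apply: le_trans h; apply: m_ge0.
have Sb' : S b' <= eps * ln N%:R.
  apply: (@le_trans _ _ (eps * \sum_(n1 <= k < N) (k%:R)^-1)); last first.
    by rewrite ler_pM2l // sum_inv_le.
  rewrite mulr_sumr; apply: ler_sum_nat => k /andP[n1k _]; rewrite mulrC ler_wpM2r //.
  have [_ _ h _] := thP k b' b'0; apply: le_trans h _; apply: n0P.
  exact: leq_trans (leqW (leqnSn n0)) n1k.
rewrite -/d => main.
have N0 : (0 < N)%N by apply: leq_trans n1N.
have lnN : 0 <= ln (N%:R : R) by rewrite ln_ge0 // ler1n.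
have M0 : 0 < magn_sum N.*2 b.
  by apply: lt_le_trans ltr01 (magn_sum_ge1 _ _); rewrite ?double_gt0.
have {main} : K / 4 * d * (ln (magn_sum N.*2 b) - ln (n1.*2)%:R) <= d * K / 8 * ln N%:R.
  have : eps * ln N%:R <= d * K / 8 * ln N%:R.
    by rewrite ler_wpM2r // /eps ge_min lexx orbT.
  move: main; rewrite /L; lra.
rewrite [leRHS](_ : _ = K / 4 * d * (2^-1 * ln N%:R)); last by field.
rewrite ler_pM2l ?mulr_gt0 ?divr_gt0 // => main.
have {}main : 2 * ln (magn_sum N.*2 b) <= 2 * ln (n1.*2)%:R + ln N%:R by lra.
apply: (@le_trans _ _ (magn_sum N.*2 b ^+ 2)).
  rewrite lerXn2r ?nnegrE //; last by rewrite magn_sum_incr // -addnn leq_addr.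
  by rewrite sumr_ge0 // => i _; apply: m_ge0.
  by rewrite ltW.
have a0 : 0 < (n1.*2)%:R :> R by rewrite ltr0n.
have N0' : 0 < N%:R :> R by rewrite ltr0n.
rewrite -ler_ln ?posrE ?mulr_gt0 ?exprn_gt0 //.
rewrite lnM ?posrE ?exprn_gt0 // (lnXn 2 M0) (lnXn 2 a0) !mulr2n; lra.
Qed.

(** On [b, b'] theta is at most 1/2 and the sum at most X, so the differential inequality becomes
    theta' >= K n / (2 X) theta. *)
Lemma m_decay n b b' X : 0 < b -> b <= b' -> m n b' <= 2^-1 -> (0 < n)%N ->
  magn_sum n b' <= X -> m n.*2 b <= expR (- (K * n%:R / (2 * X) * (b' - b))).
Proof.
move=> b0 bb' mh n0 MX; have b'0 : 0 < b' by apply: lt_le_trans bb'.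
have X0 : 0 < X by apply: lt_le_trans MX; apply: lt_le_trans ltr01 (magn_sum_ge1 _ _).
have [th [dth thP]] := m_diff n.
have dthP (y : R) : b <= y -> y <= b' -> is_derive y 1 th (dth y).
  by move=> by_ yb; have [] := thP y (lt_le_trans b0 by_).
have dthge (y : R) : b <= y -> y <= b' -> K * n%:R / (2 * X) * th y <= dth y.
  move=> by_ yb.
  have y0 := lt_le_trans b0 by_; have [_ h1 h2 h3] := thP y y0.
  have M1 : 0 < magn_sum n y by apply: lt_le_trans ltr01 (magn_sum_ge1 _ _).
  have MX' : magn_sum n y <= X by apply: le_trans MX; apply: magn_sum_incrb.
  have th0 : 0 <= th y by apply: le_trans h1; apply: m_ge0.
  have th2 : th y <= 2^-1 by apply: le_trans h2 (le_trans (m_incr _ y0 yb) mh).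
  have Kn : 0 < K * n%:R by rewrite mulr_gt0 // ltr0n.
  have h4 : K * n%:R * (th y * 2^-1) <= magn_sum n y * dth y.
    apply: le_trans h3; rewrite ler_pM2l // ler_wpM2l //; lra.
  have dth0 : 0 <= dth y.
    rewrite -(pmulr_rge0 _ M1); apply: le_trans h4; rewrite mulr_ge0 ?(ltW Kn) //.
    by rewrite mulr_ge0 // invr_ge0.
  have h5 : K * n%:R * (th y * 2^-1) <= X * dth y.
    by apply: le_trans h4 _; rewrite ler_wpM2r.
  rewrite [leLHS](_ : _ = K * n%:R * (th y * 2^-1) / X); last by field; rewrite gt_eqF.
  by rewrite ler_pdivrMr // [leRHS]mulrC.
have h := gronwall_decay bb' dthP dthge.
have [_ h1 _ _] := thP b b0; have [_ _ h2 _] := thP b' b'0.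
apply: le_trans h1 _; apply: le_trans h _.
by rewrite ler_piMl ?expR_ge0 // (le_trans h2) // m_le1.
Qed.

(** From exp(x / 4) >= x / 4. The fourth power suits an exponent of order the square root of n, for
    which it gives the summable n^-2. *)
Lemma expRN_le (x : R) : 0 < x -> expR (- x) <= (4 / x) ^+ 4.
Proof.
move=> x0; rewrite expRN -[(4 / x) ^+ 4]invrK lef_pV2 ?posrE ?expR_gt0 //; last first.
  by rewrite invr_gt0 exprn_gt0 // divr_gt0.
rewrite -exprVn invf_div.
have -> : expR x = expR (x / 4) ^+ 4.
  by rewrite -expRM_natl; congr expR; field.
rewrite lerXn2r ?nnegrE ?expR_ge0 ?divr_ge0 ?(ltW x0) //.
by apply: le_trans (expR_ge1Dx _); rewrite lerDr.
Qed.

Lemma sum_invsqr_le n N : (1 < n)%N -> (n <= N)%N ->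
  \sum_(n <= k < N) (k%:R ^+ 2 : R)^-1 <= 1.
Proof.
move=> n1 nN; apply: (@le_trans _ _ (- (N.-1%:R)^-1 - - (n.-1%:R)^-1)).
  apply: (telescope_ge (g := fun k => - (k.-1%:R : R)^-1)) => // k /andP[nk _] /=.
  have k1 : (1 < k)%N by apply: leq_trans nk.
  have k0 : 0 < k%:R :> R by rewrite ltr0n ltnW.
  have k0' : 0 < k.-1%:R :> R by rewrite ltr0n; case: (k) k1 => [|[]].
  have e : k%:R = k.-1%:R + 1 :> R by rewrite natr1 (prednK (ltnW k1)).
  rewrite opprK addrC e -subr_ge0.
  rewrite (_ : _ - _ = ((k.-1%:R) * (k.-1%:R + 1) ^+ 2)^-1).
    by rewrite invr_ge0 mulr_ge0 ?exprn_ge0 ?(ltW k0') // -e ltW.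
  by field; rewrite -e !gt_eqF.
have h1 : (n.-1%:R : R)^-1 <= 1.
  by rewrite invf_le1 ?ltr0n ?ler1n; case: (n) n1 => [|[]].
have h2 : 0 <= (N.-1%:R : R)^-1 by rewrite invr_ge0.
lra.
Qed.

(** Halfway between b and b' the sums are at most of order the square root of N; [m_decay] then
    bounds m at b by a multiple of n^-2, which is summable. *)
Lemma magn_sum_bounded b b' : 0 < b -> b < b' -> (m n b' @[n --> \oo] --> 0)%classic ->
  exists2 A : R, 0 < A & forall N, magn_sum N b <= A.
Proof.
move=> b0 bb' m_cvg; have b'0 : 0 < b' by apply: lt_trans bb'.
pose c := (b + b') / 2; have [bc cb'] : b < c /\ c < b' by rewrite /c; split; lra.
have c0 : 0 < c by apply: lt_trans bc.
have [A A0 AP] := magn_sum_sublinear c0 cb' m_cvg.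
have [n0 n0P] : exists n0, forall n, (n0 <= n)%N -> m n c <= 2^-1.
  have half : 0 < 2^-1 :> R by rewrite invr_gt0.
  move/cvgrPdist_le : m_cvg => /(_ _ half)[n0 _ h]; exists n0 => n n0n.
  apply: le_trans (m_incr _ c0 (ltW cb')) _.
  by have := h n n0n; rewrite sub0r normrN ger0_norm // m_ge0.
pose n1 := n0.+2; pose d := c - b; have d0 : 0 < d by rewrite subr_gt0.
pose D := (8 / (K * d)) ^+ 4 * A ^+ 2.
have D0 : 0 < D by rewrite mulr_gt0 ?exprn_gt0 // divr_gt0 // mulr_gt0.
have md n : (n1 <= n)%N -> m n.*2 b <= D * (n%:R ^+ 2)^-1.
  move=> n1n; have nn : (0 < n)%N := leq_trans (ltn0Sn _) n1n.
  have nR : 0 < n%:R :> R by rewrite ltr0n.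
  have M0 : 0 < magn_sum n c by apply: lt_le_trans ltr01 (magn_sum_ge1 _ _).
  have mh : m n c <= 2^-1 := n0P _ (leq_trans (leqW (leqnSn n0)) n1n).
  apply: le_trans (m_decay b0 (ltW bc) mh nn (lexx _)) _.
  apply: le_trans (expRN_le _) _; first by rewrite mulr_gt0 ?divr_gt0 ?mulr_gt0.
  rewrite [leLHS](_ : _ = (8 / (K * d)) ^+ 4 * (magn_sum n c ^+ 2) ^+ 2 / n%:R ^+ 4); last first.
    by rewrite -/d; field; rewrite !gt_eqF.
  apply: (@le_trans _ _ ((8 / (K * d)) ^+ 4 * (A * n%:R) ^+ 2 / n%:R ^+ 4)).
    rewrite ler_wpM2r ?invr_ge0 ?exprn_ge0 // ler_wpM2l ?exprn_ge0 //.
      by rewrite divr_ge0 // mulr_ge0 // ltW.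
    by rewrite lerXn2r ?nnegrE ?exprn_ge0 ?mulr_ge0 // ?(ltW A0) ?(ltW M0).
  rewrite le_eqVlt; apply/orP; left; apply/eqP; rewrite /D.
  by field; rewrite !gt_eqF.
exists (n1.*2%:R + 2 * D); first by rewrite addr_gt0 ?ltr0n // mulr_gt0.
move=> N; apply: (@le_trans _ _ (magn_sum (N + n1).*2 b)).
  by rewrite magn_sum_incr // -addnn (leq_trans (leq_addr n1 N)) ?leq_addr.
rewrite -lerBlDl.
apply: (@le_trans _ _ (magn_sum (N + n1).*2 b - magn_sum n1.*2 b)).
  by rewrite lerD2l lerN2 magn_sum_le.
apply: le_trans (telescope_le (f := fun k => 2 * (D * (k%:R ^+ 2)^-1))
  (g := fun k => magn_sum k.*2 b) (leq_addl _ _) _) _.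
  move=> k /andP[n1k _]; rewrite doubleS !magn_sumS.
  apply: (@le_trans _ _ (2 * m k.*2 b)).
    rewrite [leLHS](_ : _ = m k.*2 b + m k.*2.+1 b); last by ring.
    by rewrite mulr2n mulrDl mul1r lerD2l m_decr.
  by rewrite ler_pM2l // md.
rewrite -!mulr_sumr mulrA -[leRHS]mulr1 (ler_pM2l (mulr_gt0 (ltr0Sn _ 1) D0)).
by apply: sum_invsqr_le => //; apply: leq_addl.
Qed.

(** Bounded sums at an intermediate point make the exponent of [m_decay] linear in n. *)
Lemma exponential_decay b b' : 0 < b -> b < b' -> (m n b' @[n --> \oo] --> 0)%classic ->
  exists c C : R, [/\ 0 < c, 0 < C & forall n, m n b <= C * expR (- (c * n%:R))].
Proof.
move=> b0 bb' m_cvg; have b'0 : 0 < b' by apply: lt_trans bb'.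
pose d := (b + b') / 2; have [bd db'] : b < d /\ d < b' by rewrite /d; split; lra.
have d0 : 0 < d by apply: lt_trans bd.
have [A A0 AP] := magn_sum_bounded d0 db' m_cvg.
have [n0 n0P] : exists n0, forall n, (n0 <= n)%N -> m n d <= 2^-1.
  have half : 0 < 2^-1 :> R by rewrite invr_gt0.
  move/cvgrPdist_le : m_cvg => /(_ _ half)[n0 _ h]; exists n0 => n n0n.
  apply: le_trans (m_incr _ d0 (ltW db')) _.
  by have := h n n0n; rewrite sub0r normrN ger0_norm // m_ge0.
pose c := K / (2 * A) * (d - b) / 2.
have c0 : 0 < c by rewrite divr_gt0 // mulr_gt0 ?subr_gt0 // divr_gt0 // mulr_gt0.
(* The prefactor covers small n, where m <= 1 is used, and the rounding of n to an even number. *)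
exists c, (expR (c * (n0.*2.+4)%:R)); split=> [//||n]; first exact: expR_gt0.
rewrite -expRD; have [nn|nn] := ltnP n n0.*2.+4.
  apply: le_trans (m_le1 _ b0) _; rewrite -[leLHS]expR0 ler_expR -mulrBr.
  by rewrite mulr_ge0 ?(ltW c0) // subr_ge0 ler_nat ltnW.
have hn : (n0.+2 <= n./2)%N by lia.
apply: (@le_trans _ _ (m (n./2).*2 b)); first by apply: m_decrn => //; lia.
have hn0 : (0 < n./2)%N by lia.
apply: le_trans (m_decay b0 (ltW bd) (n0P _ _) hn0 (AP _)) _; first by lia.
rewrite ler_expR -mulrBr -lerN2 opprK -mulrN opprB.
rewrite [leRHS](_ : _ = c * (2 * (n./2)%:R)); last by rewrite /c; field; rewrite gt_eqF.
rewrite ler_pM2l // -natrM lerBlDr -natrD ler_nat; lia.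
Qed.

End SharpnessFromDifferentialInequality.

(** * The Ashkin-Teller spins *)

Section SpinGroup.
Variable R : realType.

(* The spin +1 is encoded by 0 and the spin -1 by 1, in Z/2Z. *)
Local Notation K := ('Z_2 * 'Z_2)%type.

Lemma Z2P (x : 'Z_2) : x = 0 \/ x = 1.
Proof.
by case: x => [[|[|k]] //] kP; [left|right]; apply: val_inj.
Qed.

Definition sg (x : 'Z_2) : R := if x == 0 then 1 else -1.

Lemma sgB x y : sg (x - y) = sg x * sg y.
Proof.
rewrite /sg; case: (Z2P x) => ->; case: (Z2P y) => ->;
  rewrite ?subr0 ?sub0r ?subrr ?oppr_eq0 ?eqxx ?oner_eq0; ring.
Qed.

Definition dec (x : K) : bool * bool := (x.1 == 0, x.2 == 0).
Definition enc (p : bool * bool) : K := (if p.1 then 0 else 1, if p.2 then 0 else 1).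

Lemma decK : cancel dec enc.
Proof. by case=> a b; rewrite /dec /enc /=; case: (Z2P a) => ->; case: (Z2P b) => ->. Qed.

Lemma encK : cancel enc dec.
Proof. by case=> -[] []. Qed.

(* The bonds of kinds 0, 1, 2 and 3 constrain tau, tau', tau tau' and the pair. *)
Definition kind_sat (k : 'I_4) (x : K) : bool :=
  match val k with
  | 0 => x.1 == 0
  | 1 => x.2 == 0
  | 2 => x.1 == x.2
  | _ => x == 0
  end.

Lemma kind_sat0 k : kind_sat k 0.
Proof. by case: k => [[|[|[|[|k]]]] //]. Qed.

Lemma kind_satB k x y : kind_sat k x -> kind_sat k y -> kind_sat k (x - y).
Proof.
case: k => [[|[|[|[|k]]]] //] kP; rewrite /kind_sat /= => /eqP h /eqP h'; apply/eqP => //.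
- by rewrite /= h h' subrr.
- by rewrite /= h h' subrr.
- by rewrite /= h h'.
- by rewrite h h' subrr.
Qed.

Variables J U : R.
Hypothesis J_gt0 : 0 < J.
Hypothesis U_gt0 : 0 < U.

(* The nonnegative coefficients of the edge energy on the indicators [kind_sat k],
   see [bond_energyE]. *)
Definition coupling (k : 'I_4) : R :=
  match val k with
  | 0 | 1 => if U <= J then 2 * (J - U) else 0
  | 2 => if U <= J then 0 else 2 * (U - J)
  | _ => if U <= J then 4 * U else 4 * J
  end.

Lemma coupling_ge0 k : 0 <= coupling k.
Proof.
by case: k => [[|[|[|[|k]]]] //] kP; rewrite /coupling /=; case: (leP U J) => h;
  move: J_gt0 U_gt0; lra.
Qed.

(** Kinds with coefficient 0 are left out, since the bond weights [rho] have to be positive. *)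
Definition bond_kind : Type := {k : 'I_4 | 0 < coupling k}.
HB.instance Definition _ := SubType.on bond_kind.
HB.instance Definition _ := Finite.on bond_kind.

Definition kappa (t : bond_kind) : R := coupling (val t).
Definition bond_sat (t : bond_kind) (x : K) : bool := kind_sat (val t) x.

Lemma kappa_gt0 t : 0 < kappa t.
Proof. exact: (valP t). Qed.

Definition bond_energy (x : K) : R := J * sg x.1 + J * sg x.2 + U * (sg x.1 * sg x.2).

Lemma sum_bond_kind (F : 'I_4 -> R) : (forall k, coupling k = 0 -> F k = 0) ->
  \sum_(t : bond_kind) F (val t) = \sum_(k : 'I_4) F k.
Proof.
move=> F0; rewrite [RHS](bigID (fun k => 0 < coupling k)) /= [X in _ + X]big1 ?addr0.
  rewrite (reindex_omap (val : bond_kind -> 'I_4) insub) => [|k Pk]; last by rewrite insubT.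
  by apply: eq_bigl => t; rewrite valK eqxx (valP t).
move=> k; rewrite lt_def coupling_ge0 andbT negbK => /eqP; exact: F0.
Qed.

(** With a and b the signs of the two components, 2 1_{a=1} = 1 + a and 2 1_{ab=1} = 1 + a b convert
    what remains of the energy after min(J, U) (a + b + a b). *)
Lemma bond_energyE x :
  \sum_(t : bond_kind) kappa t * (bond_sat t x)%:R =
  bond_energy x - (if U <= J then U - 2 * J else - U).
Proof.
rewrite (sum_bond_kind (F := fun k => coupling k * (kind_sat k x)%:R)); last first.
  by move=> k ->; rewrite mul0r.
rewrite !big_ord_recl big_ord0 /coupling /kind_sat /= /bond_energy /sg.
case: x => a b; case: (leP U J) => _; case: (Z2P a) => ->; case: (Z2P b) => ->;
  rewrite /= ?eqxx ?oner_eq0 /=; ring.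
Qed.

End SpinGroup.

(** * Boxes with plus boundary condition, realized on tori *)

Definition supnorm (u : vertex) : nat := maxn `|u.1|%N `|u.2|%N.

Lemma in_boxE n u : (u \in box n) = (supnorm u <= n)%N.
Proof. by rewrite in_box /supnorm; lia. Qed.

Lemma in_boundary n u : (u \in boundary (box n)) = (supnorm u == n).
Proof.
rewrite /boundary in_fset [LHS]inE in_boxE [has _ _]/= !in_boxE.
by case: u => x y; rewrite /supnorm /=; apply/andP/idP; lia.
Qed.

Section PlusMean.
Variable R : realType.
Implicit Types (J U : R) (f : config -> R).

Definition pmean n J U f : R :=
  (\sum_(s : {ffun box n -> bool * bool} | extend s \in plus_boundary R (box n))
     AT_weight (box n) J U (extend s) * f (extend s)) /
  \sum_(s : {ffun box n -> bool * bool} | extend s \in plus_boundary R (box n))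
     AT_weight (box n) J U (extend s).

Lemma AT_plusE n J U (A : set config) :
  AT_plus (box n) J U A = pmean n J U (fun s => (s \in A)%:R).
Proof.
have Z0 : 0 < AT_partition (box n) J U.
  rewrite /AT_partition (bigD1 [ffun=> (true, true)]) //= ltr_pwDl ?expR_gt0 //.
  by rewrite sumr_ge0 // => s _; apply: expR_ge0.
rewrite /AT_plus /AT /pmean -!mulr_suml invfM invrK mulrACA mulVf ?gt_eqF // mulr1.
congr (_ / _); rewrite big_mkcond [RHS]big_mkcond; apply: eq_bigr => s _.
by rewrite in_setI; case: (_ \in A); case: (_ \in plus_boundary _ _); rewrite ?mulr1 ?mulr0.
Qed.

End PlusMean.

Section Embedding.
Variables (m n : nat).
Local Notation M := m.+2.
Local Notation V := ('Z_M * 'Z_M)%type.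
Implicit Types (u v : vertex).

Definition torus_proj u : V := (u.1%:~R, u.2%:~R).

Lemma projB u v : torus_proj (u - v) = torus_proj u - torus_proj v.
Proof. by rewrite /torus_proj /= !rmorphB. Qed.

Lemma zdist_int (i : int) : (`|i|.*2 <= M)%N -> zdist (i%:~R : 'Z_M) = `|i|%N.
Proof.
case: i => k kM; first by rewrite -pmulrn zdist_nat.
by rewrite NegzE mulrNz zdistN -pmulrn zdist_nat.
Qed.

Lemma trad_proj u : ((supnorm u).*2 <= M)%N -> trad (torus_proj u) = supnorm u.
Proof. by rewrite /supnorm /trad => h; rewrite !zdist_int //; lia. Qed.

Lemma proj_surj (v : V) : exists2 u, torus_proj u = v & supnorm u = trad v.
Proof.
case: v => x y.
have [i xi ix] : exists2 i : int, i%:~R = x & `|i|%N = zdist x.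
  case: (zdist_repr x) => e; first by exists (zdist x)%:Z; rewrite // -pmulrn -e.
  by exists (- (zdist x)%:Z); rewrite ?abszN // mulrNz -pmulrn -e.
have [j yj jy] : exists2 j : int, j%:~R = y & `|j|%N = zdist y.
  case: (zdist_repr y) => e; first by exists (zdist y)%:Z; rewrite // -pmulrn -e.
  by exists (- (zdist y)%:Z); rewrite ?abszN // mulrNz -pmulrn -e.
by exists (i, j); rewrite /torus_proj /supnorm /trad /= ?xi ?yj // ix jy.
Qed.

Hypothesis nM : (4 * n + 4 <= M)%N.

Lemma proj_inj : {in box n &, injective torus_proj}.
Proof.
move=> [x y] [x' y']; rewrite !in_boxE /supnorm /= => h h' e.
have := projB (x, y) (x', y'); rewrite e subrr => /(congr1 (@trad m)).
rewrite trad_proj ?trad0 /supnorm /=; last by lia.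
by move=> e0; congr pair; lia.
Qed.

Lemma proj_in_box (v : V) : (trad v <= n)%N -> exists2 u, u \in box n & torus_proj u = v.
Proof.
by move=> vn; have [u uv un] := proj_surj v; exists u; rewrite // in_boxE un.
Qed.

Lemma trad_proj_box u : u \in box n -> trad (torus_proj u) = supnorm u.
Proof. by rewrite in_boxE => un; apply: trad_proj; lia. Qed.

Lemma in_edges (V : {fset vertex}) (e : vertex * vertex) : (e \in edges V) =
  [&& e.1 \in V, e.2 \in V & (e.2 == (e.1.1 + 1, e.1.2)) || (e.2 == (e.1.1, e.1.2 + 1))].
Proof. by rewrite /edges in_fset [LHS]inE in_fsetM !inE andbA. Qed.

(** The flag is [true] for a vertical edge, as in [tdir]. *)
Definition edge_proj (e : vertex * vertex) : V * bool := (torus_proj e.1, e.2.1 == e.1.1).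

Lemma edge_proj_tgt e : e \in edges (box n) ->
  torus_proj e.2 = (edge_proj e).1 + tdir m (edge_proj e).2.
Proof.
rewrite in_edges => /and3P[_ _]; case: e => [[x y] [x' y']] /= /orP[] /eqP[-> ->].
  rewrite (_ : (x + 1 == x) = false); last by lia.
  by rewrite /tdir /torus_proj; congr pair; rewrite /= ?addr0 // rmorphD.
by rewrite eqxx /tdir /torus_proj; congr pair; rewrite /= ?addr0 // rmorphD.
Qed.

Lemma edge_proj_inj : {in edges (box n) &, injective edge_proj}.
Proof.
move=> [u1 u2] [v1 v2]; rewrite !in_edges /= => /and3P[u1n _ hu] /and3P[v1n _ hv].
move=> e; have /= uv := proj_inj u1n v1n (congr1 fst e).
have /= {e} := congr1 snd e; move: hu hv; rewrite {}uv {u1n v1n u1}.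
case: u2 v2 v1 => [a b] [a' b'] [x y] /=.
by move=> /orP[]/eqP[-> ->] /orP[]/eqP[-> ->] // e; move: e; rewrite eqxx => /eqP; lia.
Qed.

(** Consequently a torus edge that does not come from the box has both ends at radius at least n,
    where the spins are pinned. *)
Lemma edge_proj_surj (v : V) d : (trad v < n)%N \/ (trad (v + tdir m d)%R < n)%N ->
  exists2 e, e \in edges (box n) & edge_proj e = (v, d).
Proof.
move=> h; have dd := trad_dir m d.
have vn : (trad v <= n)%N.
  case: h => [/ltnW//|h].
  by have := tradD (v + tdir m d) (- tdir m d); rewrite addrK tradN; lia.
have tn : (trad (v + tdir m d)%R <= n)%N.
  by case: h => [h|/ltnW//]; have := tradD v (tdir m d); lia.
have [u un uv] := proj_in_box vn.
pose u' : vertex := if d then (u.1, u.2 + 1) else (u.1 + 1, u.2).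
have u'p : torus_proj u' = v + tdir m d.
  rewrite -uv /u' /torus_proj /tdir; case: d {h dd tn u'}; congr pair; rewrite /= ?addr0 // rmorphD //.
have u'n : u' \in box n.
  rewrite in_boxE -trad_proj ?u'p //.
  suff : (supnorm u' <= n.+1)%N by lia.
  by move: un; rewrite in_boxE /supnorm /u'; case: (d) => /=; lia.
exists (u, u').
  rewrite in_edges un u'n /= /u'; case: (u) (d) => x y [] /=; rewrite eqxx ?orbT //.
rewrite /edge_proj /= uv /u'; congr pair; case: (d) => /=; first by rewrite eqxx.
by apply/eqP; lia.
Qed.

End Embedding.

Section Link.
Variables (R : realType) (m n : nat).
Local Notation M := m.+2.
Local Notation V := ('Z_M * 'Z_M)%type.
Local Notation K := ('Z_2 * 'Z_2)%type.
Local Notation spins := {ffun V -> K}.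
Local Notation torus_proj := (@torus_proj m).
Local Notation edge_proj := (@edge_proj m).
Hypothesis nM : (4 * n + 4 <= M)%N.
Variables J U : R.
Hypothesis J_gt0 : 0 < J.
Hypothesis U_gt0 : 0 < U.
Implicit Types (s : spins) (u v : vertex).

Definition torus_config s : config := fun u => if u \in box n then dec (s (torus_proj u)) else (true, true).

Definition box_restrict s : {ffun box n -> bool * bool} := [ffun u => dec (s (torus_proj (val u)))].

(** Vertices outside the box get the spin 0, which encodes plus. *)
Definition box_unrestrict (g : {ffun box n -> bool * bool}) : spins :=
  [ffun v => if [pick u : box n | torus_proj (val u) == v] is Some u then enc (g u) else 0].

Lemma extend_restrict s : extend (box_restrict s) = torus_config s.
Proof.
apply/funext => u; rewrite /extend /torus_config; case: insubP => [v vn vu|/negPf->//].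
by rewrite ffunE vu vn.
Qed.

Lemma unrestrictE (g : {ffun box n -> bool * bool}) (u : box n) :
  box_unrestrict g (torus_proj (val u)) = enc (g u).
Proof.
rewrite ffunE; case: pickP => [v /eqP vu|/(_ u)]; last by rewrite eqxx.
by congr (enc (g _)); apply: val_inj; apply: (proj_inj nM) => //; apply: valP.
Qed.

Lemma unrestrictK : cancel box_unrestrict box_restrict.
Proof. by move=> g; apply/ffunP => u; rewrite ffunE unrestrictE encK. Qed.

(** Shaped for [reindex_onto]: configurations of the box with plus boundary correspond to spins on
    the torus that vanish from radius n on. *)
Lemma plus_restrict s :
  (extend (box_restrict s) \in plus_boundary R (box n)) && (box_unrestrict (box_restrict s) == s)
  = pinned (outside (@trad m) 0 n) s.
Proof.
rewrite extend_restrict; apply/andP/idP => [[/set_mem plus /eqP us]|pin].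
  apply/forall_inP => v; rewrite inE subr0 => vn; rewrite -us ffunE.
  case: pickP => // u /eqP uv; rewrite ffunE decK.
  have un : val u \in box n by apply: valP.
  have ub : val u \in boundary (box n).
    rewrite in_boundary eqn_leq -in_boxE un /=.
    by rewrite -(trad_proj_box nM un) uv.
  have := plus _ ub; rewrite /tau /tau' /torus_config un /dec /=.
  move=> [h1 h2]; have n11 : (-1 : R) <> 1 by lra.
  apply/eqP; rewrite [s _]surjective_pairing; congr pair.
    by move: h1; case: eqP.
  by move: h2; case: eqP.
have pinE (v : V) : (n <= trad v)%N -> s v = 0.
  by move=> vn; apply/eqP/(forall_inP pin); rewrite inE subr0.
split.
  apply/mem_set => u; rewrite in_boundary => /eqP un.
  have ub : u \in box n by rewrite in_boxE un.
  by rewrite /tau /tau' /torus_config ub pinE //= (trad_proj_box nM ub) un.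
apply/eqP/ffunP => v; have [vn|vn] := leqP (trad v) n.
  have [u un <-] := proj_in_box vn.
  by rewrite (unrestrictE _ [` un]%fset) ffunE decK.
rewrite (pinE v) ?(ltnW vn) // ffunE; case: pickP => // u /eqP uv.
by rewrite ffunE decK uv pinE // ltnW.
Qed.

Lemma tau_torus s u : u \in box n -> tau (torus_config s) u = sg R (s (torus_proj u)).1.
Proof. by move=> un; rewrite /tau /torus_config un. Qed.

Lemma tau'_torus s u : u \in box n -> tau' (torus_config s) u = sg R (s (torus_proj u)).2.
Proof. by move=> un; rewrite /tau' /torus_config un. Qed.

Lemma pmean_reindex b f : pmean n (b * J) (b * U) f =
  (\sum_(s | pinned (outside (@trad m) 0 n) s)
      AT_weight (box n) (b * J) (b * U) (torus_config s) * f (torus_config s)) /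
  \sum_(s | pinned (outside (@trad m) 0 n) s) AT_weight (box n) (b * J) (b * U) (torus_config s).
Proof.
rewrite /pmean; congr (_ / _);
  rewrite (reindex_onto box_restrict box_unrestrict) /= => [|g _]; rewrite ?unrestrictK //;
  by apply: eq_big => s; rewrite ?plus_restrict // => _; rewrite extend_restrict.
Qed.

(** An edge with both ends pinned has energy [bond_energy J U 0]; once this value is subtracted, the
    sum over the torus reduces to the edges of the box. *)
Lemma AT_energy_torus s : pinned (outside (@trad m) 0 n) s ->
  \sum_(e <- edges (box n)) (J * tau (torus_config s) e.1 * tau (torus_config s) e.2
     + J * tau' (torus_config s) e.1 * tau' (torus_config s) e.2
     + U * tau (torus_config s) e.1 * tau' (torus_config s) e.1 * tau (torus_config s) e.2 * tau' (torus_config s) e.2)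
  = \sum_(x : V * bool) (bond_energy J U (s x.1 - s (x.1 + tdir m x.2)) - bond_energy J U 0)
    + \sum_(e <- edges (box n)) bond_energy J U 0.
Proof.
move=> pin; have pinE (v : V) : (n <= trad v)%N -> s v = 0.
  by move=> vn; apply/eqP/(forall_inP pin); rewrite inE subr0.
pose F (x : V * bool) := bond_energy J U (s x.1 - s (x.1 + tdir m x.2)) - bond_energy J U 0.
have -> : \sum_x F x = \sum_(e <- edges (box n)) F (edge_proj e).
  have uq : uniq (map edge_proj (edges (box n))).
    by rewrite map_inj_in_uniq ?fset_uniq //; apply: (edge_proj_inj nM).
  rewrite -(big_map edge_proj xpredT F) (big_uniq _ uq) /=.
  rewrite [LHS](bigID (fun x => x \in map edge_proj (edges (box n)))) /= [X in _ + X]big1 ?addr0 //.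
  move=> [v d] vd; rewrite /F /=; have [h1|h1] := ltnP (trad v) n.
    by have [e en ed] := @edge_proj_surj m n nM v d (or_introl h1); rewrite -ed map_f in vd.
  have [h2|h2] := ltnP (trad (v + tdir m d)) n.
    by have [e en ed] := @edge_proj_surj m n nM v d (or_intror h2); rewrite -ed map_f in vd.
  by rewrite !pinE // subr0 subrr.
rewrite -big_split /= big_seq [RHS]big_seq; apply: eq_bigr => e en.
have := en; rewrite in_edges => /and3P[e1 e2 _].
rewrite !tau_torus // !tau'_torus // /F -(edge_proj_tgt nM en) subrK /bond_energy /= !sgB.
by ring.
Qed.

Lemma sweightE_energy b s :
  sweight (@tdir m) (@bond_sat R J U) (rho (kappa (J := J) (U := U)) b) s =
  expR (b * (\sum_(x : V * bool) (bond_energy J U (s x.1 - s (x.1 + tdir m x.2)) - bond_energy J U 0)))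
  * expR (b * (\sum_(x : V * bool) (bond_energy J U 0 - (if U <= J then U - 2 * J else - U)))).
Proof.
rewrite -expRD -mulrDr -big_split /= /sweight.
have -> : \prod_(x : V * bool * bond_kind J U)
   (1 + rho (kappa (J := J) (U := U)) b x.2 * (satisfied (@tdir m) (@bond_sat R J U) x s)%:R) =
  \prod_(x : V * bool * bond_kind J U)
   expR (b * (kappa x.2 * (bond_sat x.2 (s x.1.1 - s (x.1.1 + tdir m x.1.2)))%:R)).
  apply: eq_bigr => x _; rewrite /satisfied /src /tgt /rho.
  by case: bond_sat; rewrite ?mulr1 ?mulr0 ?expR0 ?addr0 // addrC subrK.
rewrite -expR_sum -mulr_sumr; congr (expR (b * _)).
rewrite -(pair_bigA _ (fun (x : V * bool) (t : bond_kind J U) =>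
   kappa t * (bond_sat t (s x.1 - s (x.1 + tdir m x.2)))%:R)) /=.
by apply: eq_bigr => x _; rewrite bond_energyE // addrA subrK.
Qed.

(** On pinned spins the weights of the box and of the torus differ by a constant factor, which
    cancels in the mean. *)
Lemma pmeanE b f : pmean n (b * J) (b * U) f =
  smean (@tdir m) (@bond_sat R J U) (rho (kappa (J := J) (U := U)) b)
    (outside (@trad m) 0 n) (fun s => f (torus_config s)).
Proof.
rewrite pmean_reindex /smean.
pose c : R := expR (b * \sum_(e <- edges (box n)) bond_energy J U 0) /
  expR (b * (\sum_(x : V * bool) (bond_energy J U 0 - (if U <= J then U - 2 * J else - U)))).
have wE s : pinned (outside (@trad m) 0 n) s -> AT_weight (box n) (b * J) (b * U) (torus_config s) =
    c * sweight (@tdir m) (@bond_sat R J U) (rho (kappa (J := J) (U := U)) b) s.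
  have abc (A B E : R) : B != 0 -> A / B * (E * B) = E * A by move=> ?; field.
  move=> pin; rewrite sweightE_energy /c abc ?gt_eqF ?expR_gt0 // -expRD -mulrDr.
  rewrite -AT_energy_torus // mulr_sumr /AT_weight; congr expR.
  by apply: eq_bigr => e _; ring.
have c0 : c != 0 by rewrite mulf_neq0 ?invr_eq0 ?gt_eqF ?expR_gt0.
under eq_bigr do rewrite wE //.
under [X in _ / X]eq_bigr do rewrite wE //.
under eq_bigr do rewrite -mulrA.
by rewrite -!mulr_sumr invfM mulrACA divff // mul1r.
Qed.

End Link.

Section Observables.
Variable R : realType.
Local Notation K := ('Z_2 * 'Z_2)%type.

Definition phi_tau (x : K) : bool := x.1 != 0.
Definition phi_tau' (x : K) : bool := x.2 != 0.
Definition phi_sigma (x : K) : bool := x.1 != x.2.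

Lemma phi_tau_form : xor_form phi_tau.
Proof. by move=> [a ?] [b ?]; rewrite /phi_tau /=; case: (Z2P a) => ->; case: (Z2P b) => ->. Qed.

Lemma phi_tau'_form : xor_form phi_tau'.
Proof. by move=> [? a] [? b]; rewrite /phi_tau' /=; case: (Z2P a) => ->; case: (Z2P b) => ->. Qed.

Lemma phi_sigma_form : xor_form phi_sigma.
Proof.
by move=> [a c] [b d]; rewrite /phi_sigma /=; case: (Z2P a) => ->; case: (Z2P b) => ->;
  case: (Z2P c) => ->; case: (Z2P d) => ->.
Qed.

Definition obs (phi : K -> bool) (u : vertex) (s : config) : R := (-1) ^+ phi (enc (s u)).

Lemma obs_tau u s : obs phi_tau u s = tau s u.
Proof. by rewrite /obs /phi_tau /tau; case: (s u) => -[] []. Qed.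

Lemma obs_tau' u s : obs phi_tau' u s = tau' s u.
Proof. by rewrite /obs /phi_tau' /tau'; case: (s u) => -[] []. Qed.

Lemma obs_sigma u s : obs phi_sigma u s = tau s u * tau' s u.
Proof.
by rewrite /obs /phi_sigma /tau /tau'; case: (s u) => -[] []; rewrite /= ?mulr1 ?mul1r ?mulrNN ?mulr1.
Qed.

Lemma obs_torus m n phi u (s : {ffun 'Z_m.+2 * 'Z_m.+2 -> K}) : u \in box n ->
  obs phi u (torus_config n s) = chi_at R phi (torus_proj m u) s.
Proof. by move=> un; rewrite /obs /torus_config un decK. Qed.

End Observables.

(** * Magnetizations and two-point functions of the model *)

Section Model.
Variables (R : realType) (J U : R).
Hypothesis J_gt0 : 0 < J.
Hypothesis U_gt0 : 0 < U.
Local Notation K := ('Z_2 * 'Z_2)%type.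
Local Notation T := (bond_kind J U).
Local Notation kt := (@bond_sat R J U).
Local Notation kap := (kappa (J := J) (U := U)).
Implicit Types (b : R) (phi : K -> bool).

Lemma kt0 t : kt t 0. Proof. exact: kind_sat0. Qed.

Lemma ktB t x y : kt t x -> kt t y -> kt t (x - y).
Proof. exact: kind_satB. Qed.

Definition relevant phi (t : T) : bool := [forall x, kt t x ==> ~~ phi x].

Lemma relevant_phi phi t x : relevant phi t -> kt t x -> phi x = false.
Proof. by move=> /forallP/(_ x)/implyP h /h/negPf. Qed.

Definition mg phi n b : R := pmean n (b * J) (b * U) (obs R phi origin).

(** Every torus that is large enough gives the same value, so quantities at different radii can be
    compared in a common torus. *)
Lemma mgE m phi n b : (4 * n + 4 <= m.+2)%N ->
  mg phi n b = magn (@tdir m) kt (@trad m) phi (rho kap b) n.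
Proof.
move=> nm; rewrite /mg (pmeanE nm J_gt0 U_gt0) /magn; congr (_ / _).
by apply: eq_bigr => s _; rewrite obs_torus ?in_boxE.
Qed.

Lemma rho_pos b t : 0 < b -> 0 < rho kap b t.
Proof. by move=> b0; apply: rho_gt0 => //; apply: kappa_gt0. Qed.

Lemma mg_incr phi n b b' : xor_form phi -> 0 < b -> b <= b' -> mg phi n b <= mg phi n b'.
Proof.
move=> phiP b0 bb'; rewrite !(@mgE (4 * n + 4)) //; try lia.
apply: (magn_incr _ kt0 ktB _ phiP) => // t; first exact: rho_pos.
by apply: rho_incr => // t'; apply: kappa_gt0.
Qed.

Lemma mg_decr phi n b : xor_form phi -> 0 < b -> mg phi n.+1 b <= mg phi n b.
Proof.
move=> phiP b0; rewrite !(@mgE (4 * n + 8)) //; try lia.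
by apply: (magn_incr _ kt0 ktB _ phiP) => // t; apply: rho_pos.
Qed.

Lemma mg_ge0 phi n b : xor_form phi -> 0 < b -> 0 <= mg phi n b.
Proof.
move=> phiP b0; rewrite (@mgE (4 * n + 4)); last by lia.
by apply: (magn_ge0 _ kt0 ktB _ phiP) => t; apply: rho_pos.
Qed.

Lemma kappa_lower : exists2 k0 : R, 0 < k0 & forall t : T, k0 <= kap t.
Proof.
exists ((1 + \sum_(t : T) (kap t)^-1)^-1).
  rewrite invr_gt0 ltr_pwDl // sumr_ge0 // => t _.
  by rewrite invr_ge0 ltW // kappa_gt0.
move=> t; have t0 := kappa_gt0 t; rewrite invf_ple ?posrE //; last first.
  rewrite ltr_pwDl // sumr_ge0 // => t' _.
  by rewrite invr_ge0 ltW // kappa_gt0.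
rewrite (bigD1 t) //= addrCA lerDl addr_ge0 // sumr_ge0 // => t' _.
by rewrite invr_ge0 ltW // kappa_gt0.
Qed.

Lemma both_gt0 : 0 < coupling J U (inord 3).
Proof.
rewrite /coupling (_ : val (inord 3 : 'I_4) = 3%N) /=; last by rewrite inordK.
by case: ifP => _; rewrite mulr_gt0.
Qed.

(** This kind is present for all J and U and forces every [phi] to be constant, so it can serve as
    [t0] in the Peierls argument. *)
Definition both : T := exist _ (inord 3) both_gt0.

Lemma bond_sat_both x : kt both x = (x == 0).
Proof. by rewrite /bond_sat /kind_sat /= inordK. Qed.

Section Form.
Variables (phi : K -> bool) (g : K).
Hypothesis phiP : xor_form phi.
Hypothesis phi_g : phi g.
Hypothesis irl_g : forall t : T, ~~ relevant phi t -> kt t g.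

Lemma relevant_both : relevant phi both.
Proof.
apply/forallP => x; apply/implyP; rewrite bond_sat_both => /eqP->.
by rewrite form0.
Qed.

Lemma mg0 b : 0 < b -> mg phi 0 b = 1.
Proof.
move=> b0; have r0 := fun t : T => rho_pos t b0.
rewrite (@mgE 4) // /magn (smean_reach _ kt0 ktB phiP (@relevant_phi phi) phi_g irl_g) //.
have Z : \sum_w bweight (@tdir 4) kt (rho kap b) (outside (@trad 4) 0 0) w != 0.
  by rewrite gt_eqF // sum_bweight_gt0 //; apply: kt0.
rewrite -[RHS](wmean_cst 1 Z); apply: eq_wmean => w _.
by rewrite (_ : reach _ _ _ _ _) //; apply/exists_inP; exists 0; rewrite ?inE ?connect0.
Qed.

Lemma mg_differential : exists2 k : R, 0 < k & forall n, exists theta dtheta : R -> R,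
  forall b, 0 < b ->
  [/\ is_derive b 1 theta (dtheta b), mg phi n.*2 b <= theta b, theta b <= mg phi n b
    & k * n%:R * (theta b * (1 - theta b)) <= magn_sum (mg phi) n b * dtheta b].
Proof.
have [k0 k0_gt0 k0P] := kappa_lower; exists (k0 / 4); first by rewrite divr_gt0.
(* Radii up to 2n have to fit in one torus; the 4 of [k0 / 4] is that of [theta_osss]. *)
move=> n; pose m := (8 * n + 8)%N.
have mE i b : (i <= n.*2)%N ->
    mg phi i b = magn (@tdir m) kt (@trad m) phi (rho kap b) i.
  by move=> ni; apply: mgE; rewrite /m; lia.
pose th b := theta (@tdir m) kt (@trad m) (relevant phi) (rho kap b) n.
pose mu b := bweight (@tdir m) kt (rho kap b) (outside (@trad m) 0 n.*2).
pose cv b x := wcov (mu b) (fun w => (x \in w)%:R)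
   (fun w => (crossing (@tdir m) (@trad m) (relevant phi) n w)%:R).
exists th, (fun b => \sum_x drho kap b x.2 * cv b x) => b b0.
have r0 := fun t : T => rho_pos t b0.
split.
- by apply: is_derive_wmean => //; [exact: kt0|exact: kappa_gt0].
- by rewrite mE //; apply: (magn_le_theta _ kt0 ktB _ phiP (@relevant_phi phi) phi_g irl_g).
- rewrite mE -?addnn ?leq_addr //.
  exact: (theta_le_magn _ kt0 ktB _ phiP (@relevant_phi phi) phi_g irl_g).
have := theta_osss kt0 ktB (@trad0 m) (@tradD m) (@tradN m) (@trad_dir m) phiP
   (@relevant_phi phi) phi_g irl_g n r0.
rewrite -/(th b) => h.
have -> : magn_sum (mg phi) n b = \sum_(i < n) magn (@tdir m) kt (@trad m) phi (rho kap b) i.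
  by apply: eq_bigr => i _; rewrite mE // -addnn (leq_trans (ltnW (ltn_ord i))) ?leq_addr.
have M0 : 0 <= \sum_(i < n) magn (@tdir m) kt (@trad m) phi (rho kap b) i.
  by apply: sumr_ge0 => i _; apply: (magn_ge0 _ kt0 ktB _ phiP).
have cv0 x : 0 <= cv b x.
  apply: fkg => [w||X Y|X Y XY|X Y XY].
  - by apply/ltW/bweight_gt0 => //; apply: kt0.
  - by apply: sum_bweight_gt0 => //; apply: kt0.
  - by apply: bweight_lattice => //; [exact: kt0|exact: ktB].
  - exact: indic_incr.
  - by rewrite ler_nat; case: (boolP (crossing _ _ _ n X)) => // /(crossing_incr XY)->.
apply: (@le_trans _ _ ((\sum_(i < n) magn (@tdir m) kt (@trad m) phi (rho kap b) i) *
   (k0 * \sum_(x | relevant phi x.2) cv b x))).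
  rewrite [leLHS](_ : _ = k0 / 4 * (n%:R * (th b * (1 - th b)))); last by ring.
  rewrite [leRHS](_ : _ = k0 / 4 * (4 * (\sum_(i < n) magn (@tdir m) kt (@trad m) phi (rho kap b) i)
     * \sum_(x | relevant phi x.2) cv b x)); last by field.
  by rewrite ler_pM2l // divr_gt0.
rewrite ler_wpM2l // mulr_sumr big_mkcond /=; apply: ler_sum => x _.
case: ifP => _.
  rewrite ler_wpM2r //; apply: le_trans (k0P _) _.
  by apply: drho_ge => //; apply: kappa_gt0.
rewrite mulr_ge0 //; apply: le_trans (ltW (kappa_gt0 _)) _.
by apply: drho_ge => //; apply: kappa_gt0.
Qed.

Lemma mg_exponential_decay b b' : 0 < b -> b < b' ->
  (mg phi n b' @[n --> \oo] --> 0)%classic ->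
  exists c C : R, [/\ 0 < c, 0 < C & forall n, mg phi n b <= C * expR (- (c * n%:R))].
Proof.
have [k k0 kP] := mg_differential.
apply: (exponential_decay k0 _ mg0 _ _ kP) => [n x|n x|n x y].
- exact: mg_ge0.
- exact: mg_decr.
- exact: mg_incr.
Qed.

Lemma mg_high_temperature : exists2 b, 0 < b & (mg phi n b @[n --> \oo] --> 0)%classic.
Proof.
pose S b := \sum_(t : T | relevant phi t) rho kap b t.
have [b b0 Sb] : exists2 b, 0 < b & 4 * S b <= 2^-1.
  (* For b = 1 / (16 Q) every [b * kap t] is at most 1/16, where exp x - 1 <= 2 x; then 4 S <= 8 b Q
     = 1/2. *)
  pose Q := 1 + \sum_(t : T) kap t.
  have Q1 : 1 <= Q by rewrite lerDl sumr_ge0 // => t _; apply/ltW/kappa_gt0.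
  have Q0 : 0 < Q by apply: lt_le_trans Q1.
  have kQ t : kap t <= Q.
    rewrite /Q (bigD1 t) //= addrCA lerDl addr_ge0 // sumr_ge0 // => t' _.
    exact/ltW/kappa_gt0.
  pose b := (16 * Q)^-1; have b0 : 0 < b by rewrite invr_gt0 mulr_gt0.
  have bQ : b * Q = 16^-1 by rewrite /b invfM divfK ?gt_eqF.
  have rb t : rho kap b t <= 2 * (b * kap t).
    have kt0' := kappa_gt0 t; set x := b * kap t.
    have x0 : 0 < x by rewrite mulr_gt0.
    have x1 : x <= 16^-1 by rewrite -bQ ler_pM2l.
    have h := expR_ge1Dx (- x); rewrite /rho -/x.
    have e0 : 0 < expR x by apply: expR_gt0.
    have : (1 - x) * expR x <= 1.
      by rewrite -[leRHS](expRxMexpNx_1 x) mulrC ler_pM2l.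
    nra.
  exists b => //; apply: (@le_trans _ _ (4 * (2 * (b * Q)))); last by rewrite bQ; lra.
  rewrite ler_pM2l // /S; apply: (@le_trans _ _ (\sum_(t | relevant phi t) 2 * (b * kap t))).
    by apply: ler_sum => t _; apply: rb.
  rewrite -!mulr_sumr ler_pM2l // ler_pM2l // /Q [X in _ <= 1 + X](bigID (relevant phi)) /=.
  rewrite addrCA lerDl addr_ge0 // sumr_ge0 // => t _; exact/ltW/kappa_gt0.
exists b => //.
have r0 := fun t : T => rho_pos t b0.
have step n : mg phi n.+1 b <= 2^-1 * mg phi n b.
  rewrite !(@mgE (4 * n + 8)) //; try lia.
  apply: le_trans (magn_high_temperature kt0 ktB (@trad0 _) (@tradD _) (@tradN _)
    (@trad_dir _) phiP (@relevant_phi phi) phi_g irl_g n r0) _.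
  by rewrite ler_wpM2r //; apply: (magn_ge0 _ kt0 ktB _ phiP).
have geo n : mg phi n b <= 2^-1 ^+ n.
  elim: n => [|n IHn]; first by rewrite mg0.
  by apply: le_trans (step n) _; rewrite exprS ler_pM2l // invr_gt0.
apply: (@squeeze_cvgr _ _ _ _ (fun=> 0) (fun n => 2^-1 ^+ n)).
- by apply: nearW => n; rewrite mg_ge0 //= geo.
- exact: cvg_cst.
- by apply: cvg_expr; rewrite ger0_norm ?invr_ge0 // invf_lt1 // ltr1n.
Qed.

Lemma mg_low_temperature : exists2 b, 0 < b & forall n, 2 / 3 <= mg phi n b.
Proof.
pose k : R := #|{: K}|%:R; have k0 : 0 < k by apply: card_K_gt0.
have kb := kappa_gt0 both.
(* By exp x - 1 >= x this choice provides the 16 of [magn_low_temperature]. *)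
exists (16 * k / kap both); first by rewrite divr_gt0 // mulr_gt0.
have b0 : 0 < 16 * k / kap both by rewrite divr_gt0 // mulr_gt0.
move=> n; rewrite (@mgE (4 * n + 4)); last by lia.
apply: (magn_low_temperature kt0 ktB phiP (@relevant_phi phi) phi_g irl_g relevant_both).
- by move=> t; apply: rho_pos.
- by lia.
have h := expR_ge1Dx (16 * k / kap both * kap both).
rewrite divfK ?gt_eqF // in h; rewrite /rho divfK ?gt_eqF //.
have : 16 <= (expR (16 * k) - 1) / k by rewrite ler_pdivlMr // lerBrDl.
by rewrite -/k; lra.
Qed.

(** The empty set of bonds has positive weight and does not connect the origin to radius 1. The
    strict inequality serves to remove the prefactor of the exponential bound. *)
Lemma mg1_lt1 b : 0 < b -> mg phi 1 b < 1.
Proof.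
move=> b0; have r0 := fun t : T => rho_pos t b0.
rewrite (@mgE 8) // /magn (smean_reach _ kt0 ktB phiP (@relevant_phi phi) phi_g irl_g) //.
set W := outside _ _ _; rewrite /bprob /wmean ltr_pdivrMr; last first.
  by apply: sum_bweight_gt0 => //; apply: kt0.
rewrite mul1r (bigD1 finset.set0) //= [ltRHS](bigD1 finset.set0) //= ltr_leD //.
  rewrite (_ : reach _ _ _ _ _ = false) ?mulr0.
    by apply: bweight_gt0 => //; apply: kt0.
  apply: negbTE; apply/exists_inP => -[v vW /connectP[[|x p] /=]].
    by move=> _ v0; move: vW; rewrite v0 inE subr0 trad0.
  by case/andP=> h _; case/exists_inP: h => y; rewrite inE.
apply: ler_sum => w _; rewrite ler_piMr //; last by rewrite lern1 leq_b1.
by apply/ltW/bweight_gt0 => //; apply: kt0.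
Qed.

End Form.

Local Notation tdir := (@tdir _).

Lemma pmean_smean m n b (f : config -> R) (chi : {ffun 'Z_m.+2 * 'Z_m.+2 -> K} -> R) :
  (4 * n + 4 <= m.+2)%N -> (forall s, f (torus_config n s) = chi s) ->
  pmean n (b * J) (b * U) f = smean tdir kt (rho kap b) (outside (@trad m) 0 n) chi.
Proof.
move=> nm fchi; rewrite (pmeanE nm J_gt0 U_gt0) /smean; congr (_ / _).
by apply: eq_bigr => s _; rewrite fchi.
Qed.

(** [true] marks a factor tau and [false] a factor tau'; a spin may occur several times. *)
Definition cchar (l : seq (bool * vertex)) (s : config) : R :=
  \prod_(x <- l) obs R (if x.1 then phi_tau else phi_tau') x.2 s.

Definition tchar m (l : seq (bool * vertex)) (s : {ffun 'Z_m.+2 * 'Z_m.+2 -> K}) : R :=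
  \prod_(x <- l) chi_at R (if x.1 then phi_tau else phi_tau') (torus_proj m x.2) s.

Lemma is_char1 m : is_char (fun _ : {ffun 'Z_m.+2 * 'Z_m.+2 -> K} => 1 : R).
Proof. by split=> *; [rewrite mulr1|left]. Qed.

Lemma tchar_char m l : is_char (@tchar m l).
Proof.
elim: l => [|x l IHl].
  rewrite (_ : tchar [::] = fun=> 1); first exact: is_char1.
  by apply/funext => s; rewrite /tchar big_nil.
rewrite (_ : tchar (x :: l) = fun s => chi_at R (if x.1 then phi_tau else phi_tau')
  (torus_proj m x.2) s * tchar l s); last by apply/funext => s; rewrite /tchar big_cons.
apply: is_charM IHl; apply: chi_at_char.
by case: x.1; [exact: phi_tau_form|exact: phi_tau'_form].
Qed.

Lemma cchar_torus m n l (s : {ffun 'Z_m.+2 * 'Z_m.+2 -> K}) :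
  (forall x, x \in l -> x.2 \in box n) -> cchar l (torus_config n s) = tchar l s.
Proof.
move=> ln; rewrite /cchar /tchar big_seq [RHS]big_seq; apply: eq_bigr => x xl.
by rewrite obs_torus // ln.
Qed.

Lemma pmean_cchar_decr n l b : 0 < b -> (forall x, x \in l -> x.2 \in box n) ->
  pmean n.+1 (b * J) (b * U) (cchar l) <= pmean n (b * J) (b * U) (cchar l).
Proof.
move=> b0 ln; have ln' x : x \in l -> x.2 \in box n.+1.
  by move=> /ln; rewrite !in_boxE => /leqW.
rewrite !(@pmean_smean (4 * n + 8) _ _ _ (tchar l)); try by [lia|move=> s; apply: cchar_torus].
apply: (smean_char_incr tdir kt0 ktB (@tchar_char (4 * n + 8) l)) => // [t|]; first exact: rho_pos.
exact: outsideS.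
Qed.

Lemma pmean_cchar_ge0 n l b : 0 < b -> (forall x, x \in l -> x.2 \in box n) ->
  0 <= pmean n (b * J) (b * U) (cchar l).
Proof.
move=> b0 ln; rewrite (@pmean_smean (4 * n + 8) _ _ _ (tchar l)); try by [lia|move=> s; apply: cchar_torus].
by apply: (smean_char_ge0 tdir kt0 ktB _ (@tchar_char (4 * n + 8) l)) => t; apply: rho_pos.
Qed.

Definition corr phi n b (x : vertex) : R :=
  pmean n (b * J) (b * U) (fun s => obs R phi origin s * obs R phi x s).

(** Shrinking the box to radius |x| raises the mean and pins the spin at x to 1. *)
Lemma corr_le_mg phi n b x : xor_form phi -> 0 < b -> (supnorm x <= n)%N ->
  corr phi n b x <= mg phi (supnorm x) b.
Proof.
move=> phiP b0 xn; pose m := (4 * n + 4)%N; have nm : (4 * n + 4 <= m.+2)%N by rewrite /m; lia.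
pose chi u := chi_at R phi (torus_proj m u).
have chiP u : is_char (chi u) by apply: chi_at_char.
rewrite /corr (@pmean_smean m _ _ _ (fun s => chi origin s * chi x s)) //; last first.
  by move=> s; rewrite !obs_torus ?in_boxE.
rewrite /mg (@pmean_smean m _ _ _ (chi origin)); first last.
- by move=> s; rewrite !obs_torus ?in_boxE.
- by apply: leq_trans nm; rewrite leq_add2r leq_mul2l.
have h := @smean_char_incr R _ _ _ tdir kt kt0 ktB (rho kap b) (rho kap b)
  (outside (@trad m) 0 n) (outside (@trad m) 0 (supnorm x)) _ (is_charM (chiP origin) (chiP x)).
apply: le_trans (h _ _ _) _ => //; first by move=> t; apply: rho_pos.
  exact: outsideS.
rewrite le_eqVlt; apply/orP; left; apply/eqP; congr (_ / _).
apply: eq_bigr => s /forall_inP pin; congr (_ * _).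
rewrite [chi x s]/chi_at (eqP (pin _ _)) ?form0 ?mulr1 // inE subr0 trad_proj //.
by apply: leq_trans nm; rewrite -addnn; lia.
Qed.

(** Griffiths' inequality separates the two spins. The box of radius n + |x| about x contains the
    box of radius n about the origin, so its magnetization bounds the mean at x from below. *)
Lemma mg_le_corr phi n b x : xor_form phi -> 0 < b -> (supnorm x <= n)%N ->
  mg phi n b * mg phi (n + supnorm x) b <= corr phi n b x.
Proof.
move=> phiP b0 xn; pose m := (8 * n + 8)%N.
have nm : (4 * n + 4 <= m.+2)%N by rewrite /m; lia.
have r0 := fun t : T => rho_pos t b0.
pose chi u := chi_at R phi (torus_proj m u).
have chiP u : is_char (chi u) by apply: chi_at_char.
rewrite /corr (@pmean_smean m _ _ _ (fun s => chi origin s * chi x s)) //; last first.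
  by move=> s; rewrite !obs_torus ?in_boxE.
apply: le_trans (smean_gks _ kt0 ktB _ (chiP origin) (chiP x) r0).
rewrite (@mgE m phi n) // (@mgE m phi (n + _)); last by rewrite /m; lia.
rewrite ler_wpM2l //; first by apply: (smean_char_ge0 _ kt0 ktB _ (chiP origin)).
rewrite -(smean_shift _ _ _ _ _ (torus_proj m x)).
apply: (smean_char_incr _ kt0 ktB (chiP x)) => //.
apply/fintype.subsetP => v; rewrite !inE subr0 => h.
have xx : trad (torus_proj m x) = supnorm x by apply: trad_proj; rewrite /m -addnn; lia.
have t := tradD v (- torus_proj m x); rewrite tradN xx in t.
by rewrite -(leq_add2r (supnorm x)); apply: leq_trans h t.
Qed.

Lemma corr_sigma_ge n b x : 0 < b -> (supnorm x <= n)%N ->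
  corr phi_tau n b x * corr phi_tau' n b x <= corr phi_sigma n b x.
Proof.
move=> b0 xn; pose m := (4 * n + 4)%N; have nm : (4 * n + 4 <= m.+2)%N by rewrite /m; lia.
have r0 := fun t : T => rho_pos t b0.
pose chi phi u := chi_at R phi (torus_proj m u).
have E phi : corr phi n b x = smean tdir kt (rho kap b) (outside (@trad m) 0 n)
    (fun s => chi phi origin s * chi phi x s).
  by apply: pmean_smean => // s; rewrite !obs_torus ?in_boxE.
rewrite !E; set A := (X in _ <= smean _ _ _ _ X).
rewrite (_ : A = fun s => (chi phi_tau origin s * chi phi_tau x s) *
   (chi phi_tau' origin s * chi phi_tau' x s)).
  apply: (smean_gks _ kt0 ktB) => //; apply: is_charM; apply: chi_at_char;
    by [exact: phi_tau_form|exact: phi_tau'_form].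
have sigmaE u s : chi phi_sigma u s = chi phi_tau u s * chi phi_tau' u s.
  rewrite /chi /chi_at -signr_addb; congr (_ ^+ nat_of_bool _).
  rewrite /phi_tau /phi_tau' /phi_sigma; case: (s _) => a c /=.
  by case: (Z2P a) => ->; case: (Z2P c) => ->.
by apply/funext => s; rewrite /A !sigmaE mulrACA.
Qed.

(** Only the kind of tau', when U <= J, or that of tau tau', when J < U, can be irrelevant to tau.
    The former is satisfied by flipping tau alone, the latter by flipping both spins. *)
Lemma irrelevant_tau t : ~~ relevant phi_tau t -> kt t (1, if U <= J then 0 else 1).
Proof.
apply: contraR => nt; apply/forallP => x; apply/implyP.
move: nt (kappa_gt0 t); rewrite /bond_sat /kappa; move: (val t) => k.
rewrite /coupling /kind_sat /phi_tau; case: k => [[|[|[|[|k]]]]] //= _.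
- by move=> _ _ /eqP->.
- by case: ifP => //= _ _; rewrite ltxx.
- by case: ifP => //= _ _; rewrite ltxx.
- by move=> _ _ /eqP->.
Qed.

(** For J < U the kinds present are those of tau tau' and of the pair, both relevant, so no kind is
    left to be satisfied. *)
Lemma irrelevant_sigma t : J < U -> ~~ relevant phi_sigma t -> kt t (1, 0).
Proof.
move=> JU; apply: contraR => nt; apply/forallP => x; apply/implyP.
move: nt (kappa_gt0 t); rewrite /bond_sat /kappa; move: (val t) => k.
rewrite /coupling /kind_sat /phi_sigma leNgt JU; case: k => [[|[|[|[|k]]]]] //= _.
- by rewrite ltxx.
- by move=> _ _ /eqP->; rewrite eqxx.
- by move=> _ _ /eqP->; rewrite eqxx.
Qed.

(** The element (1, 0) flips tau as well as tau tau', and it satisfies the bonds irrelevant to tau.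
    Triviality of the character of tau tau' thus already yields a connection by bonds relevant to
    tau. *)
Lemma mg_sigma_le n b : 0 < b -> U <= J -> mg phi_sigma n b <= mg phi_tau n b.
Proof.
move=> b0 UJ; pose m := (4 * n + 4)%N; have nm : (4 * n + 4 <= m.+2)%N by rewrite /m; lia.
have r0 := fun t : T => rho_pos t b0.
rewrite !(@mgE m) // /magn !smean_char //; try exact: kt0; try exact: ktB;
  try (apply: chi_at_char; by [exact: phi_sigma_form|exact: phi_tau_form]).
apply: ler_wmean => [w|w _]; first by apply/ltW/bweight_gt0 => //; apply: kt0.
rewrite ler_nat; case: (boolP (triv _ _ (chi_at R phi_sigma 0) _ w)) => // h.
suff -> : triv tdir kt (chi_at R phi_tau 0) (outside (@trad m) 0 n) w by [].
apply: (@reach_triv R _ _ _ _ _ (relevant phi_tau)) => //.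
- exact: phi_tau_form.
- exact: relevant_phi.
apply: (triv_reach (R := R) (psi := phi_sigma) (g := (1, 0)) kt0 ktB _ _ _ h) => // t ht.
by have := irrelevant_tau ht; rewrite UJ.
Qed.

Lemma mg_tau_swap n b : mg phi_tau' n b = mg phi_tau n b.
Proof.
pose sw (s : {ffun box n -> bool * bool}) := [ffun u => ((s u).2, (s u).1)].
have swK : involutive sw by move=> s; apply/ffunP => u; rewrite !ffunE; case: (s u).
have ext s u : extend (sw s) u = ((extend s u).2, (extend s u).1).
  by rewrite /extend; case: insubP => // v _ _; rewrite ffunE.
have tauE s u : tau (extend (sw s)) u = tau' (extend s) u :> R by rewrite /tau ext.
have tau'E s u : tau' (extend (sw s)) u = tau (extend s) u :> R by rewrite /tau' ext.
have plus s : (extend (sw s) \in plus_boundary R (box n)) = (extend s \in plus_boundary R (box n)).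
  apply/idP/idP => /set_mem h; apply/mem_set => u /h; rewrite tauE tau'E => -[]; tauto.
have w s : AT_weight (box n) (b * J) (b * U) (extend (sw s)) =
    AT_weight (box n) (b * J) (b * U) (extend s).
  by rewrite /AT_weight; congr expR; apply: eq_bigr => e _; rewrite !tauE !tau'E; ring.
rewrite /mg /pmean [X in X / _ = _](reindex_inj (inv_inj swK)).
rewrite [X in _ / X = _](reindex_inj (inv_inj swK)) /=.
congr (_ / _); apply: eq_big => s; rewrite ?plus // => _; rewrite ?w //.
by rewrite !(obs_tau, obs_tau') tau'E.
Qed.

End Model.

(** * The infinite-volume measure *)

Section Cylinders.
Local Open Scope classical_set_scope.

Lemma cylinder0 : cylinder set0.
Proof. by exists fset0. Qed.

Lemma cylinderC A : cylinder A -> cylinder (~` A).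
Proof.
move=> [V AV]; exists V => s t st nAs At; apply: nAs; apply: AV At => u uV.
by rewrite st.
Qed.

Lemma cylinderU A B : cylinder A -> cylinder B -> cylinder (A `|` B).
Proof.
move=> [V AV] [W BW]; exists (V `|` W)%fset => s t st [As|Bs].
  by left; apply: AV As => u uV; apply: st; rewrite in_fsetU uV.
by right; apply: BW Bs => u uW; apply: st; rewrite in_fsetU uW orbT.
Qed.

Definition config_space : Type := prod_topology (fun _ : vertex => (bool * bool)%type).

HB.instance Definition _ := Pointed.on config_space.
HB.instance Definition _ := Nbhs.on config_space.
HB.instance Definition _ := Topological.on config_space.

Lemma config_space_compact : compact [set: config_space].
Proof.
have := tychonoff (fun _ : vertex => compact_setX bool_compact bool_compact).
by congr (compact _); apply/seteqP; split.
Qed.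

Lemma near_eq (s : config_space) (u : vertex) : \forall t \near s, (t : config) u = s u.
Proof.
have h := @proj_continuous _ (fun _ : vertex => (bool * bool)%type) u s [set y | y = s u]. apply: h.
exists ([set (s u).1], [set (s u).2]) => [|[a b] /= [-> ->]]; last by rewrite -surjective_pairing.
by split; rewrite nbhs_principalE; apply/principal_filterP.
Qed.

Lemma cylinder_open (A : set config_space) : cylinder A -> open A.
Proof.
move=> [V AV]; rewrite openE => s As; rewrite /interior.
have sV : \forall t \near s, forall u : V, (t : config) (val u) = s (val u).
  apply: (@filter_forall _ V (fun u t => (t : config) (val u) = s (val u)) (nbhs s) (nbhs_filter s)) => u.
  exact: near_eq.
apply: filterS sV => t ts; apply: AV As => u uV.
by rewrite (ts [` uV]%fset).
Qed.

(** Cylinder events are open and closed in a compact space, so countable covers reduce to finite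
    ones and finite additivity is enough for a measure. *)
Lemma cylinder_subcover (A : set config) (F : nat -> set config) :
  cylinder A -> (forall n, cylinder (F n)) -> A `<=` \bigcup_n F n ->
  exists n, A `<=` \big[setU/set0]_(k < n) F k.
Proof.
move=> cA cF AF.
have := config_space_compact; rewrite compact_cover.
(* The index [None] carries the complement of [A], which completes the cover to one of the whole
   space. *)
pose G (k : option nat) : set config_space := if k is Some k then F k else ~` A.
have Go k : setT k -> open (G k).
  by case: k => [k|] _; apply: cylinder_open; [exact: cF | exact: cylinderC].
have Gc : [set: config_space] `<=` cover setT G.
  move=> s _; have [/AF[k _ Fk]|nA] := pselect (A s); first by exists (Some k).
  by exists None.
move=> /(_ _ _ _ Go Gc)[D _ DG].
exists (\max_(k <- D) (odflt 0%N k).+1)%N => s As.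
have [[k|] /= kD Gs] := DG s I; last by case: Gs.
rewrite -bigcup_mkord; exists k => //=.
apply: (@leq_bigmax_seq _ (D : seq _) xpredT (fun k => (odflt 0%N k).+1) (Some k)) => //.
Qed.

End Cylinders.

Definition cylinder_space : Type := config.
HB.instance Definition _ := Pointed.copy cylinder_space (vertex -> (bool * bool)%type).
HB.instance Definition _ := @isAlgebraOfSets.Build default_measure_display cylinder_space
  cylinder cylinder0 cylinderU cylinderC.

Section Extension.
Variable R : realType.
Local Open Scope classical_set_scope.
Variable mu : set config -> R.
Hypothesis mu_ge0 : forall A, cylinder A -> 0 <= mu A.
Hypothesis mu1 : mu setT = 1.
Hypothesis mu_add : forall A B, cylinder A -> cylinder B -> A `&` B = set0 ->
  mu (A `|` B) = mu A + mu B.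

Definition cyl_content (A : set cylinder_space) : \bar R :=
  if `[< cylinder A >] then (mu A)%:E else 0%E.

Lemma cyl_contentE A : cylinder A -> cyl_content A = (mu A)%:E.
Proof. by move=> /asboolT; rewrite /cyl_content => ->. Qed.

Lemma cyl_content_ge0 A : (0 <= cyl_content A)%E.
Proof. by rewrite /cyl_content; case: asboolP => // cA; rewrite lee_fin mu_ge0. Qed.

Lemma cyl_content_additive : measure_function.semi_additive cyl_content.
Proof.
have c0 := cylinder0.
apply/additive2P.
  rewrite cyl_contentE //; congr _%:E; apply: (addIr (mu set0)).
  by rewrite -mu_add ?setU0 ?setI0 // add0r.
move=> A B cA cB AB; rewrite !cyl_contentE ?mu_add //.
exact: cylinderU.
Qed.

HB.instance Definition _ := isContent.Build _ _ _ cyl_content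
  cyl_content_ge0 cyl_content_additive.

Lemma cyl_content_sigma_subadditive : measurable_subset_sigma_subadditive cyl_content.
Proof.
move=> A F mF mA AF.
have [n An] := cylinder_subcover mA mF AF.
have /le_trans -> // : (cyl_content A <= \sum_(k < n) cyl_content (F k))%E.
  by apply: (@content_subadditive _ _ _ (cyl_content : {content set cylinder_space -> \bar R})) => // k _; exact: mF.
rewrite -(big_mkord xpredT (fun k => cyl_content (F k))).
by apply: nneseries_lim_ge => k _ _; exact: cyl_content_ge0.
Qed.

HB.instance Definition _ := Content_SigmaSubAdditive_isMeasure.Build _ _ _ cyl_content
  cyl_content_sigma_subadditive.

Definition cyl_measure := measure_extension cyl_content.
HB.instance Definition _ := Measure.on cyl_measure.

Lemma cyl_measureE A : cylinder A -> cyl_measure A = (mu A)%:E.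
Proof. by move=> cA; rewrite -(cyl_contentE cA); exact: (measurable_mu_extE cyl_content). Qed.

Lemma cyl_measureT : cyl_measure setT = 1%E.
Proof. by rewrite cyl_measureE ?mu1 // -setC0; apply: cylinderC; exact: cylinder0. Qed.

HB.instance Definition _ := Measure_isProbability.Build _ _ R cyl_measure cyl_measureT.

Theorem cylinder_extension : exists P : probability configM R,
  forall A, cylinder A -> P A = (mu A)%:E.
Proof. by exists (cyl_measure : probability _ _) => A; exact: cyl_measureE. Qed.
End Extension.

(** * Existence of the plus limit *)

Section PlusMeanLinear.
Variables (R : realType) (J U : R).
Implicit Types (f : config -> R).

Lemma eq_pmean n f h : f =1 h -> pmean n J U f = pmean n J U h.
Proof. by move=> fh; rewrite /pmean; congr (_ / _); apply: eq_bigr => s _; rewrite fh. Qed.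

Lemma pmean_sum n (I : Type) (r : seq I) (a : I -> R) (f : I -> config -> R) :
  pmean n J U (fun s => \sum_(i <- r) a i * f i s) = \sum_(i <- r) a i * pmean n J U (f i).
Proof.
rewrite /pmean; under [RHS]eq_bigr do rewrite mulrA mulr_sumr.
rewrite -mulr_suml; congr (_ / _); rewrite exchange_big /=; apply: eq_bigr => s _.
by rewrite mulr_sumr; apply: eq_bigr => i _; rewrite mulrCA.
Qed.

Lemma pmean_lin n (a c : R) f h :
  pmean n J U (fun s => a * f s + c * h s) = a * pmean n J U f + c * pmean n J U h.
Proof.
have := @pmean_sum n bool [:: true; false] (fun i => if i then a else c) (fun i => if i then f else h).
rewrite !big_cons big_nil addr0 => <-.
by apply: eq_pmean => s; rewrite !big_cons big_nil addr0.
Qed.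

Lemma pmean1 n : pmean n J U (fun=> 1) = 1.
Proof.
rewrite /pmean; under eq_bigr do rewrite mulr1; rewrite divff // gt_eqF //.
rewrite (bigD1 [ffun=> (true, true)]) /= ?ltr_pwDl ?expR_gt0 ?sumr_ge0 // => [s _|]; first exact: expR_ge0.
by apply/mem_set => u _; rewrite /tau /tau' /extend; case: insubP => // v _ _; rewrite ffunE.
Qed.

Lemma pmean_ge0 n f : (forall s, 0 <= f s) -> 0 <= pmean n J U f.
Proof.
by move=> f0; apply: divr_ge0; apply: sumr_ge0 => s _; rewrite ?mulr_ge0 ?expR_ge0.
Qed.

End PlusMeanLinear.

Section Limit.
Local Open Scope classical_set_scope.
Variables (R : realType) (J U : R).
Hypothesis J_gt0 : 0 < J.
Hypothesis U_gt0 : 0 < U.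
Variable b : R.
Hypothesis b_gt0 : 0 < b.

Lemma is_cvgMr_const (a : R) (u : nat -> R) : cvgn u -> cvgn (fun n => a * u n).
Proof. by move=> /cvg_ex[l ul]; apply/cvg_ex; exists (a * l); exact: cvgMr. Qed.

Lemma is_cvg_sum_const (I : Type) (r : seq I) (a : I -> R) (u : I -> nat -> R) :
  (forall i, cvgn (u i)) -> cvgn (fun n => \sum_(i <- r) a i * u i n).
Proof.
move=> cu; elim: r => [|i r IHr].
  by under eq_fun do rewrite big_nil; exact: is_cvg_cst.
by under eq_fun do rewrite big_cons; apply: is_cvgD => //; exact: is_cvgMr_const.
Qed.

Lemma cvg_cchar l : cvgn (fun n => pmean n (b * J) (b * U) (cchar R l)).
Proof.
(* Monotonicity in n is available once the box contains all the vertices of [l]. *)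
pose n0 := (\max_(x <- l) supnorm x.2)%N.
have ln n x : x \in l -> x.2 \in box (n + n0)%N.
  move=> xl; rewrite in_boxE; apply: (leq_trans _ (leq_addl n n0)).
  exact: (@leq_bigmax_seq _ l xpredT (fun x => supnorm x.2)).
have : cvgn (fun n => pmean (n + n0) (b * J) (b * U) (cchar R l)).
  apply: nonincreasing_is_cvgn.
    by apply/nonincreasing_seqP => n; rewrite addSn; apply: pmean_cchar_decr => // x /ln.
  by exists 0 => _ [n _ <-]; apply: pmean_cchar_ge0 => // x /ln.
move=> /cvg_ex[r hr]; apply/cvg_ex; exists r.
by rewrite -(cvg_shiftn n0).
Qed.

(** Each factor is the indicator that a spin equals (-1) ^+ x.2, that is -1 for [true]; the product
    tests a spin pattern. *)
Definition spin_test (r : seq ((bool * vertex) * bool)) (s : config) : R :=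
  \prod_(x <- r) ((1 + (-1) ^+ x.2 * cchar R [:: x.1] s) / 2).

(** The character of [l] is there for the induction: expanding one factor of the test moves its spin
    into [l]. *)
Lemma cvg_spin_test l r :
  cvgn (fun n => pmean n (b * J) (b * U) (fun s => cchar R l s * spin_test r s)).
Proof.
elim: r l => [|x r IHr] l.
  rewrite (_ : (fun n => _) = fun n => pmean n (b * J) (b * U) (cchar R l)); first exact: cvg_cchar.
  by apply/funext => n; apply: eq_pmean => s; rewrite /spin_test big_nil mulr1.
rewrite (_ : (fun n => _) = fun n =>
    2^-1 * pmean n (b * J) (b * U) (fun s => cchar R l s * spin_test r s)
    + ((-1) ^+ x.2 / 2) * pmean n (b * J) (b * U) (fun s => cchar R (x.1 :: l) s * spin_test r s)).
  by apply: is_cvgD; apply: is_cvgMr_const; exact: IHr.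
apply/funext => n; rewrite -pmean_lin; apply: eq_pmean => s.
by rewrite /spin_test /cchar !big_cons big_nil; field.
Qed.

Definition spin_pattern (V : {fset vertex}) (g : {ffun V -> bool * bool}) :=
  flatten [seq [:: ((true, val u), ~~ (g u).1); ((false, val u), ~~ (g u).2)] | u <- enum {: V}].

Lemma spin_patternE (V : {fset vertex}) (g : {ffun V -> bool * bool}) s :
  spin_test (spin_pattern g) s = [forall u : V, s (val u) == g u]%:R.
Proof.
have E (u : V) : (1 + (-1) ^+ (~~ (g u).1) * cchar R [:: (true, val u)] s) / 2 *
   ((1 + (-1) ^+ (~~ (g u).2) * cchar R [:: (false, val u)] s) / 2) = (s (val u) == g u)%:R :> R.
  rewrite /cchar !big_cons !big_nil /= !mulr1 obs_tau obs_tau' /tau /tau'.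
  by case: (s _) (g u) => [[] []] [[] []] /=; rewrite ?expr0 ?expr1; field.
rewrite /spin_test big_flatten big_map /=.
under eq_bigr do rewrite !big_cons big_nil mulr1 E.
rewrite big_enum /=; apply/esym; case: forallP => [h|nh].
  by rewrite big1 // => u _; rewrite h.
have [u nu] : exists u : V, ~~ (s (val u) == g u).
  by apply: contrapT => h; apply: nh => u; apply/negPn/negP => nu; apply: h; exists u.
by rewrite (bigD1 u) //= (negbTE nu) mul0r.
Qed.

(** A cylinder event is a disjoint union of finitely many spin patterns on [V]. *)
Lemma cvg_AT_plus (A : set config) : cylinder A ->
  cvgn (fun n => AT_plus (box n) (b * J) (b * U) A).
Proof.
move=> [V AV].
rewrite (_ : (fun n => _) = fun n => \sum_(g : {ffun V -> bool * bool})
   (extend g \in A)%:R * pmean n (b * J) (b * U) (spin_test (spin_pattern g))).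
  apply: is_cvg_sum_const => g.
  rewrite (_ : (fun n => _) = fun n => pmean n (b * J) (b * U) (fun s => cchar R [::] s * spin_test (spin_pattern g) s)).
    exact: cvg_spin_test.
  by apply/funext => n; apply: eq_pmean => s; rewrite /cchar big_nil mul1r.
apply/funext => n /=; rewrite AT_plusE -pmean_sum; apply: eq_pmean => s.
pose h : {ffun V -> bool * bool} := [ffun u => s (val u)].
have sh u : u \in V -> s u = extend h u.
  by move=> uV; rewrite /extend insubT ffunE.
rewrite (bigD1 h) //= big1 ?addr0 => [|g gh]; last first.
  rewrite spin_patternE; case: forallP; rewrite ?mulr0 // => gs.
  by case/eqP: gh; apply/ffunP => u; rewrite ffunE (eqP (gs u)).
rewrite spin_patternE (_ : [forall u : V, _] = true) ?mulr1; last by apply/forallP => u; rewrite ffunE.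
congr (_%:R); congr nat_of_bool; apply/idP/idP => /set_mem sA; apply/mem_set; apply: AV sA => // u uV.
by rewrite sh.
Qed.

Lemma AT_plus_limit_exists : exists P : probability configM R, is_AT_plus_limit (b * J) (b * U) P.
Proof.
pose mu (A : set config) := limn (fun n => AT_plus (box n) (b * J) (b * U) A).
have muE A : cylinder A -> AT_plus (box n) (b * J) (b * U) A @[n --> \oo] --> mu A.
  exact: cvg_AT_plus.
have [| |A B cA cB AB|P PE] := @cylinder_extension R mu.
- move=> A /cvg_AT_plus cA; apply: limr_ge => //; apply: nearW => n.
  by rewrite AT_plusE pmean_ge0.
- apply/cvg_lim => //; rewrite (_ : (fun n => _) = fun=> 1); first exact: cvg_cst.
  apply/funext => n /=; rewrite AT_plusE -[RHS](pmean1 (b * J) (b * U) n); apply: eq_pmean => s.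
  by rewrite in_setT.
- rewrite -limD; try exact: cvg_AT_plus.
  congr (limn _); apply/funext => n; rewrite fctE !AT_plusE -[X in _ = X + _]mul1r -[X in _ = _ + X]mul1r -pmean_lin.
  apply: eq_pmean => s; rewrite in_setU !mul1r.
  case: (boolP (s \in A)) => [/set_mem sA|_]; last by rewrite add0r.
  by rewrite (_ : s \in B = false) ?addr0 //; apply/negP => /set_mem sB; have : set0 s by rewrite -AB.
- exists P => A cA; rewrite PE //; apply/fine_cvgP; split; first exact: nearW.
  exact: muE.
Qed.

Lemma AT_plus_infP : is_AT_plus_limit (b * J) (b * U) (AT_plus_inf (b * J) (b * U)).
Proof. by rewrite /AT_plus_inf; case: xgetP => [P -> //|] nP; have [P /nP] := AT_plus_limit_exists. Qed.

(** A function with values 1 and -1 is 2 1_B - 1, so convergence of the probabilities of cylinder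
    events is enough. *)
Lemma AT_plus_expect_lim (f : config -> R) (B : set config) : cylinder B ->
  (forall s, f s = (-1) ^+ (s \notin B)) ->
  pmean n (b * J) (b * U) f @[n --> \oo] --> AT_plus_expect (b * J) (b * U) f.
Proof.
move=> cB fB; pose P := AT_plus_inf (b * J) (b * U).
have mB : measurable (B : set configM) by apply: sub_gen_smallest.
have fE : f = fun s => 2 * \1_B s - 1.
  by apply/funext => s; rewrite fB indicE; case: (s \in B); rewrite /= ?expr0 ?expr1; lra.
have EP : AT_plus_expect (b * J) (b * U) f = 2 * fine (P B) - 1.
  have iB : \1_B \in Lfun (P : measure configM R) 1 by apply/Lfun1_integrable/integrable_indic.
  have L1 : (cst 1 : configM -> R) \in Lfun (P : measure configM R) 1 by exact: Lfun_cst.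
  rewrite /AT_plus_expect -/P (_ : f = (2 \o* \1_B) \- cst 1); last by apply/funext => s; rewrite fE /= mulrC.
  rewrite expectationB // ?Lfun_scale // expectationZl // expectation_cst expectation_indic //.
  by rewrite fineB ?fineM ?fin_numM // fin_num_measure.
rewrite EP (_ : (fun n => _) = fun n => 2 * AT_plus (box n) (b * J) (b * U) B + -1); last first.
  apply/funext => n /=; rewrite AT_plusE.
  rewrite -[X in _ + X](_ : -1 * pmean n (b * J) (b * U) (fun=> 1) = -1); last by rewrite pmean1 mulr1.
  rewrite -pmean_lin.
  by apply: eq_pmean => s; rewrite fE indicE mulr1.
apply: cvgD; last exact: cvg_cst.
have PB : P B \is a fin_num by exact: fin_num_measure.
by apply: cvgMr; have := AT_plus_infP cB; rewrite -/P -(fineK PB) => /fine_cvgP[].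
Qed.

End Limit.

(** * The critical points *)

(** Let x = c n and y = d x / (L + d). Either y <= x - L, and the given bound suffices, or y <= d,
    and m n <= m 1 <= exp(- d) suffices. *)
Lemma absorb_prefactor (R : realType) (m : nat -> R) (c C : R) : 0 < c -> 0 < C ->
  (forall n, m n <= C * expR (- (c * n%:R))) -> m 0%N <= 1 -> m 1%N < 1 ->
  {homo m : i j / (i <= j)%N >-> j <= i} ->
  exists2 c', 0 < c' & forall n, m n <= expR (- (c' * n%:R)).
Proof.
move=> c0 C0 mC m0 m1 m_decr.
(* The maximum with 1/2 keeps [q] positive, so that its logarithm is meaningful. *)
pose L := `|ln C|; pose q := Num.max (m 1%N) 2^-1; pose d := - ln q.
have q0 : 0 < q by rewrite /q lt_max invr_gt0 ltr0n orbT.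
have q1 : q < 1 by rewrite /q gt_max m1 invf_lt1 // ltr1n.
have d0 : 0 < d by rewrite /d oppr_gt0 ln_lt0 // q0.
have L0 : 0 <= L by exact: normr_ge0.
have CL : C <= expR L by rewrite -{1}(lnK C0) ler_expR ler_norm.
have Ld : 0 < L + d by rewrite ltr_wpDl.
exists (d / (L + d) * c) => [|n]; first by rewrite mulr_gt0 ?divr_gt0.
case: n => [|n]; first by rewrite mulr0 oppr0 expR0.
set x := c * n.+1%:R; have x0 : 0 < x by rewrite mulr_gt0 ?ltr0n.
set y := d / (L + d) * x.
rewrite (_ : d / (L + d) * c * n.+1%:R = y); last by rewrite /y /x mulrA.
have yE : y * (L + d) = d * x by rewrite /y mulrAC divfK // gt_eqF.
have [xy|xy] := leP (L - x) (- y).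
  apply: (le_trans (mC _)); apply: (le_trans (ler_wpM2r (expR_ge0 _) CL)).
  by rewrite -expRD ler_expR.
have yd : y <= d by rewrite leNgt; apply/negP => dy; nra.
apply: (le_trans (m_decr 1%N n.+1 isT)); apply: (@le_trans _ _ q).
  by rewrite /q le_max lexx.
by rewrite -[q]lnK // ler_expR -[ln q]opprK lerN2.
Qed.

Section Norm.
Variables (R : realType) (N : 'rV[R]_2 -> R).
Hypothesis normN : is_norm N.

Lemma is_norm_ge0 v : 0 <= N v.
Proof.
have [_ NZ ND] := normN.
have N0 : N 0 = 0 by rewrite -[0](scale0r (0 : 'rV[R]_2)) NZ normr0 mul0r.
have NN : N (- v) = N v by rewrite -scaleN1r NZ normrN1 mul1r.
by have := ND v (- v); rewrite subrr N0 NN; lra.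
Qed.

Lemma is_norm_supnorm : exists2 c : R, 0 < c & forall x, N (to_plane R x) <= c * (supnorm x)%:R.
Proof.
have [_ NZ ND] := normN.
pose e (i : 'I_2) : 'rV[R]_2 := delta_mx 0 i.
exists (N (e 0) + N (e 1) + 1) => [|x]; first by rewrite ltr_wpDl ?addr_ge0 ?is_norm_ge0.
rewrite (_ : to_plane R x = x.1%:~R *: e 0 + x.2%:~R *: e 1); last first.
  apply/rowP => i; rewrite !mxE; case: i => [[|[|//]] ?] /=;
  by rewrite ?mulr1 ?mulr0 ?addr0 ?add0r.
apply: (le_trans (ND _ _)); rewrite !NZ.
have xs (z : int) : (`|z|%N <= supnorm x)%N -> `|z%:~R| <= (supnorm x)%:R :> R.
  by rewrite -(@ler_nat R) natr_absz intr_norm.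
have h1 : `|x.1%:~R| <= (supnorm x)%:R :> R by apply: xs; rewrite leq_maxl.
have h2 : `|x.2%:~R| <= (supnorm x)%:R :> R by apply: xs; rewrite leq_maxr.
have := ler_wpM2r (is_norm_ge0 (e 0)) h1; have := ler_wpM2r (is_norm_ge0 (e 1)) h2.
rewrite !mulrDl mul1r ![N _ * _]mulrC => p1 p2.
by rewrite -[X in X <= _]addr0; apply: lerD; rewrite ?ler0n // lerD.
Qed.

End Norm.

Section Assembly.
Variables (R : realType) (J U : R).
Hypothesis J_gt0 : 0 < J.
Hypothesis U_gt0 : 0 < U.
Local Notation mg := (mg J U).
Local Notation corr := (corr J U).
Local Notation two_point phi b x := (AT_plus_expect (b * J) (b * U)
  (fun s => obs R phi origin s * obs R phi x s)).

Lemma corr_cvg phi b x : 0 < b -> (corr phi n b x @[n --> \oo] --> two_point phi b x)%classic.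
Proof.
move=> b0; apply: (@AT_plus_expect_lim R J U J_gt0 U_gt0 b b0 _
  [set s : config | phi (enc (s origin)) = phi (enc (s x))]%classic).
  exists [fset origin; x]%fset => s t st /=.
  have -> : s origin = t origin by apply: st; rewrite !inE eqxx.
  by have -> : s x = t x by apply: st; rewrite !inE eqxx orbT.
move=> s; rewrite /obs -signr_addb; congr (_ ^+ nat_of_bool _).
rewrite -in_setC; apply/idP/idP.
  by move=> h; apply/mem_set => /= e; rewrite e addbb in h.
by move=> /set_mem /=; case: (phi _); case: (phi _).
Qed.

Lemma two_point_le_mg phi b x : xor_form phi -> 0 < b -> two_point phi b x <= mg phi (supnorm x) b.
Proof.
move=> phiP b0; rewrite -(cvg_lim (@Rhausdorff R) (@corr_cvg phi b x b0)) //.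
apply: limr_le; first by apply/cvg_ex; eexists; exact: corr_cvg.
by near=> n; apply: corr_le_mg => //; near: n; exact: nbhs_infty_ge.
Unshelve. all: by end_near. Qed.

Lemma two_point_ge phi b x (m : R) : 0 < b -> (forall n, (supnorm x <= n)%N -> m <= corr phi n b x) ->
  m <= two_point phi b x.
Proof.
move=> b0 mc; rewrite -(cvg_lim (@Rhausdorff R) (@corr_cvg phi b x b0)) //.
apply: limr_ge; first by apply/cvg_ex; eexists; exact: corr_cvg.
by near=> n; apply: mc; near: n; exact: nbhs_infty_ge.
Unshelve. all: by end_near. Qed.

Lemma mg_nonincreasing phi b : xor_form phi -> 0 < b -> {homo mg phi ^~ b : i j / (i <= j)%N >-> j <= i}.
Proof. by move=> phiP b0; apply/nonincreasing_seqP => n; exact: mg_decr. Qed.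

(** The threshold is the supremum of the inverse temperatures at which the magnetization tends to 0.
    Below it, some such point lies strictly above b; above it, the nonincreasing magnetizations have
    a positive limit, which bounds them from below. *)
Lemma critical_point phi g : xor_form phi -> phi g ->
  (forall t : bond_kind J U, ~~ relevant phi t -> bond_sat t g) ->
  exists bc : R, [/\ 0 < bc,
    forall b, 0 < b -> b < bc ->
      exists2 c, 0 < c & forall n, mg phi n b <= expR (- (c * n%:R))
  & forall b, bc < b -> exists2 m, 0 < m & forall n, m <= mg phi n b].
Proof.
move=> phiP phi_g irl.
pose S := [set b : R | 0 < b /\ mg phi n b @[n --> \oo] --> (0 : R)]%classic.
have [b1 b1_gt0 b1S] := mg_high_temperature J_gt0 U_gt0 phiP phi_g irl.
have [b2 b2_gt0 b2low] := mg_low_temperature J_gt0 U_gt0 phiP phi_g irl.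
have S1 : S b1 by [].
have Sb : has_sup S.
  split; first by exists b1.
  exists b2 => b [b0 mb]; rewrite leNgt; apply/negP => b2b.
  have : 2 / 3 <= (0 : R).
    rewrite -(cvg_lim (@Rhausdorff R) mb) //; apply: limr_ge; first by apply/cvg_ex; exists 0.
    by apply: nearW => n; apply: (le_trans (b2low n)); apply: mg_incr => //; exact: ltW.
  by lra.
have ub b : S b -> b <= sup S by exact: sup_upper_bound.
exists (sup S); split=> [|b b0 bS|b Sb'].
- exact: lt_le_trans (ub _ S1).
- have e0 : 0 < sup S - b by rewrite subr_gt0.
  have [b' [b'0 mb']] := sup_adherent e0 Sb; rewrite subKr => bb'.
  have [c [C [c0 C0 mC]]] := mg_exponential_decay J_gt0 U_gt0 phiP phi_g irl b0 bb' mb'.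
  apply: (@absorb_prefactor _ (mg phi ^~ b) c C) => //.
  + by rewrite /= (mg0 J_gt0 U_gt0 phiP phi_g irl b0).
  + exact: (mg1_lt1 J_gt0 U_gt0 phiP phi_g irl b0).
  + exact: mg_nonincreasing.
- have b0 : 0 < b by apply: lt_trans Sb'; apply: lt_le_trans (ub _ S1).
  have cm : cvgn (mg phi ^~ b).
    apply: nonincreasing_is_cvgn; first exact: mg_nonincreasing.
    by exists 0 => _ [n _ <-]; exact: mg_ge0.
  exists (limn (mg phi ^~ b)) => [|n]; last by apply: nonincreasing_cvgn_ge => //; exact: mg_nonincreasing.
  rewrite lt_neqAle; apply/andP; split; last by apply: limr_ge => //; apply: nearW => n; exact: mg_ge0.
  apply/eqP => m0; move: Sb'; rewrite ltNge => /negP; apply; apply: ub; split => //.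
  by rewrite m0.
Qed.

Lemma corr_tau_ge phi b (m : R) x : phi = phi_tau \/ phi = phi_tau' -> 0 < b -> 0 < m ->
  (forall n, m <= mg phi_tau n b) -> forall n, (supnorm x <= n)%N -> m * m <= corr phi n b x.
Proof.
move=> phiE b0 m0 mm n xn.
have phiP : xor_form phi by case: phiE => ->; [exact: phi_tau_form | exact: phi_tau'_form].
have mphi k : m <= mg phi k b by case: phiE => ->; rewrite ?mg_tau_swap.
by apply: le_trans (mg_le_corr J_gt0 U_gt0 phiP b0 xn); apply: ler_pM => //; exact: ltW.
Qed.

End Assembly.

Theorem mainTheorem5 (R : realType) (N : 'rV[R]_2 -> R) (hN : is_norm N)
    (J U : R) (hJ : 0 < J) (hU : 0 < U) :
  exists betac_tau betac_tautau' : R,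
    [/\ 0 < betac_tau, 0 < betac_tautau',
      (forall beta : R, 0 < beta -> beta < betac_tau ->
        exists2 c : R, 0 < c & forall x : vertex,
          AT_plus_expect (beta * J) (beta * U)
             (fun s => tau s origin * tau s x)
           <= expR (- c * N (to_plane R x))) /\
      (forall beta : R, betac_tau < beta ->
        exists2 C : R, 0 < C & forall x : vertex,
          C <= AT_plus_expect (beta * J) (beta * U)
             (fun s => tau s origin * tau s x))
    & (forall beta : R, 0 < beta -> beta < betac_tautau' ->
        exists2 c : R, 0 < c & forall x : vertex,
          AT_plus_expect (beta * J) (beta * U)
             (fun s => tau s origin * tau' s origin * tau s x * tau' s x)
           <= expR (- c * N (to_plane R x))) /\
      (forall beta : R, betac_tautau' < beta ->
        exists2 C : R, 0 < C & forall x : vertex,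
          C <= AT_plus_expect (beta * J) (beta * U)
             (fun s => tau s origin * tau' s origin * tau s x * tau' s x))].
Proof.
pose E phi b x := AT_plus_expect (b * J) (b * U) (fun s => obs R phi origin s * obs R phi x s).
have Etau b x : AT_plus_expect (b * J) (b * U) (fun s => tau s origin * tau s x) = E phi_tau b x.
  by congr AT_plus_expect; apply/funext => s; rewrite !obs_tau.
have Esigma b x : AT_plus_expect (b * J) (b * U)
    (fun s => tau s origin * tau' s origin * tau s x * tau' s x) = E phi_sigma b x.
  by congr AT_plus_expect; apply/funext => s; rewrite !obs_sigma mulrA.
have [K K0 NK] := is_norm_supnorm hN.
have decay phi b c : 0 < c -> (forall x, E phi b x <= expR (- (c * (supnorm x)%:R))) ->
    exists2 c' : R, 0 < c' & forall x, E phi b x <= expR (- c' * N (to_plane R x)).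
  move=> c0 Ec; exists (c / K) => [|x]; first exact: divr_gt0.
  apply: (le_trans (Ec x)); rewrite ler_expR mulNr lerN2 -mulrA ler_pM2l //.
  by rewrite mulrC ler_pdivrMr // mulrC.
have [bt [bt0 bt_lt bt_gt]] := critical_point hJ hU phi_tau_form (g := (1, if U <= J then 0 else 1))
  isT (@irrelevant_tau R J U).
have tau_part : (forall b, 0 < b -> b < bt -> exists2 c : R, 0 < c & forall x,
      E phi_tau b x <= expR (- c * N (to_plane R x))) /\
    (forall b, bt < b -> exists2 C : R, 0 < C & forall x, C <= E phi_tau b x).
  split=> [b b0 /(bt_lt _ b0)[c c0 mc]|b btb].
    apply: (decay _ _ c c0) => x; apply: le_trans (mc _).
    exact: (two_point_le_mg hJ hU x phi_tau_form b0).
  have b0 := lt_trans bt0 btb; have [m m0 mm] := bt_gt _ btb.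
  exists (m * m) => [|x]; first exact: mulr_gt0.
  apply: (two_point_ge hJ hU b0) => n; apply: (corr_tau_ge hJ hU) => //; by left.
suff [bs [bs0 bs_lt bs_gt]] : exists bs : R, [/\ 0 < bs,
    forall b, 0 < b -> b < bs -> exists2 c : R, 0 < c & forall x,
      E phi_sigma b x <= expR (- (c * (supnorm x)%:R))
  & forall b, bs < b -> exists2 C : R, 0 < C & forall x, C <= E phi_sigma b x].
  exists bt, bs; split => //; split.
  - move=> b b0 bb; have [c c0 h] := tau_part.1 b b0 bb.
    by exists c => // x; rewrite Etau.
  - by move=> b bb; have [c c0 h] := tau_part.2 b bb; exists c => // x; rewrite Etau.
  - move=> b b0 bb; have [c c0 h] := bs_lt b b0 bb.
    by have [c' c'0 h'] := decay _ _ _ c0 h; exists c' => // x; rewrite Esigma.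
  - by move=> b bb; have [c c0 h] := bs_gt b bb; exists c => // x; rewrite Esigma.
have [UJ|JU] := leP U J.
  exists bt; split=> // [b b0 /(bt_lt _ b0)[c c0 mc]|b btb].
    exists c => // x; apply: le_trans (mc _); apply: le_trans (mg_sigma_le hJ hU _ b0 UJ).
    exact: (two_point_le_mg hJ hU x phi_sigma_form b0).
  have b0 := lt_trans bt0 btb; have [m m0 mm] := bt_gt _ btb.
  have mm0 : 0 < m * m by exact: mulr_gt0.
  (* One factor m m bounds the two-point function of tau, the other that of tau'. *)
  exists (m * m * (m * m)) => [|x]; first exact: mulr_gt0.
  apply: (two_point_ge hJ hU b0) => n xn; apply: le_trans (corr_sigma_ge hJ hU b0 xn).
  by apply: ler_pM; rewrite ?(ltW mm0) //; apply: (corr_tau_ge hJ hU) => //; [left|right].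
have [bs [bs0 bs_lt bs_gt]] := critical_point hJ hU phi_sigma_form (g := (1, 0)) isT
  (fun t => @irrelevant_sigma R J U t JU).
exists bs; split=> // [b b0 /(bs_lt _ b0)[c c0 mc]|b bsb].
  exists c => // x; apply: le_trans (mc _).
  exact: (two_point_le_mg hJ hU x phi_sigma_form b0).
have b0 := lt_trans bs0 bsb; have [m m0 mm] := bs_gt _ bsb.
exists (m * m) => [|x]; first exact: mulr_gt0.
apply: (two_point_ge hJ hU b0) => n xn.
apply: le_trans (mg_le_corr hJ hU phi_sigma_form b0 xn).
by apply: ler_pM => //; exact: ltW.
Qed.
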